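(* Let $k$ be a field of characteristic zero. Let $\alpha\in\mathbb{R}_{>0}^n$ and set $N=\dim_{\mathbb{Q}}(\mathbb{Q}\alpha_1+\cdots+\mathbb{Q}\alpha_n)$. Let $\gamma_1,\dots,\gamma_s$ be homogeneous elements with respect to $\nu_\alpha$ and let $P(Z)\in\mathcal V_\alpha[\langle\gamma_1,\dots,\gamma_s\rangle][Z]$ be a monic polynomial. Then there exist integral homogeneous elements $\gamma'_1,\dots,\gamma'_N$ with respect to $\nu_\alpha$ such that $P(Z)$ has all its roots in $\mathcal V_\alpha[\langle\gamma'_1,\dots,\gamma'_N\rangle]$.
   Context: Here $n\ge2$, $x=(x_1,\dots,x_n)$, $\mathbb{N}$ is the set of positive integers. A polynomial in $k[x]$ is $(\alpha)$-homogeneous of degree $i$ if each nonzero monomial $c\,x^\beta$ of it satisfies $\sum_j\alpha_j\beta_j=i$. The monomial valuation is $\nu_\alpha(\sum_\beta c_\beta x^\beta)=\min\{\sum_j\alpha_j\beta_j:c_\beta\ne0\}$, extended to $\mathrm{Frac}(k[[x]])$; $\widehat V_{\nu_\alpha}$ is the completion of its valuation ring $V_{\nu_\alpha}$ for the topology given by the ideals $\{\nu_\alpha\ge\lambda\}$, and $\widehat K_{\nu_\alpha}$ is the fraction field of $\widehat V_{\nu_\alpha}$. For $i\in\mathbb{R}$, $G_i$ is the set of $0$ and all fractions $a/b$ of nonzero $(\alpha)$-homogeneous polynomials with $\nu_\alpha(a)-\nu_\alpha(b)=i$. For a nonzero $(\alpha)$-homogeneous polynomial $\delta$, $\mathcal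 V_{\alpha,\delta}$ is the set of $A\in\widehat V_{\nu_\alpha}$ that can be written $A=\sum_{i\in\Lambda}\frac{a_i}{\delta^{m(i)}}$, where $\Lambda$ is a finitely generated sub-semigroup of $\mathbb{R}_{\ge0}$, each $a_i\in k[x]$ is $(\alpha)$-homogeneous, $m(i)\in\mathbb{N}$, $\nu_\alpha(a_i/\delta^{m(i)})=i$ (when $a_i\ne0$), and there are $a\ge0$, $b\in\mathbb{R}$ with $m(i)\le ai+b$ for all $i\in\Lambda$. $\mathcal V_\alpha$ is the union (inductive limit) of the $\mathcal V_{\alpha,\delta}$ over all $\delta$; it is a valuation ring for $\nu_\alpha$, and $\mathcal K_\alpha$ is its fraction field. Fix an algebraic closure $\Omega$ of $\widehat K_{\nu_\alpha}$ with the unique extension of $\nu_\alpha$. A homogeneous element of order $d\ge0$ with respect to $\nu_\alpha$ is $\gamma\in\Omega$ whose minimal polynomial is irreducible in $\widehat V_{\nu_\alpha}[Z]$ and of the form $Z^q+g_1Z^{q-1}+\cdots+g_q$ with $g_k\in G_{dk}$; it is integral if moreover every $g_k$ is an $(\alpha)$-homogeneous polynomial in $k[x]$. For homogeneous elements $\gamma_1,\dots,\gamma_s$, $\mathcal V_\alpha[\langle\gamma_1,\dots,\gamma_s\rangle]$ is the ring of elements of $\mathcal K_\alpha[\gamma_1,\dots,\gamma_s]$ of nonnegative valuation. *)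

(* Defs.v *)
From HB Require Import structures.
From mathcomp Require Import all_boot all_order all_algebra.
From mathcomp Require Import finmap.
From mathcomp Require Import boolp classical_sets functions reals.
From mathcomp Require Import interval_inference constructive_ereal ereal.
From mathcomp Require Import topology sequences normedtype.
From mathcomp Require mpoly.
(* The notations of multinomials clash with those of mathcomp-analysis:
   [mpoly n k] is {mpoly k[n]}, [multinom n] is 'X_{1..n},
   [mcoeff m p] is p@_m and [meval v p] is p.@[v]. *)
Import -(notations) mpoly.

Set Implicit Arguments.
Unset Strict Implicit.
Unset Printing Implicit Defensive.

Import Order.TTheory GRing.Theory Num.Theory.
Import numFieldNormedType.Exports.
Local Open Scope classical_set_scope.
Local Open Scope ring_scope.

Section ClassicalUnit.
Variable A : comNzRingType.
Implicit Types x y : A.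

Definition classical_unit : {pred A} := fun x => `[< exists y, y * x = 1 >].

Definition classical_inv x : A :=
  if pselect (exists y, y * x = 1) is left xP then sval (cid xP) else x.

Lemma classical_mulVx : {in classical_unit, left_inverse 1 classical_inv *%R}.
Proof.
by move=> x /asboolP ux; rewrite /classical_inv; case: pselect => // h; case: cid.
Qed.

Lemma classical_unitPl x y : y * x = 1 -> classical_unit x.
Proof. by move=> yx; apply/asboolP; exists y. Qed.

Lemma classical_invr_out : {in [predC classical_unit], classical_inv =1 id}.
Proof.
move=> x; rewrite inE => /asboolP nx; rewrite /classical_inv.
by case: pselect.
Qed.

End ClassicalUnit.

Record mfps (n : nat) (k : Type) := MFPS { fcoef : multinom n -> k }.

Section PowerSeriesRing.
Variables (n : nat) (k : fieldType).
Implicit Types (f g h : mfps n k) (m : multinom n) (p q : mpoly n k).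

HB.instance Definition _ := gen_eqMixin (mfps n k).
HB.instance Definition _ := gen_choiceMixin (mfps n k).

Lemma mfpsP f g : (forall m, fcoef f m = fcoef g m) -> f = g.
Proof. by case: f g => [f] [g] /= fg; congr MFPS; apply/funext. Qed.

Definition mfps_add f g := MFPS (fun m => fcoef f m + fcoef g m).
Definition mfps_opp f := MFPS (fun m => - fcoef f m).
Definition mfps_of_mpoly p := MFPS (fun m => mcoeff m p).

Definition mfps_mul f g := MFPS (fun m =>
  \sum_(b : bmultinom n (mdeg m).+1 * bmultinom n (mdeg m).+1
        | m == mnm_add b.1 b.2) fcoef f b.1 * fcoef g b.2).

Fact mfps_addA : associative mfps_add.
Proof. by move=> f g h; apply: mfpsP => m /=; rewrite addrA. Qed.
Fact mfps_addC : commutative mfps_add.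
Proof. by move=> f g; apply: mfpsP => m /=; rewrite addrC. Qed.
Fact mfps_add0 : left_id (mfps_of_mpoly 0) mfps_add.
Proof. by move=> f; apply: mfpsP => m /=; rewrite mcoeff0 add0r. Qed.
Fact mfps_addN : left_inverse (mfps_of_mpoly 0) mfps_opp mfps_add.
Proof. by move=> f; apply: mfpsP => m /=; rewrite mcoeff0 addNr. Qed.

HB.instance Definition _ := GRing.isZmodule.Build (mfps n k)
  mfps_addA mfps_addC mfps_add0 mfps_addN.

(* The ring axioms are inherited from polynomials, by truncation. *)
Definition approx d f p := forall m, (mdeg m <= d)%N -> fcoef f m = mcoeff m p.

Lemma approx_mul d f g p q :
  approx d f p -> approx d g q -> approx d (mfps_mul f g) (p * q).
Proof.
move=> fp gq m md; rewrite mcoeffM /=; apply: eq_bigr => -[b1 b2] /= _.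
rewrite fp ?gq //.
  by rewrite (leq_trans _ md) // -ltnS bmdeg.
by rewrite (leq_trans _ md) // -ltnS bmdeg.
Qed.

Lemma approx_mpoly d p : approx d (mfps_of_mpoly p) p.
Proof. by []. Qed.

Definition mfps_trunc d f : mpoly n k :=
  \sum_(b : bmultinom n d.+1) fcoef f b *: mpolyX k b.

Lemma approx_trunc d f : approx d f (mfps_trunc d f).
Proof.
move=> m md; rewrite /mfps_trunc raddf_sum /=.
rewrite (bigD1 (BMultinom (md : (mdeg m < d.+1)%N))) //= mcoeffZ mcoeffX eqxx mulr1.
rewrite big1 ?addr0 // => b; rewrite bmeqP /= => bm.
by rewrite mcoeffZ mcoeffX (negbTE bm) mulr0.
Qed.

Lemma approx_add d f g p q :
  approx d f p -> approx d g q -> approx d (f + g) (p + q).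
Proof. by move=> fp gq m md; rewrite mcoeffD -fp // -gq. Qed.

Lemma approx_eq f g :
  (forall d, exists p, approx d f p /\ approx d g p) -> f = g.
Proof.
move=> fg; apply: mfpsP => m.
by have [p [fp gp]] := fg (mdeg m); rewrite fp // gp.
Qed.

Fact mfps_mulA : associative mfps_mul.
Proof.
move=> f g h; apply: approx_eq => d.
exists (mfps_trunc d f * (mfps_trunc d g * mfps_trunc d h)).
by split; [|rewrite mulrA]; do !apply: approx_mul; apply: approx_trunc.
Qed.

Fact mfps_mulC : commutative mfps_mul.
Proof.
move=> f g; apply: approx_eq => d.
exists (mfps_trunc d f * mfps_trunc d g).
by split; [|rewrite mulrC]; apply: approx_mul; apply: approx_trunc.
Qed.

Fact mfps_mul1 : left_id (mfps_of_mpoly 1) mfps_mul.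
Proof.
move=> f; apply: approx_eq => d; exists (1 * mfps_trunc d f).
by split; [apply: approx_mul|rewrite mul1r]; try exact: approx_trunc.
Qed.

Fact mfps_mulDl : left_distributive mfps_mul +%R.
Proof.
move=> f g h; apply: approx_eq => d.
exists ((mfps_trunc d f + mfps_trunc d g) * mfps_trunc d h).
split; first by do ?[apply: approx_mul|apply: approx_add]; apply: approx_trunc.
by rewrite mulrDl; apply: approx_add; apply: approx_mul; apply: approx_trunc.
Qed.

Fact mfps_1neq0 : mfps_of_mpoly 1 != 0.
Proof.
apply/eqP => /(congr1 (fun f => fcoef f mnm0))/=.
by rewrite mcoeff1 mcoeff0 eqxx => /eqP; rewrite oner_eq0.
Qed.

HB.instance Definition _ := GRing.Zmodule_isComNzRing.Build (mfps n k)
  mfps_mulA mfps_mulC mfps_mul1 mfps_mulDl mfps_1neq0.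

HB.instance Definition _ := GRing.ComNzRing_hasMulInverse.Build (mfps n k)
  (@classical_mulVx (mfps n k)) (@classical_unitPl (mfps n k))
  (@classical_invr_out (mfps n k)).

Fact mfps_of_mpoly_is_zmod_morphism : zmod_morphism mfps_of_mpoly.
Proof. by move=> p q; apply: mfpsP => m /=; rewrite mcoeffB. Qed.

Fact mfps_of_mpoly_is_monoid_morphism : monoid_morphism mfps_of_mpoly.
Proof.
split=> // p q; apply: approx_eq => d; exists (p * q).
by split=> //; apply: approx_mul.
Qed.

HB.instance Definition _ := GRing.isZmodMorphism.Build
  (mpoly n k) (mfps n k) mfps_of_mpoly mfps_of_mpoly_is_zmod_morphism.
HB.instance Definition _ := GRing.isMonoidMorphism.Build
  (mpoly n k) (mfps n k) mfps_of_mpoly mfps_of_mpoly_is_monoid_morphism.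

End PowerSeriesRing.

(* Multiplicativity of initial forms, for a weight with finite sublevels. *)
Section InitialForm.
Variables (n : nat) (k : fieldType) (S : realDomainType) (w : multinom n -> S).
Hypothesis wD : forall m1 m2, w (mnm_add m1 m2) = w m1 + w m2.
Hypothesis w_fin : forall c, exists d, forall m, w m <= c -> (mdeg m <= d)%N.
Implicit Types (f g : mfps n k) (m : multinom n).

Definition is_initial f m0 :=
  fcoef f m0 != 0 /\ forall m, fcoef f m != 0 -> w m0 <= w m.

Lemma ex_initial f : f != 0 -> exists m, is_initial f m.
Proof.
move=> f0; have [m1 m1f] : exists m, fcoef f m != 0.
  apply: contrapT => nf; move/eqP: f0; apply; apply: mfpsP => m /=.
  by rewrite mcoeff0; apply: contrapT => /eqP fm; apply: nf; exists m.
have [d dP] := w_fin (w m1).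
pose b1 := BMultinom (dP _ (lexx _) : (mdeg m1 < d.+1)%N).
have [b /= bf bmin] := @arg_minP _ _ _ b1
  (fun b : bmultinom n d.+1 => fcoef f b != 0) (fun b => w b) m1f.
exists b; split=> // m mf; have [wm|/ltW wm] := leP (w m) (w m1).
  exact: (bmin (BMultinom (dP _ wm : (mdeg m < d.+1)%N))).
exact: le_trans (bmin b1 m1f) wm.
Qed.

Lemma mfps_mul_ge f g c e m :
    (forall m, fcoef f m != 0 -> c <= w m) ->
    (forall m, fcoef g m != 0 -> e <= w m) ->
  fcoef (f * g) m != 0 -> c + e <= w m.
Proof.
move=> fc ge; apply: contraR; rewrite -ltNge => wm /=.
apply/eqP/big1 => -[b1 b2] /= /eqP mb.
have [->|f1] := eqVneq (fcoef f b1) 0; first by rewrite mul0r.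
have [->|g2] := eqVneq (fcoef g b2) 0; first by rewrite mulr0.
have : w b1 + w b2 < c + e by rewrite -wD -mb.
by rewrite ltNge lerD ?fc ?ge.
Qed.

Definition initial_form c f : mpoly n k :=
  \sum_(b : bmultinom n (sval (cid (w_fin c))).+1 | w b == c) fcoef f b *: mpolyX k b.

Lemma initial_formE c f m :
  mcoeff m (initial_form c f) = if w m == c then fcoef f m else 0.
Proof.
rewrite /initial_form; case: (cid _) => d /= dP; rewrite raddf_sum /=.
have [wm|wm] := eqVneq (w m) c; last first.
  rewrite big1 // => b /eqP wb; rewrite mcoeffZ mcoeffX.
  by have [bm|_] := eqVneq (bmnm b) m; rewrite ?mulr0 //; case/eqP: wm; rewrite -bm.
have md : (mdeg m < d.+1)%N by rewrite ltnS dP // wm.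
rewrite (bigD1 (BMultinom md)) /= ?wm // mcoeffZ mcoeffX eqxx mulr1.
rewrite big1 ?addr0 // => b /andP[_]; rewrite bmeqP /= => bm.
by rewrite mcoeffZ mcoeffX (negbTE bm) mulr0.
Qed.

Lemma initial_form_mul f g mf mg m :
    is_initial f mf -> is_initial g mg -> w m = w mf + w mg ->
  fcoef (f * g) m = mcoeff m (initial_form (w mf) f * initial_form (w mg) g).
Proof.
move=> [_ fmin] [_ gmin] wm; rewrite mcoeffM; apply: eq_bigr => -[b1 b2] /=.
move=> /eqP mb; rewrite !initial_formE.
have wb : w b1 + w b2 = w mf + w mg by rewrite -wD -mb.
have [w1|w1] := eqVneq (w b1) (w mf).
  by have -> : w b2 = w mg; [apply: (addrI (w mf)); rewrite -wb w1|rewrite eqxx].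
rewrite mul0r.
have [->|f1] := eqVneq (fcoef f b1) 0; first by rewrite mul0r.
have [->|g2] := eqVneq (fcoef g b2) 0; first by rewrite mulr0.
have : w mf + w mg < w b1 + w b2.
  by rewrite ltr_leD ?gmin // lt_neqAle eq_sym w1 fmin.
by rewrite wb ltxx.
Qed.

Lemma is_initial_mul f g mf mg : is_initial f mf -> is_initial g mg ->
  exists2 m, is_initial (f * g) m & w m = w mf + w mg.
Proof.
move=> fP gP; pose p := initial_form (w mf) f; pose q := initial_form (w mg) g.
have nz h mh : is_initial h mh -> initial_form (w mh) h != 0.
  case=> h0 _; apply: contraNneq h0 => /(congr1 (mcoeff mh)).
  by rewrite initial_formE eqxx mcoeff0 => ->.
have pq0 : p * q != 0 by rewrite mulf_neq0 ?nz.
have [m pqm] : exists m, mcoeff m (p * q) != 0.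
  by exists (mlead (p * q)); rewrite mleadc_eq0.
have wm : w m = w mf + w mg.
  move: pqm; rewrite mcoeffM; apply: contra_neqP => /eqP wm.
  apply: big1 => -[b1 b2] /= /eqP mb; rewrite !initial_formE.
  case: eqP => w1; last by rewrite mul0r.
  case: eqP => w2; last by rewrite mulr0.
  by case/eqP: wm; rewrite mb wD w1 w2.
exists m => //; split; first by rewrite (initial_form_mul fP gP wm).
by move=> m' m'f; rewrite wm; apply: mfps_mul_ge m'f; [apply: fP.2|apply: gP.2].
Qed.

End InitialForm.

Section PowerSeriesDomain.
Variables (n : nat) (k : fieldType).

Fact mfps_integral : GRing.integral_domain_axiom (mfps n k).
Proof.
move=> f g fg0; have [//|f0] := eqVneq f 0; have [//|g0] := eqVneq g 0.
pose w (m : multinom n) : int := (mdeg m)%:Z.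
have wD m1 m2 : w (mnm_add m1 m2) = w m1 + w m2 by rewrite /w mdegD PoszD.
have w_fin c : exists d, forall m, w m <= c -> (mdeg m <= d)%N.
  exists `|c|%N => m mc; rewrite -lez_nat.
  by rewrite (le_trans mc) // abszE ler_norm.
have [mf fP] := ex_initial w_fin f0; have [mg gP] := ex_initial w_fin g0.
have [m [+ _] _] := is_initial_mul wD w_fin fP gP.
by rewrite fg0 /= mcoeff0 eqxx.
Qed.

HB.instance Definition _ :=
  GRing.ComUnitRing_isIntegral.Build (mfps n k) mfps_integral.

End PowerSeriesDomain.

Record valuation (R : realType) (D : idomainType) := Valuation {
  val_fun :> D -> \bar R;
  val_eqy : forall x, val_fun x = +oo%E <-> x = 0;
  val_neqNy : forall x, val_fun x <> -oo%E;
  valM : forall x y, val_fun (x * y) = (val_fun x + val_fun y)%E;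
  valD : forall x y, (Order.min (val_fun x) (val_fun y) <= val_fun (x + y)%R)%E
}.

Section ValuationTheory.
Variables (R : realType) (D : idomainType) (v : valuation R D).
Implicit Types x y : D.

Lemma val0 : v 0 = +oo%E. Proof. exact/(val_eqy v). Qed.

Lemma val_fin x : x != 0 -> exists r : R, v x = r%:E.
Proof.
move=> x0; case E : (v x) => [r||]; first by exists r.
- by move/(val_eqy v): E => E; rewrite E eqxx in x0.
- by have := val_neqNy E.
Qed.

Lemma val_lbound x : exists r : R, (r%:E <= v x)%E.
Proof.
have [->|/val_fin[r ->]] := eqVneq x 0; last by exists r.
by exists 0; rewrite val0 leey.
Qed.

Lemma val1 : v 1 = 0%E.
Proof.
have [r v1] := val_fin (oner_neq0 D).
by have := valM v 1 1; rewrite mulr1 v1 => -[] /eqP; rewrite -subr_eq0 opprD addNKr oppr_eq0 => /eqP ->.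
Qed.

Lemma valN x : v (- x) = v x.
Proof.
have [r v1] : exists r, v (- 1) = r%:E by apply: val_fin; rewrite oppr_eq0 oner_neq0.
have /eqP : v (- 1 * - 1) = 0%E by rewrite mulrNN mulr1 val1.
rewrite valM v1 -EFinD eqe -mulr2n mulrn_eq0 /= => /eqP r0.
by rewrite -mulN1r valM v1 r0 add0e.
Qed.

Lemma valB x y : (Order.min (v x) (v y) <= v (x - y)%R)%E.
Proof. by rewrite -(valN y); apply: valD. Qed.

Lemma valD_ge x y (c : \bar R) : (c <= v x -> c <= v y -> c <= v (x + y)%R)%E.
Proof. by move=> cx cy; apply: le_trans (valD v x y); rewrite le_min cx. Qed.

Lemma valB_ge x y (c : \bar R) : (c <= v x -> c <= v y -> c <= v (x - y)%R)%E.
Proof. by move=> cx cy; apply: valD_ge; rewrite ?valN. Qed.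

Lemma val_close x y : (v x < v (y - x)%R)%E -> v y = v x.
Proof.
move=> xy; apply/eqP; rewrite eq_le; apply/andP; split; last first.
  by rewrite -(subrK x y); apply: valD_ge => //; apply: ltW.
rewrite leNgt; apply/negP => vxy.
have : (Order.min (v y) (v (y - x)%R) <= v x)%E.
  by rewrite -[X in (_ <= v X)%E](subKr y x) valB.
by rewrite leNgt lt_min vxy xy.
Qed.

End ValuationTheory.

Local Notation "x %:F" := (@FracField.tofrac _ x).

Section FractionValuation.
Variables (R : realType) (D : idomainType) (v : valuation R D).
Implicit Types (a b : D) (x y : {fraction D}).

Definition fracval_fun x : \bar R := (v (\n_(repr x)) - v (\d_(repr x)))%E.

Lemma frac_repr x : x * (\d_(repr x))%:F = (\n_(repr x))%:F.
Proof.
have d0 := denom_ratioP (repr x).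
unlock FracField.tofrac; rewrite -{1}[x]reprK -[LHS]FracField.pi_mul.
apply/eqmodP; rewrite /= FracField.equivfE /FracField.mulf.
by rewrite !numden_Ratio ?mulr1 ?oner_neq0 // mulrC.
Qed.

Lemma fracP x : exists a b, b != 0 /\ x = a%:F / b%:F.
Proof.
exists (\n_(repr x)), (\d_(repr x)); have d0 := denom_ratioP (repr x).
by split=> //; rewrite -frac_repr mulfK // tofrac_eq0.
Qed.

Lemma fracval_funE a b : b != 0 -> fracval_fun (a%:F / b%:F) = (v a - v b)%E.
Proof.
move=> b0; set x := _ / _; rewrite /fracval_fun.
have d0 := denom_ratioP (repr x); have := frac_repr x.
move: (\n_(repr x)) (\d_(repr x)) d0 => n d d0 xdn.
have adnb : a * d = n * b.
  have xb : x * b%:F = a%:F by rewrite divfK // tofrac_eq0.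
  by apply/eqP; rewrite -tofrac_eq !tofracM -xdn mulrAC xb.
have := valM v a d; rewrite adnb valM.
have [r ->] := val_fin v b0; have [s ->] := val_fin v d0.
case: (v n) (v a) (val_neqNy (v := v) (x := n)) (val_neqNy (v := v) (x := a))
  => [p||] [q||] // _ _ [] pq.
by congr EFin; apply/eqP; rewrite subr_eq addrAC eq_sym subr_eq pq.
Qed.

Lemma fracval_tofrac a : fracval_fun a%:F = v a.
Proof. by rewrite -[a%:F]divr1 -tofrac1 fracval_funE ?oner_neq0 // val1 sube0. Qed.

Fact fracval_eqy x : fracval_fun x = +oo%E <-> x = 0.
Proof.
have [a [b [b0 ->]]] := fracP x; rewrite fracval_funE //.
have [r ->] := val_fin v b0; split.
  have [->|/(val_fin v)[s ->]//] := eqVneq a 0.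
  by rewrite tofrac0 mul0r.
move/eqP; rewrite mulf_eq0 invr_eq0 !tofrac_eq0 (negbTE b0) orbF => /eqP ->.
by rewrite val0.
Qed.

Fact fracval_neqNy x : fracval_fun x <> -oo%E.
Proof.
have [a [b [b0 ->]]] := fracP x; rewrite fracval_funE //.
have [r ->] := val_fin v b0.
by case: (v a) (val_neqNy (v := v) (x := a)).
Qed.

Fact fracvalM x y : fracval_fun (x * y) = (fracval_fun x + fracval_fun y)%E.
Proof.
have [a [b [b0 ->]]] := fracP x; have [c [d [d0 ->]]] := fracP y.
rewrite mulrACA -invfM -!tofracM !fracval_funE ?mulf_neq0 // !valM.
have [r ->] := val_fin v b0; have [s ->] := val_fin v d0.
case: (v a) (v c) (val_neqNy (v := v) (x := a)) (val_neqNy (v := v) (x := c))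
  => [p||] [q||] // _ _.
by congr EFin; rewrite opprD addrACA.
Qed.

Fact fracvalD x y :
  (Order.min (fracval_fun x) (fracval_fun y) <= fracval_fun (x + y)%R)%E.
Proof.
have [a [b [b0 ->]]] := fracP x; have [c [d [d0 ->]]] := fracP y.
have -> : a%:F / b%:F = (a * d)%:F / (b * d)%:F.
  by rewrite !tofracM -mulf_div divff ?mulr1 ?tofrac_eq0.
have -> : c%:F / d%:F = (b * c)%:F / (b * d)%:F.
  by rewrite !tofracM -mulf_div divff ?mul1r ?tofrac_eq0.
rewrite -mulrDl -tofracD !fracval_funE ?mulf_neq0 //.
have [r ->] := val_fin v (mulf_neq0 b0 d0).
have /= := valD v (a * d) (b * c).
rewrite !ge_min => /orP[] h; apply/orP; [left|right]; exact: leeD2r.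
Qed.

Definition fracval : valuation R {fraction D} :=
  Valuation fracval_eqy fracval_neqNy fracvalM fracvalD.

End FractionValuation.

Section ValuationRing.
Variables (R : realType) (K : fieldType) (v : valuation R K).

Definition vring_pred : {pred K} := fun x => (0 <= v x)%E.

Record vring := VRing { vring_val :> K; _ : vring_val \in vring_pred }.

HB.instance Definition _ := [isSub for vring_val].
HB.instance Definition _ := [Choice of vring by <:].

Fact vring_subring : subring_closed vring_pred.
Proof.
split; first by rewrite unfold_in val1.
- by move=> x y; rewrite !unfold_in; apply: valB_ge.
- by move=> x y; rewrite !unfold_in valM; apply: adde_ge0.
Qed.

HB.instance Definition _ := GRing.isSubringClosed.Build K vring_pred vring_subring.
HB.instance Definition _ := [SubChoice_isSubComNzRing of vring by <:].
HB.instance Definition _ := GRing.ComNzRing_hasMulInverse.Build vring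
  (@classical_mulVx vring) (@classical_unitPl vring) (@classical_invr_out vring).

Fact vring_integral : GRing.integral_domain_axiom vring.
Proof.
move=> x y /(congr1 vring_val)/eqP; rewrite mulf_eq0.
by move=> /orP[] /eqP xy; apply/orP; [left|right]; apply/eqP/val_inj.
Qed.

HB.instance Definition _ := GRing.ComUnitRing_isIntegral.Build vring vring_integral.

Fact vring_eqy (x : vring) : v (vring_val x) = +oo%E <-> x = 0.
Proof.
rewrite val_eqy; split=> [x0|->//]; exact: val_inj.
Qed.

Definition vring_valuation : valuation R vring := @Valuation R vring
  (fun x => v (vring_val x)) vring_eqy (fun x => @val_neqNy _ _ v _)
  (fun x y => valM v _ _) (fun x y => valD v _ _).

End ValuationRing.

(* The completion for the topology given by the ideals {v >= c}: Cauchy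
   sequences modulo null sequences. *)
Section Completion.
Variables (R : realType) (D : idomainType) (v : valuation R D).
Implicit Types s t : nat -> D.

Definition cauchy_for_val s := forall c : R, exists N, forall i j,
  (N <= i)%N -> (N <= j)%N -> (c%:E <= v (s i - s j)%R)%E.

Definition null_for_val s := forall c : R, exists N, forall i,
  (N <= i)%N -> (c%:E <= v (s i))%E.

Definition cauchy_pred : {pred nat -> D} := fun s => `[< cauchy_for_val s >].

Record cseq := CSeq { cseq_val :> nat -> D; _ : cseq_val \in cauchy_pred }.

HB.instance Definition _ := [isSub for cseq_val].
HB.instance Definition _ := [Choice of cseq by <:].

Lemma cseqP (s : cseq) : cauchy_for_val s.
Proof. by case: s => s /= /asboolP. Qed.

Lemma cauchy_lbound s : cauchy_for_val s ->
  exists M : R, exists N, forall i, (N <= i)%N -> (M%:E <= v (s i))%E.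
Proof.
move=> /(_ 0)[N sN]; have [M MN] := val_lbound v (s N).
exists (Order.min 0 M), N => i Ni; rewrite -(subrK (s N) (s i)).
apply: valD_ge; first by apply: le_trans (sN _ _ Ni (leqnn N)); rewrite lee_fin ge_min lexx.
by apply: le_trans MN; rewrite lee_fin ge_min lexx orbT.
Qed.

Fact cauchy_subring : subring_closed cauchy_pred.
Proof.
split.
- by apply/asboolP => c; exists 0%N => i j _ _; rewrite subrr val0 leey.
- move=> s t /asboolP sC /asboolP tC; apply/asboolP => c.
  have [[M sM] [N tN]] := (sC c, tC c).
  exists (maxn M N) => i j; rewrite !geq_max => /andP[Mi Ni] /andP[Mj Nj].
  rewrite (_ : _ - _ = (s i - s j) - (t i - t j)).
    by apply: valB_ge; [apply: sM|apply: tN].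
  by rewrite !opprD !opprK /= addrACA.
- move=> s t /asboolP sC /asboolP tC; apply/asboolP => c.
  have [a [A sA]] := cauchy_lbound sC; have [b [B tB]] := cauchy_lbound tC.
  have [[M sM] [N tN]] := (sC (c - b), tC (c - a)).
  exists (maxn (maxn A B) (maxn M N)) => i j; rewrite !geq_max.
  move=> /andP[/andP[Ai Bi] /andP[Mi Ni]] /andP[/andP[Aj Bj] /andP[Mj Nj]].
  rewrite (_ : _ - _ = (s i - s j) * t i + s j * (t i - t j)); last first.
    by rewrite mulrBl mulrBr addrA subrK.
  apply: valD_ge; rewrite valM.
    by rewrite -[c](subrK b) EFinD; apply: leeD; [apply: sM|apply: tB].
  by rewrite -[c](subrK a) addrC EFinD; apply: leeD; [apply: sA|apply: tN].
Qed.

HB.instance Definition _ :=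
  GRing.isSubringClosed.Build (nat -> D) cauchy_pred cauchy_subring.
HB.instance Definition _ := [SubChoice_isSubComNzRing of cseq by <:].

Definition null_pred : {pred cseq} := fun s : cseq => `[< null_for_val s >].

Lemma cauchy_not_null (s : cseq) : ~ null_for_val s ->
  exists r : R, exists N, forall i, (N <= i)%N -> v (s i) = r%:E.
Proof.
move=> sn; have [c cP] : exists c : R, forall N, exists i, (N <= i)%N /\ (v (s i) < c%:E)%E.
  apply: contrapT => nc; apply: sn => c; apply: contrapT => nN; apply: nc.
  exists c => N; apply: contrapT => ni; apply: nN; exists N => i Ni.
  by rewrite leNgt; apply/negP => si; apply: ni; exists i.
have [N sN] := cseqP s c; have [i [Ni si]] := cP N.
have [r ri] : exists r : R, v (s i) = r%:E.
  by apply: val_fin; apply/eqP => s0; move: si; rewrite s0 val0 ltNge leey.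
exists r, N => j Nj; rewrite -ri; apply: val_close.
exact: lt_le_trans si (sN _ _ Nj Ni).
Qed.

Lemma null_cst (s : cseq) (r : R) N :
  (forall i, (N <= i)%N -> v (s i) = r%:E) -> ~ null_for_val s.
Proof.
move=> sr /(_ (r + 1))[M sM].
have := sM _ (leq_maxl M N); rewrite sr ?leq_maxr // lee_fin.
by rewrite leNgt ltrDl ltr01.
Qed.

Fact null_idealr : idealr_closed null_pred.
Proof.
split.
- by apply/asboolP => c; exists 0%N => i _; rewrite val0 leey.
- apply/asboolP/(@null_cst _ 0 0%N) => i _; exact: val1.
- move=> a s t /asboolP sN /asboolP tN; apply/asboolP => c.
  have [b [B aB]] := cauchy_lbound (cseqP a).
  have [[M sM] [N tM]] := (sN (c - b), tN c).
  exists (maxn B (maxn M N)) => i; rewrite !geq_max => /and3P[Bi Mi Ni].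
  apply: valD_ge; last exact: tM.
  by rewrite valM -[c](subrK b) addrC EFinD; apply: leeD; [apply: aB|apply: sM].
Qed.

Fact null_prime : prime_idealr_closed null_pred.
Proof.
move=> s t /asboolP stN; apply: contrapT => /negP; rewrite negb_or.
move=> /andP[/asboolP/cauchy_not_null[a [A sA]] /asboolP/cauchy_not_null[b [B tB]]].
apply: (@null_cst (s * t) (a + b) (maxn A B)) stN => i.
by rewrite geq_max => /andP[Ai Bi]; rewrite valM sA // tB.
Qed.

HB.instance Definition _ := isIdealr.Build cseq null_pred null_idealr.
HB.instance Definition _ := isPrimeIdealrClosed.Build cseq null_pred null_prime.

Definition vcompletion := {ideal_quot null_pred}.

HB.instance Definition _ := GRing.ComNzRing.on vcompletion.
HB.instance Definition _ := GRing.ComNzRing_hasMulInverse.Build vcompletion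
  (@classical_mulVx vcompletion) (@classical_unitPl vcompletion)
  (@classical_invr_out vcompletion).

Fact vcompletion_integral : GRing.integral_domain_axiom vcompletion.
Proof. exact: Quotient.rquot_IdomainAxiom. Qed.

HB.instance Definition _ :=
  GRing.ComUnitRing_isIntegral.Build vcompletion vcompletion_integral.

End Completion.

Section CompletionValuation.
Variables (R : realType) (D : idomainType) (v : valuation R D).
Local Notation Dhat := (vcompletion v).
Local Notation pi := (\pi_Dhat%qT).
Implicit Types (x y : Dhat) (s t : cseq v).

Definition vcompletion_val_fun x : \bar R := limn (fun i => v (cseq_val (repr x) i)).

Lemma pi_null s : (pi s = 0) <-> null_for_val v s.
Proof.
have -> : (0 : Dhat) = pi 0 by rewrite rmorph0.
split=> [/eqP|sN].
  by rewrite -Quotient.idealrBE subr0 => /asboolP.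
by apply/eqP; rewrite -Quotient.idealrBE subr0; apply/asboolP.
Qed.

Lemma vcompletion_val_null s :
  null_for_val v s -> vcompletion_val_fun (pi s) = +oo%E.
Proof.
move=> /pi_null s0; rewrite s0 /vcompletion_val_fun.
have /pi_null rN : pi (repr (0 : Dhat)) = 0 by rewrite reprK.
apply/cvg_lim => //; apply/cvgeyPge => c.
have [N rc] := rN c; near=> i; apply: rc; near: i; exact: nbhs_infty_ge.
Unshelve. all: by end_near. Qed.

Lemma vcompletion_val_cst s (r : R) N :
    (forall i, (N <= i)%N -> v (s i) = r%:E) ->
  vcompletion_val_fun (pi s) = r%:E.
Proof.
move=> sr; rewrite /vcompletion_val_fun; set t := repr _.
have : pi (t - s) = 0 by rewrite rmorphB /= reprK subrr.
move=> /pi_null /(_ (r + 1))[M tsM].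
apply/cvg_lim => //; apply: cvg_near_cst; near=> i.
have Mi : (M <= i)%N by near: i; exact: nbhs_infty_ge.
have Ni : (N <= i)%N by near: i; exact: nbhs_infty_ge.
rewrite -(sr i Ni); apply: val_close; rewrite sr //.
by apply: lt_le_trans (tsM i Mi); rewrite lte_fin ltrDl.
Unshelve. all: by end_near. Qed.

Variant vcompletion_spec x : \bar R -> Prop :=
| VCompletion0 of x = 0 : vcompletion_spec x +oo%E
| VCompletionN0 s (r : R) N of x = pi s
    & (forall i, (N <= i)%N -> v (s i) = r%:E) : vcompletion_spec x r%:E.

Lemma vcompletionP x : vcompletion_spec x (vcompletion_val_fun x).
Proof.
have xE : x = pi (repr x) by rewrite reprK.
have [rN|/cauchy_not_null[r [N rr]]] := pselect (null_for_val v (repr x)).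
  have x0 : x = 0 by rewrite xE; apply/pi_null.
  by rewrite [in vcompletion_val_fun _]xE vcompletion_val_null //; constructor.
by rewrite [in vcompletion_val_fun _]xE (vcompletion_val_cst rr); apply: (VCompletionN0 xE rr).
Qed.

Fact vcompletion_eqy x : vcompletion_val_fun x = +oo%E <-> x = 0.
Proof.
split=> [|->]; first by case: vcompletionP.
have /pi_null := reprK (0 : Dhat); rewrite -[in X in _ -> X](reprK (0 : Dhat)).
exact: vcompletion_val_null.
Qed.

Fact vcompletion_neqNy x : vcompletion_val_fun x <> -oo%E.
Proof. by case: vcompletionP. Qed.

Fact vcompletionM x y : vcompletion_val_fun (x * y) =
  (vcompletion_val_fun x + vcompletion_val_fun y)%E.
Proof.
have vy0 : vcompletion_val_fun 0 = +oo%E by apply/vcompletion_eqy.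
case: (vcompletionP x) => [->|s r N -> sr].
  by rewrite mul0r vy0; case: (vcompletionP y).
case: (vcompletionP y) => [->|t q M -> tq]; first by rewrite mulr0 vy0.
rewrite -rmorphM -EFinD; apply: (@vcompletion_val_cst _ _ (maxn N M)) => i.
by rewrite geq_max => /andP[Ni Mi]; rewrite valM sr // tq.
Qed.

Fact vcompletionD x y :
  (Order.min (vcompletion_val_fun x) (vcompletion_val_fun y)
     <= vcompletion_val_fun (x + y)%R)%E.
Proof.
case: (vcompletionP x) => [->|s r N xs sr].
  by rewrite add0r ge_min lexx orbT.
case: (vcompletionP y) => [->|t q M yt tq].
  by rewrite addr0 -{1}(vcompletion_val_cst sr) -xs ge_min lexx.
have xyE : x + y = pi (s + t) by rewrite rmorphD xs yt.
have [stN|/cauchy_not_null[p [L stp]]] := pselect (null_for_val v (s + t)).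
  by rewrite xyE vcompletion_val_null // leey.
rewrite xyE (vcompletion_val_cst stp).
pose i := maxn L (maxn N M).
have Li : (L <= i)%N by rewrite leq_maxl.
have Ni : (N <= i)%N by rewrite /i maxnCA leq_maxl.
have Mi : (M <= i)%N by rewrite /i maxnA leq_maxr.
by rewrite -(stp i Li) -(sr i Ni) -(tq i Mi); apply: valD.
Qed.

Definition vcompletion_valuation : valuation R Dhat :=
  Valuation vcompletion_eqy vcompletion_neqNy vcompletionM vcompletionD.

Fact cst_cauchy (a : D) : (fun _ : nat => a) \in cauchy_pred v.
Proof. by apply/asboolP => c; exists 0%N => i j _ _; rewrite subrr val0 leey. Qed.

Definition to_vcompletion (a : D) : Dhat := pi (CSeq (cst_cauchy a)).

Fact to_vcompletion_is_zmod_morphism : zmod_morphism to_vcompletion.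
Proof. by move=> a b; rewrite /to_vcompletion -rmorphB; congr (pi _); apply: val_inj. Qed.

Fact to_vcompletion_is_monoid_morphism : monoid_morphism to_vcompletion.
Proof.
split; first by rewrite -[RHS](rmorph1 pi); congr (pi _); apply: val_inj.
by move=> a b; rewrite /to_vcompletion -rmorphM; congr (pi _); apply: val_inj.
Qed.

HB.instance Definition _ := GRing.isZmodMorphism.Build D Dhat
  to_vcompletion to_vcompletion_is_zmod_morphism.
HB.instance Definition _ := GRing.isMonoidMorphism.Build D Dhat
  to_vcompletion to_vcompletion_is_monoid_morphism.

Lemma to_vcompletion_val a : vcompletion_valuation (to_vcompletion a) = v a.
Proof.
have [->|a0] := eqVneq a 0; first by rewrite rmorph0 !val0.
have [r ar] := val_fin v a0; rewrite ar.
by apply: (@vcompletion_val_cst _ r 0%N) => i _.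
Qed.

End CompletionValuation.

Section MonomialValuation.
Variables (R : realType) (n : nat) (alpha : 'I_n -> {posnum R}) (k : fieldType).
Implicit Types (f g : mfps n k) (m : multinom n) (p : mpoly n k).

Definition weight m : R := \sum_(j < n) (alpha j)%:num * (m j)%:R.

Lemma weightD m1 m2 : weight (mnm_add m1 m2) = weight m1 + weight m2.
Proof.
by rewrite -big_split; apply: eq_bigr => j _; rewrite mnmDE natrD mulrDr.
Qed.

Lemma weight_ge0 m : 0 <= weight m.
Proof. by apply: sumr_ge0 => j _; rewrite mulr_ge0. Qed.

Lemma weight_fin c : exists d, forall m, weight m <= c -> (mdeg m <= d)%N.
Proof.
exists (\sum_(j < n) Num.bound (c / (alpha j)%:num))%N => m mc.
rewrite mdegE; apply: leq_sum => j _; rewrite -(ler_nat R).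
have mj : (m j)%:R <= c / (alpha j)%:num.
  rewrite ler_pdivlMr // mulrC; apply: le_trans mc.
  rewrite /weight (bigD1 j) //= lerDl; apply: sumr_ge0 => i _.
  by rewrite mulr_ge0.
have c0 : 0 <= c / (alpha j)%:num by rewrite (le_trans _ mj).
by rewrite (le_trans mj) // ltW // archi_boundP.
Qed.

(* The infimum is a minimum when f <> 0, and +oo when f = 0. *)
Definition ord_fun f : \bar R :=
  ereal_inf [set (weight m)%:E | m in [set m | fcoef f m != 0]].

Lemma ord_fun0 : ord_fun 0 = +oo%E.
Proof.
rewrite /ord_fun (_ : [set m | _] = set0) ?image_set0 ?ereal_inf0 //.
by rewrite -subset0 => m /=; rewrite mcoeff0 eqxx.
Qed.

Lemma ord_funE f m : is_initial weight f m -> ord_fun f = (weight m)%:E.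
Proof.
move=> [fm mmin]; apply/eqP; rewrite eq_le; apply/andP; split.
  by apply: ereal_inf_lbound; exists m.
by apply: le_ereal_inf_tmp => _ [m' /= fm' <-]; rewrite lee_fin mmin.
Qed.

Lemma ord_funP f : f != 0 -> exists2 m, is_initial weight f m & ord_fun f = (weight m)%:E.
Proof.
by move=> /(ex_initial weight_fin)[m fm]; exists m => //; apply: ord_funE.
Qed.

Fact ord_fun_eqy f : ord_fun f = +oo%E <-> f = 0.
Proof.
split=> [|->]; last exact: ord_fun0.
by have [//|/ord_funP[m _ ->]] := eqVneq f 0.
Qed.

Fact ord_fun_neqNy f : ord_fun f <> -oo%E.
Proof. by have [->|/ord_funP[m _ ->]] := eqVneq f 0; rewrite ?ord_fun0. Qed.

Fact ord_funM f g : ord_fun (f * g) = (ord_fun f + ord_fun g)%E.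
Proof.
have [->|/ord_funP[mf fP fE]] := eqVneq f 0.
  by rewrite mul0r ord_fun0; case: (ord_fun g) (@ord_fun_neqNy g).
have [->|/ord_funP[mg gP gE]] := eqVneq g 0.
  by rewrite mulr0 ord_fun0 fE.
have [m fgP mE] := is_initial_mul weightD weight_fin fP gP.
by rewrite (ord_funE fgP) mE fE gE.
Qed.

Fact ord_funD f g : (Order.min (ord_fun f) (ord_fun g) <= ord_fun (f + g)%R)%E.
Proof.
apply: le_ereal_inf_tmp => _ [m /= fgm <-]; rewrite ge_min.
have [fm|fm] := eqVneq (fcoef f m) 0; apply/orP; [right|left].
  apply: ereal_inf_lbound; exists m => //=; move: fgm.
  by rewrite fm add0r.
by apply: ereal_inf_lbound; exists m.
Qed.

Definition monomial_valuation : valuation R (mfps n k) :=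
  Valuation ord_fun_eqy ord_fun_neqNy ord_funM ord_funD.

Definition nu_alpha : valuation R {fraction mfps n k} := fracval monomial_valuation.

Definition Vnu : idomainType := vring nu_alpha.

Fact mfps_in_Vnu f : (@FracField.tofrac _ f) \in vring_pred nu_alpha.
Proof.
rewrite unfold_in /= fracval_tofrac /=; apply: le_ereal_inf_tmp => _ [m _ <-].
by rewrite lee_fin weight_ge0.
Qed.

Definition mfps_to_Vnu f : Vnu := VRing (mfps_in_Vnu f).

Fact mfps_to_Vnu_is_zmod_morphism : zmod_morphism mfps_to_Vnu.
Proof. by move=> f g; apply: val_inj; rewrite /= tofracB. Qed.

Fact mfps_to_Vnu_is_monoid_morphism : monoid_morphism mfps_to_Vnu.
Proof.
by split=> [|f g]; apply: val_inj; rewrite /= ?tofrac1 ?tofracM.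
Qed.

HB.instance Definition _ := GRing.isZmodMorphism.Build (mfps n k) Vnu
  mfps_to_Vnu mfps_to_Vnu_is_zmod_morphism.
HB.instance Definition _ := GRing.isMonoidMorphism.Build (mfps n k) Vnu
  mfps_to_Vnu mfps_to_Vnu_is_monoid_morphism.

Definition Vhat : idomainType := vcompletion (vring_valuation nu_alpha).
Definition Vhat_val : valuation R Vhat := vcompletion_valuation (vring_valuation nu_alpha).

Definition Khat : fieldType := {fraction Vhat}.
Definition Khat_val : valuation R Khat := fracval Vhat_val.

Definition Vhat_to_Khat : {rmorphism Vhat -> Khat} := @FracField.tofrac Vhat.

Definition mpoly_to_Vhat : {rmorphism mpoly n k -> Vhat} :=
  @to_vcompletion R Vnu (vring_valuation nu_alpha)
    \o (mfps_to_Vnu \o @mfps_of_mpoly n k).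

Definition mpoly_to_Khat : {rmorphism mpoly n k -> Khat} :=
  Vhat_to_Khat \o mpoly_to_Vhat.

Lemma Khat_val_mpoly p :
  Khat_val (mpoly_to_Khat p) = monomial_valuation (mfps_of_mpoly p).
Proof.
by rewrite /Khat_val /= fracval_tofrac to_vcompletion_val /= fracval_tofrac.
Qed.

Definition alpha_homog p : Prop :=
  exists i : R, forall m, mcoeff m p != 0 -> weight m = i.

Definition G_alpha (i : R) : set Khat := [set g | g = 0 \/
  exists a b : mpoly n k, [/\ a != 0, b != 0, alpha_homog a, alpha_homog b &
    (monomial_valuation (mfps_of_mpoly a) - monomial_valuation (mfps_of_mpoly b))%E
      = i%:E
    /\ g = mpoly_to_Khat a / mpoly_to_Khat b]].

End MonomialValuation.

(* Unconditional convergence, for the topology defined by the valuation. *)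
Definition has_sum (R : realType) (K : fieldType) (v : valuation R K)
    (L : set R) (u : R -> K) (A : K) : Prop :=
  forall c : R, exists F0 : {fset R}, [set` F0] `<=` L /\
    forall F : {fset R}, (F0 `<=` F)%fset -> [set` F] `<=` L ->
      (c%:E <= v (A - \sum_(i <- F) u i)%R)%E.

Definition fg_subsemigroup (R : realType) (L : set R) : Prop :=
  exists gens : seq R, all (fun x => 0 <= x) gens /\
    L = smallest [set S : set R | forall x y, S x -> S y -> S (x + y)] [set` gens].

Section ValphaKalpha.
Variables (R : realType) (n : nat) (alpha : 'I_n -> {posnum R}) (k : fieldType).

Local Notation Vh := (Vhat alpha k).
Local Notation Kh := (Khat alpha k).
Local Notation pK := (mpoly_to_Khat alpha k).

Definition Valpha_delta (delta : mpoly n k) : set Vh := [set A |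
  exists (L : set R) (a : R -> mpoly n k) (m : R -> nat),
  [/\ fg_subsemigroup L,
      (forall i, L i -> [/\ alpha_homog alpha (a i), (0 < m i)%N &
         a i != 0 -> Khat_val alpha k (pK (a i) / pK delta ^+ m i) = i%:E]),
      (exists c b : R, 0 <= c /\ forall i, L i -> (m i)%:R <= c * i + b) &
      has_sum (Khat_val alpha k) L (fun i => pK (a i) / pK delta ^+ m i)
        (Vhat_to_Khat alpha k A)]].

Definition Valpha : set Vh :=
  \bigcup_(delta in [set delta | delta != 0 /\ alpha_homog alpha delta])
    Valpha_delta delta.

Definition Kalpha : set Kh := [set x | exists a b, [/\ Valpha a, Valpha b, b != 0 &
  x = Vhat_to_Khat alpha k a / Vhat_to_Khat alpha k b]].

End ValphaKalpha.

Definition is_minpoly (F L : fieldType) (iota : {rmorphism F -> L}) (z : L)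
    (p : {poly F}) : Prop :=
  [/\ p \is monic, root (map_poly iota p) z &
      forall q : {poly F}, root (map_poly iota q) z -> p %| q].

(* mathcomp's [irreducible_poly] ignores constant factors: over a domain it is
   irreducibility over the fraction field. *)
Definition irreducible_elt (A : unitRingType) (p : A) : Prop :=
  [/\ p != 0, p \isn't a GRing.unit &
      forall q r, p = q * r -> q \is a GRing.unit \/ r \is a GRing.unit].

Section HomogeneousElements.
Variables (R : realType) (n : nat) (alpha : 'I_n -> {posnum R}) (k : fieldType).
Variables (Omega : fieldType) (iota : {rmorphism Khat alpha k -> Omega}).
Variable w : valuation R Omega.

(* With q = (size p).-1, the coefficient g_j of Z^(q - j) is p`_(q - j). *)
Definition homog_minpoly (d : R) (gamma : Omega) (p : {poly Vhat alpha k}) : Prop :=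
  [/\ is_minpoly iota gamma (map_poly (Vhat_to_Khat alpha k) p),
      irreducible_elt p &
      forall j, (0 < j <= (size p).-1)%N ->
        G_alpha (d * j%:R) (Vhat_to_Khat alpha k p`_((size p).-1 - j))].

Definition homogeneous_element (gamma : Omega) : Prop :=
  exists d p, 0 <= d /\ homog_minpoly d gamma p.

Definition integral_homogeneous_element (gamma : Omega) : Prop :=
  exists d p, [/\ 0 <= d, homog_minpoly d gamma p &
    forall j, (0 < j <= (size p).-1)%N -> exists2 g : mpoly n k,
      alpha_homog alpha g & p`_((size p).-1 - j) = mpoly_to_Vhat alpha k g].

Definition Kalpha_adjoin (s : nat) (gamma : 'I_s -> Omega) : set Omega :=
  [set z | exists f : mpoly s Omega,
    (forall m, exists2 c, Kalpha c & mcoeff m f = iota c) /\ z = meval gamma f].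

Definition Valpha_adjoin (s : nat) (gamma : 'I_s -> Omega) : set Omega :=
  [set z | Kalpha_adjoin gamma z /\ (0 <= w z)%E].

End HomogeneousElements.

Section RationalDimension.
Variable R : realType.

Definition rat_span (s : nat) (e : 'I_s -> R) : set R :=
  [set \sum_(j < s) ratr (q j) * e j | q in [set: 'I_s -> rat]].

Definition rat_free (s : nat) (e : 'I_s -> R) : Prop :=
  forall q : 'I_s -> rat, \sum_(j < s) ratr (q j) * e j = 0 -> forall j, q j = 0.

Definition has_rat_dim (V : set R) (N : nat) : Prop :=
  exists e : 'I_N -> R, rat_free e /\ V = rat_span e.

End RationalDimension.

(* Main.v *)
Require Import Defs.
From HB Require Import structures.
From mathcomp Require Import all_boot all_order all_algebra.
From mathcomp Require Import finmap.
From mathcomp Require Import boolp classical_sets reals.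
From mathcomp Require Import interval_inference constructive_ereal ereal.
From mathcomp Require Import separable.
From mathcomp Require Import ring lra.
From mathcomp Require mpoly.
Import -(notations) mpoly.

(** Every root [z] of the polynomial is algebraic over [Kalpha], so it suffices to
    show that finitely many elements algebraic over [Kalpha] lie in a field
    generated by [N] integral homogeneous elements.

    Call [G_i] the set of homogeneous fractions of degree [i]. The completed field
    [Khat] consists of generalised series with components in the [G_i]
    ([series_all]), and [Kalpha] is the subset of the series whose component of
    degree [i] has a denominator [delta ^ m] with [m] bounded linearly in [i]
    ([KalphaE]; the elements of this set are called tame here). This is a field,
    and it is relatively algebraically closed in [Khat] ([tame_algebraic]): after a
    Taylor expansion near a simple root and a rescaling, the equation becomes a
    fixed point equation whose coefficients have positive valuation, and Picard
    iteration stays in a closed ring of series with bounded denominators.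

    In [Omega], the roots of homogeneous fractions, times elements algebraic over
    the residue field [G_0], form the homogeneous components of a graded ring; call
    its elements [degree_elt]s. As [Khat] is complete, conjugates over [Khat] have
    the same valuation ([conj_val]), and it follows that each nonzero [z] of
    [Omega] has an initial form: a [degree_elt] [u] such that [z - u] has larger
    valuation than [z] ([degree_elt_leading]).

    Let [H] be the field generated over [Kalpha] by all the [degree_elt]s. An
    element [z] algebraic over [Kalpha] belongs to [H] ([algebraic_homog_span]).
    Otherwise subtract from [z] the average [c] of its conjugates over [H], and then
    the initial form [u] of [z - c]. The conjugates of [z - c - u] over [H] all have
    valuation larger than that of [u], because [Kalpha] is relatively algebraically
    closed in [Khat]; but their sum is [- m * u], where [m] is their number, and [m]
    is a unit in characteristic zero.

    So the roots lie in a field generated by finitely many [degree_elt]s. Up to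
    factors algebraic over [G_0], these are monomials in [N] radicals whose degrees
    form a basis of the rational span of the weights, and the factors are absorbed
    in the first radical by the primitive element theorem, applied to elements of
    one and the same degree ([degree_elt_generators]). Finally, multiplying a
    [degree_elt] by a homogeneous polynomial makes it integral homogeneous
    ([degree_elt_integral_homogeneous]). *)

Set Implicit Arguments.
Unset Strict Implicit.
Unset Printing Implicit Defensive.

Import Order.TTheory GRing.Theory Num.Theory.
Import Defs.
Local Open Scope classical_set_scope.
Local Open Scope ring_scope.

(** * Valuations *)

Lemma nat_above (R : realType) (c : R) :
  exists N : nat, forall i : nat, (N <= i)%N -> c <= i%:R.
Proof.
exists (Num.bound c) => i Ni; have [c0|/ltW c0] := leP 0 c; last exact: le_trans c0 _.
by rewrite (le_trans (ltW (archi_boundP c0))) // ler_nat.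
Qed.

Section Valuations.
Variables (R : realType) (D : idomainType) (v : valuation R D).
Implicit Types (x y : D) (c : R).

Lemma val_sum_ge (I : eqType) (r : seq I) (P : pred I) (F : I -> D) c :
    (forall i, i \in r -> P i -> (c%:E <= v (F i))%E) ->
  (c%:E <= v (\sum_(i <- r | P i) F i)%R)%E.
Proof.
move=> cF; rewrite big_seq_cond; apply: (big_ind (fun x => (c%:E <= v x)%E)) => [|x y|i /andP[]].
- by rewrite val0 leey.
- exact: valD_ge.
- exact: cF.
Qed.

Lemma valD_gt c x y : (c%:E < v x -> c%:E < v y -> c%:E < v (x + y)%R)%E.
Proof. by move=> cx cy; apply: lt_le_trans (valD v x y); rewrite lt_min cx. Qed.

Lemma val_sum_gt (I : eqType) (r : seq I) (P : pred I) (F : I -> D) c :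
    (forall i, i \in r -> P i -> (c%:E < v (F i))%E) ->
  (c%:E < v (\sum_(i <- r | P i) F i)%R)%E.
Proof.
move=> cF; rewrite big_seq_cond; apply: (big_ind (fun x => (c%:E < v x)%E)) => [|x y|i /andP[]].
- by rewrite val0 ltry.
- exact: valD_gt.
- exact: cF.
Qed.

Lemma valM_ge (a b : R) x y :
  (a%:E <= v x -> b%:E <= v y -> (a + b)%:E <= v (x * y)%R)%E.
Proof. by move=> ax bx; rewrite valM EFinD; apply: leeD. Qed.

Lemma valX x (a : R) m : v x = a%:E -> v (x ^+ m) = (a *+ m)%:E.
Proof.
move=> xa; elim: m => [|m IH]; first by rewrite expr0 val1.
by rewrite exprS valM IH xa mulrS EFinD.
Qed.

Lemma valX_ge x (a : R) m : (a%:E <= v x -> (a *+ m)%:E <= v (x ^+ m)%R)%E.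
Proof.
move=> xa; elim: m => [|m IH]; first by rewrite expr0 val1.
by rewrite exprS mulrS; apply: valM_ge.
Qed.

Lemma val_nat_ge0 m : (0 <= v m%:R)%E.
Proof.
elim: m => [|m IH]; first by rewrite val0 leey.
by rewrite mulrS; apply: valD_ge => //; rewrite val1.
Qed.

Lemma val_approx x y (c : \bar R) : (c <= v x -> c <= v (x - y)%R -> c <= v y)%E.
Proof. by move=> cx cxy; rewrite -(subKr x y); apply: valB_ge. Qed.

Lemma val_chain y x z (c : \bar R) :
  (c <= v (x - y)%R -> c <= v (y - z)%R -> c <= v (x - z)%R)%E.
Proof. by move=> xy yz; rewrite -(subrKA y); apply: valD_ge. Qed.

Lemma val_sym x y : v (x - y) = v (y - x).
Proof. by rewrite -opprB valN. Qed.

Lemma val_inj_ge x y : (forall c, c%:E <= v (x - y)%R)%E -> x = y.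
Proof.
move=> xy; apply/eqP; rewrite -subr_eq0; apply/negP => /negP /(val_fin v)[r rE].
by have := xy (r + 1); rewrite rE lee_fin leNgt ltrDl ltr01.
Qed.

Lemma val_neq0 x (a : R) : v x = a%:E -> x != 0.
Proof. by move=> xa; apply/eqP => x0; move: xa; rewrite x0 val0. Qed.

Lemma val_dominated x y : (v x < v y)%E -> v (x + y) = v x.
Proof. by move=> xy; apply: val_close; rewrite addrC addKr. Qed.

End Valuations.

Section FieldValuation.
Variables (R : realType) (K : fieldType) (v : valuation R K).
Implicit Types (x y : K) (c : R).

Lemma valV x (a : R) : v x = a%:E -> v x^-1 = (- a)%:E.
Proof.
move=> xa; have x0 := val_neq0 xa.
have [b xb] : exists b, v x^-1 = b%:E by apply: val_fin; rewrite invr_eq0.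
have := valM v x x^-1; rewrite divff // val1 xa xb => -[] /eqP.
by rewrite eq_sym addr_eq0 => /eqP ->; rewrite opprK.
Qed.

Lemma val_div x y (a b : R) : v x = a%:E -> v y = b%:E -> v (x / y) = (a - b)%:E.
Proof. by move=> xa yb; rewrite valM xa (valV yb). Qed.

(** If [v z] were negative, the leading term of a polynomial with integral
    coefficients would dominate the others. *)
Lemma root_val_ge0 (p : {poly K}) z : v (lead_coef p) = 0%E ->
  (forall i, (0 <= v p`_i)%E) -> root p z -> (0 <= v z)%E.
Proof.
move=> vl vp pz; rewrite leNgt; apply/negP => z0.
have zn0 : z != 0 by apply/eqP => zE; move: z0; rewrite zE val0 ltNge leey.
have p0 : p != 0 by rewrite -lead_coef_eq0 (val_neq0 vl).
have [a vz] := val_fin v zn0; move: z0; rewrite vz lte_fin => a0.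
have := rootP pz; rewrite horner_coef.
rewrite -[size p]prednK ?size_poly_gt0 // big_ord_recr /= => /(congr1 v).
rewrite addrC val_dominated; last first.
  rewrite valM vl add0e (valX _ vz); apply: val_sum_gt => i _ _.
  rewrite valM (valX _ vz).
  apply: (@lt_le_trans _ _ (a *+ i)%:E).
    rewrite lte_fin -!(mulr_natr a) ltr_nM2l // ltr_nat; exact: ltn_ord.
  by rewrite -[leLHS]add0e leeD2r.
by rewrite valM vl add0e (valX _ vz) val0.
Qed.

End FieldValuation.

(** * Fields of generalised series over a graded family *)

Section GradedFamily.
Variables (R : realType) (K : fieldType) (v : valuation R K).
Implicit Types (H : R -> set K) (s : seq (R * K)) (A B x y : K) (c i : R).

Definition terms H s := forall t, t \in s -> H t.1 t.2.
Definition gsum s : K := \sum_(t <- s) t.2.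

(** Generalised series whose component of degree [i] lies in [H i], encoded as
    limits of finite sums of terms, so that no support has to be tracked. *)
Definition series_in H : set K := [set A | forall c,
  exists2 s, terms H s & (c%:E <= v (A - gsum s)%R)%E].

Lemma terms_cat H s1 s2 : terms H s1 -> terms H s2 -> terms H (s1 ++ s2).
Proof. by move=> h1 h2 t; rewrite mem_cat => /orP[/h1|/h2]. Qed.

Lemma terms_filter H (P : pred (R * K)) s : terms H s -> terms H (seq.filter P s).
Proof. by move=> h t; rewrite mem_filter => /andP[_ /h]. Qed.

Lemma gsum_cat s1 s2 : gsum (s1 ++ s2) = gsum s1 + gsum s2.
Proof. exact: big_cat. Qed.

Lemma gsum_filter (P : pred (R * K)) s :
  gsum (seq.filter P s) = \sum_(t <- s | P t) t.2.
Proof. by rewrite /gsum big_filter. Qed.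

Lemma series_in_gsum H s : terms H s -> series_in H (gsum s).
Proof. by move=> hs c; exists s => //; rewrite subrr val0 leey. Qed.

Lemma series_in_term H i x : H i x -> series_in H x.
Proof.
move=> ix; have -> : x = gsum [:: (i, x)] by rewrite /gsum big_seq1.
by apply: series_in_gsum => t; rewrite inE => /eqP ->.
Qed.

Lemma series_in0 H : series_in H 0.
Proof.
have -> : 0 = gsum [::] by rewrite /gsum big_nil.
by apply: series_in_gsum => t; rewrite in_nil.
Qed.

Lemma series_in_sub H H' A :
  (forall i x, H i x -> H' i x) -> series_in H A -> series_in H' A.
Proof. by move=> hh' hA c; have [s hs sc] := hA c; exists s => // t /hs /hh'. Qed.

Lemma series_inD H A B : series_in H A -> series_in H B -> series_in H (A + B).
Proof.
move=> hA hB c; have [s hs sc] := hA c; have [t ht tc] := hB c.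
exists (s ++ t); first exact: terms_cat.
by rewrite gsum_cat opprD addrACA; apply: valD_ge.
Qed.

Lemma series_inN H A :
  (forall i x, H i x -> H i (- x)) -> series_in H A -> series_in H (- A).
Proof.
move=> hN hA c; have [s hs sc] := hA c.
exists [seq (t.1, - t.2) | t <- s].
  by move=> _ /mapP[t /hs ht ->]; apply: hN.
by rewrite /gsum big_map /= sumrN -opprD valN.
Qed.

(** The product of two approximations approximates the product, with a loss of
    precision bounded by the valuations of the factors. *)
Lemma series_inM H1 H2 H A B :
    (forall i j x y, H1 i x -> H2 j y -> H (i + j) (x * y)) ->
  series_in H1 A -> series_in H2 B -> series_in H (A * B).
Proof.
move=> hM hA hB c; have [a aA] := val_lbound v A; have [b bB] := val_lbound v B.
have [s hs] := hA (Num.max (c - b) a); rewrite EFin_max ge_max => /andP[sc sa].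
have [t ht tc] := hB (c - a).
exists [seq (p.1 + q.1, p.2 * q.2) | p <- s, q <- t].
  by move=> _ /allpairsP[[p q] [/= /hs hp /ht hq ->]]; apply: hM.
have -> : gsum [seq (p.1 + q.1, p.2 * q.2) | p <- s, q <- t] = gsum s * gsum t.
  rewrite /gsum big_allpairs_dep /= big_distrl /=; apply: eq_bigr => x _.
  by rewrite big_distrr.
have -> : A * B - gsum s * gsum t = (A - gsum s) * B + gsum s * (B - gsum t) by ring.
apply: valD_ge; first by rewrite -[c](subrK b); apply: valM_ge.
rewrite -[c](subrK a) addrC; apply: valM_ge => //.
have -> : gsum s = A - (A - gsum s) by ring.
exact: valB_ge.
Qed.

Lemma series_in_closed H A :
  (forall c, exists2 B, series_in H B & (c%:E <= v (A - B)%R)%E) -> series_in H A.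
Proof.
move=> hA c; have [B hB Bc] := hA c; have [s hs sc] := hB c; exists s => //.
by rewrite -(subrKA B); apply: (valD_ge Bc sc).
Qed.

Lemma series_inX H A m : (forall i j x y, H i x -> H j y -> H (i + j) (x * y)) ->
  H 0 1 -> series_in H A -> series_in H (A ^+ m).
Proof.
move=> hM h1 hA; elim: m => [|m IH]; first exact: series_in_term h1.
by rewrite exprS; exact: (series_inM hM hA IH).
Qed.

Lemma series_in_sum H (I : eqType) (r : seq I) (P : pred I) (F : I -> K) :
    (forall j, j \in r -> P j -> series_in H (F j)) ->
  series_in H (\sum_(j <- r | P j) F j).
Proof.
move=> hF; rewrite big_seq_cond; apply: (big_ind (series_in H)) => [|x y|i /andP[]].
- exact: series_in0.
- exact: series_inD.
- exact: hF.
Qed.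

(** The inverse is the limit of the partial sums of the geometric series. *)
Lemma series_in_inv1B H A : (forall i j x y, H i x -> H j y -> H (i + j) (x * y)) ->
  H 0 1 -> series_in H A -> (0 < v A)%E -> series_in H (1 - A)^-1.
Proof.
move=> hM h1 hA A0; have [->|An0] := eqVneq A 0.
  by rewrite subr0 invr1; apply: series_in_term h1.
have [a aE] := val_fin v An0; move: A0; rewrite aE lte_fin => a0.
have v1A : v (1 - A) = 0%E by rewrite val_dominated ?val1 // valN aE lte_fin.
have n1A : 1 - A != 0 by apply: val_neq0 v1A.
apply: series_in_closed => c; have [m mP] := nat_above (c / a).
exists (\sum_(i < m) A ^+ i).
  by apply: series_in_sum => i _ _; apply: series_inX.
have -> : (1 - A)^-1 - \sum_(i < m) A ^+ i = A ^+ m / (1 - A).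
  apply: (mulIf n1A); rewrite divfK // mulrBl mulVf //.
  have -> : A ^+ m = 1 + (A - 1) * \sum_(i < m) A ^+ i by rewrite -subrX1; ring.
  by ring.
rewrite valM (valX _ aE) (valV v1A) oppr0 adde0 lee_fin -mulr_natr.
by rewrite mulrC -ler_pdivrMr // mP.
Qed.

Record graded (G : R -> set K) : Prop := Graded {
  graded0 : forall i, G i 0;
  gradedB : forall i x y, G i x -> G i y -> G i (x - y);
  gradedM : forall i j x y, G i x -> G j y -> G (i + j) (x * y);
  graded1 : G 0 1;
  gradedV : forall i x, G i x -> G (- i) x^-1;
  graded_val : forall i x, G i x -> x != 0 -> v x = i%:E }.

Section Graded.
Variables (G : R -> set K) (gG : graded G).

Lemma gradedN i x : G i x -> G i (- x).
Proof. by move=> ix; rewrite -[- x]add0r; apply: gradedB => //; apply: graded0. Qed.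

Lemma gradedD i x y : G i x -> G i y -> G i (x + y).
Proof. by move=> ix iy; rewrite -[y]opprK; apply: gradedB => //; apply: gradedN. Qed.

Lemma gradedX i x m : G i x -> G (i *+ m) (x ^+ m).
Proof.
move=> ix; elim: m => [|m IH]; first exact: graded1.
by rewrite exprS mulrS; apply: gradedM.
Qed.

Lemma graded_sum i (I : eqType) (r : seq I) (P : pred I) (F : I -> K) :
  (forall j, j \in r -> P j -> G i (F j)) -> G i (\sum_(j <- r | P j) F j).
Proof.
move=> hF; rewrite big_seq_cond; apply: (big_ind (G i)) => [|x y|j /andP[]].
- exact: graded0.
- exact: gradedD.
- exact: hF.
Qed.

Lemma graded_val_ge i x : G i x -> (i%:E <= v x)%E.
Proof.
move=> ix; have [->|/(graded_val gG ix) ->//] := eqVneq x 0; first by rewrite val0 leey.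
Qed.

(** A component of lowest degree cannot be cancelled by the others, so it must
    vanish when the sum has larger valuation; removing it, one concludes by
    induction on the number of terms. *)
Lemma gsum_eq0 s c : terms G s -> (forall t, t \in s -> t.1 < c) ->
  (c%:E <= v (gsum s))%E -> gsum s = 0.
Proof.
have [m] := ubnP (size s); elim: m => // m IH in s *; rewrite ltnS => sm Gs sc cs.
have [->|] := eqVneq s [::]; first by rewrite /gsum big_nil.
rewrite -size_eq0 -lt0n -has_predT => /hasP[t1 t1s _].
have [t0 t0s t0min] : exists2 t0, t0 \in s & forall t, t \in s -> t0.1 <= t.1.
  have x0 : 'I_(size s) by exists (index t1 s); rewrite index_mem.
  have [i _ imin] := @arg_minP _ _ _ x0 xpredT (fun i : 'I_(size s) => (nth t1 s i).1) isT.
  exists (nth t1 s i); first exact: mem_nth.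
  by move=> t ts; have := imin (Ordinal (etrans (index_mem t s) ts)) isT; rewrite /= nth_index.
pose g := \sum_(t <- s | t.1 == t0.1) t.2.
have sE : gsum s = g + gsum [seq t <- s | t.1 != t0.1].
  by rewrite gsum_filter /gsum (bigID (fun t => t.1 == t0.1)).
have Gg : G t0.1 g by apply: graded_sum => t /Gs + /eqP<-.
have t0c : (t0.1%:E < v (gsum s))%E by apply: lt_le_trans cs; rewrite lte_fin sc.
have g0 : g = 0.
  apply/eqP/negP => /negP gn0; have := graded_val gG Gg gn0.
  suff : (t0.1%:E < v g)%E by move=> + E; rewrite E ltxx.
  have -> : g = gsum s - gsum [seq t <- s | t.1 != t0.1] by rewrite sE addrK.
  apply: valD_gt => //; rewrite valN gsum_filter; apply: val_sum_gt => t ts tt0.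
  apply: lt_le_trans (graded_val_ge (Gs t ts)).
  by rewrite lte_fin lt_neqAle eq_sym tt0 t0min.
move: (sE); rewrite g0 add0r => sE'; rewrite sE'.
apply: IH; rewrite -?sE' //.
- rewrite (leq_trans _ sm) // size_filter -(count_predC (fun t => t.1 != t0.1) s).
  rewrite -[ltnLHS]addn0 ltn_add2l -has_count; apply/hasP; exists t0 => //=.
  by rewrite eqxx.
- exact: terms_filter.
- by move=> t; rewrite mem_filter => /andP[_ /sc].
Qed.

Lemma gsum_lt_eq0 s c : terms G s -> (c%:E <= v (gsum s))%E ->
  \sum_(t <- s | t.1 < c) t.2 = 0.
Proof.
move=> Gs cs; rewrite -gsum_filter; apply: (@gsum_eq0 _ c).
- exact: terms_filter.
- by move=> t; rewrite mem_filter => /andP[].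
have -> : gsum [seq t <- s | t.1 < c] = gsum s - \sum_(t <- s | ~~ (t.1 < c)) t.2.
  by rewrite gsum_filter [X in _ = X - _](bigID (fun t => t.1 < c)) /= addrK.
apply: valB_ge => //; apply: val_sum_ge => t ts; rewrite -leNgt => ct.
by apply: le_trans (graded_val_ge (Gs t ts)); rewrite lee_fin.
Qed.

Lemma gsum_comp_eq0 s c i : terms G s -> (c%:E <= v (gsum s))%E -> i < c ->
  \sum_(t <- s | t.1 == i) t.2 = 0.
Proof.
move=> Gs cs ic; set g := bigop _ _ _.
have Gg : G i g by apply: graded_sum => t /Gs + /eqP<-.
have si : \sum_(t <- s | t.1 < i) t.2 = 0.
  by apply: gsum_lt_eq0 => //; apply: le_trans cs; rewrite lee_fin ltW.
have sE : gsum s = g + \sum_(t <- s | i < t.1) t.2.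
  rewrite /gsum (bigID (fun t => t.1 == i)) /= -/g; congr (_ + _).
  rewrite (bigID (fun t => t.1 < i)) /= (eq_bigl (fun t => t.1 < i)); last first.
    by move=> t /=; case: ltgtP.
  by rewrite si add0r; apply: eq_bigl => t; case: ltgtP.
apply/eqP/negP => /negP gn0; have := graded_val gG Gg gn0.
suff : (i%:E < v g)%E by move=> + E; rewrite E ltxx.
have -> : g = gsum s - \sum_(t <- s | i < t.1) t.2 by rewrite sE addrK.
apply: valD_gt; first by apply: lt_le_trans cs; rewrite lte_fin.
rewrite valN; apply: val_sum_gt => t ts it.
by apply: lt_le_trans (graded_val_ge (Gs t ts)); rewrite lte_fin.
Qed.

Lemma gsum_ge s c : terms G s -> (c%:E <= v (gsum s))%E ->
  gsum s = gsum [seq t <- s | c <= t.1].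
Proof.
move=> Gs cs; rewrite gsum_filter /gsum (bigID (fun t => t.1 < c)) /=.
by rewrite (gsum_lt_eq0 Gs cs) add0r; apply: eq_bigl => t; rewrite leNgt.
Qed.

(** Terms of degree less than [r] cancel out in an element of valuation at
    least [r], so only the terms of degree at least [r] need to be in [H']. *)
Lemma series_in_ge H H' A r : (forall i x, H i x -> G i x) ->
    (r%:E <= v A)%E -> (forall i x, r <= i -> H i x -> H' i x) ->
  series_in H A -> series_in H' A.
Proof.
move=> HG rA HH' hA c; have [s hs] := hA (Num.max c r).
rewrite EFin_max ge_max => /andP[sc sr].
have Gs : terms G s by move=> t /hs /HG.
exists [seq t <- s | r <= t.1].
  by move=> t; rewrite mem_filter => /andP[rt /hs]; apply: HH'.
rewrite -gsum_ge //; have -> : gsum s = A - (A - gsum s) by ring.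
exact: valB_ge.
Qed.

(** Initial forms: the terms of degree less than [v A] in an approximation of
    [A] cancel out, and those of degree [v A] add up to [g]. *)
Lemma series_in_leading H A (a : R) : (forall i x, H i x -> G i x) ->
    (forall i, H i 0) -> (forall i x y, H i x -> H i y -> H i (x + y)) ->
    series_in H A -> v A = a%:E ->
  exists2 g, H a g & (a%:E < v (A - g)%R)%E.
Proof.
move=> HG H0 HD hA vA; have [s hs sa] := hA (a + 1).
have Gs : terms G s by move=> t /hs /HG.
have sv : (a%:E <= v (gsum s))%E.
  have -> : gsum s = A - (A - gsum s) by ring.
  apply: valB_ge; first by rewrite vA.
  by apply: le_trans sa; rewrite lee_fin lerDl.
exists (\sum_(t <- s | t.1 == a) t.2).
  by rewrite big_seq_cond; apply: (big_ind (H a)) => [//|x y|t /andP[/hs + /eqP<-]//]; apply: HD.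
rewrite -(subrKA (gsum s)); apply: valD_gt.
  by apply: lt_le_trans sa; rewrite lte_fin ltrDl.
have -> : gsum s - \sum_(t <- s | t.1 == a) t.2 = \sum_(t <- s | a < t.1) t.2.
  rewrite (gsum_ge Gs sv) gsum_filter (bigID (fun t => t.1 == a)) /=.
  have -> : \sum_(t <- s | (a <= t.1) && (t.1 == a)) t.2 = \sum_(t <- s | t.1 == a) t.2.
    by apply: eq_bigl => t; have [->|] := eqVneq t.1 a; rewrite ?lexx ?andbF.
  by rewrite addrAC subrr add0r; apply: eq_bigl => t; rewrite lt_neqAle [a == _]eq_sym andbC.
apply: val_sum_gt => t ts at1; apply: lt_le_trans (graded_val_ge (Gs t ts)).
by rewrite lte_fin.
Qed.

(** Two approximations of precision larger than [i] differ by a finite sum of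
    valuation larger than [i], so they have the same component of degree [i]. *)
Lemma series_in_components H A : (forall i x, H i x -> G i x) ->
    (forall i, H i 0) -> (forall i x y, H i x -> H i y -> H i (x + y)) ->
    series_in H A ->
  exists2 h : R -> K, (forall i, H i (h i)) &
    forall c s, terms G s -> (c%:E <= v (A - gsum s)%R)%E ->
      forall i, i < c -> h i = \sum_(t <- s | t.1 == i) t.2.
Proof.
move=> HG H0 HD hA.
have /choice[S SP] : forall i, exists s, terms H s /\ ((i + 1)%:E <= v (A - gsum s)%R)%E.
  by move=> i; have [s hs sc] := hA (i + 1); exists s.
exists (fun i => \sum_(t <- S i | t.1 == i) t.2) => [i|c s Gs sc i ic].
  have [hs _] := SP i; rewrite big_seq_cond.
  by apply: (big_ind (H i)) => [//|x y|t /andP[/hs + /eqP<-]//]; apply: HD.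
have [hs si] := SP i; apply/eqP; rewrite -subr_eq0; apply/eqP.
pose s' := S i ++ [seq (t.1, - t.2) | t <- s].
have -> : \sum_(t <- S i | t.1 == i) t.2 - \sum_(t <- s | t.1 == i) t.2
    = \sum_(t <- s' | t.1 == i) t.2.
  by rewrite big_cat big_map /= sumrN.
apply: (@gsum_comp_eq0 _ (Num.min c (i + 1))).
- apply: terms_cat => [t /hs /HG//|_ /mapP[t /Gs Gt ->]]; exact: gradedN.
- have -> : gsum s' = (A - gsum s) - (A - gsum (S i)).
    by rewrite gsum_cat {2}/gsum big_map sumrN /= /gsum; ring.
  apply: valB_ge.
    by apply: le_trans sc; rewrite lee_fin ge_min lexx.
  by apply: le_trans si; rewrite lee_fin ge_min lexx orbT.
- by rewrite lt_min ic ltrDl ltr01.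
Qed.

(** The inverse of [A] is that of an initial form times a geometric series. *)
Lemma div_leadingE A g (a : R) : v A = a%:E -> (a%:E < v (A - g)%R)%E ->
  [/\ v g = a%:E, A^-1 = g^-1 * (1 - (1 - g^-1 * A))^-1 & (0 < v (1 - g^-1 * A)%R)%E].
Proof.
move=> vA Ag; have vg : v g = a%:E.
  by rewrite -vA; apply: val_close; rewrite vA -opprB valN.
have g0 := val_neq0 vg; split=> //.
  by rewrite opprB addrC subrK invfM invrK mulrA mulVf // mul1r.
have -> : 1 - g^-1 * A = - ((A - g) / g) by field.
rewrite valN valM (valV vg).
have [->|Ag0] := eqVneq (A - g) 0; first by rewrite val0 addye // ltry.
have [r vr] := val_fin v Ag0; move: Ag; rewrite vr lte_fin => ar.
by rewrite -EFinD lte_fin subr_gt0.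
Qed.

Lemma series_in_inv A : series_in G A -> series_in G A^-1.
Proof.
move=> sA; have [->|A0] := eqVneq A 0; first by rewrite invr0; apply: series_in0.
have [a vA] := val_fin v A0.
have [g ga Ag] := series_in_leading (fun _ _ h => h) (graded0 gG) gradedD sA vA.
have [vg -> u0] := div_leadingE vA Ag.
have sg : series_in G g^-1 by apply: series_in_term (gradedV gG ga).
apply: (series_inM (gradedM gG) sg).
apply: (series_in_inv1B (gradedM gG) (graded1 gG)) => //.
apply: series_inD; first exact: series_in_term (graded1 gG).
apply: series_inN; first exact: gradedN.
exact: (series_inM (gradedM gG) sg sA).
Qed.

End Graded.
End GradedFamily.

(** * Homogeneous fractions and their series *)

Section CompletionApprox.
Variables (R : realType) (D : idomainType) (v : valuation R D).

Lemma vcompletion_val_ge (s : cseq v) (c : R) N :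
    (forall i, (N <= i)%N -> (c%:E <= v (s i))%E) ->
  (c%:E <= vcompletion_valuation v (\pi_(vcompletion v)%qT s))%E.
Proof.
move=> sc /=; have [/vcompletion_val_null ->|/cauchy_not_null[r [M sr]]] :=
  pselect (null_for_val v s); first exact: leey.
rewrite (vcompletion_val_cst sr) -(sr _ (leq_maxr N M)); apply: sc.
exact: leq_maxl.
Qed.

Lemma vcompletion_lim (s : nat -> D) : cauchy_for_val v s ->
  exists A : vcompletion v, forall c : R, exists N, forall i, (N <= i)%N ->
    (c%:E <= vcompletion_valuation v (A - to_vcompletion v (s i))%R)%E.
Proof.
move=> sC; have sP : s \in cauchy_pred v by apply/asboolP.
exists (\pi_(vcompletion v)%qT (CSeq sP)) => c; have [N sN] := sC c.
exists N => i Ni; rewrite /to_vcompletion -rmorphB.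
by apply: (@vcompletion_val_ge _ _ N) => j Nj; apply: sN.
Qed.

Lemma vcompletion_dense (A : vcompletion v) (c : R) :
  exists a : D, (c%:E <= vcompletion_valuation v (A - to_vcompletion v a)%R)%E.
Proof.
have [N sN] := cseqP (repr A) c; exists (repr A N).
rewrite /to_vcompletion -{1}[A]reprK -rmorphB.
by apply: (@vcompletion_val_ge _ _ N) => j Nj; apply: sN.
Qed.

End CompletionApprox.

Section HomogeneousFractions.
Variables (R : realType) (n : nat) (alpha : 'I_n -> {posnum R}) (k : fieldType).
Variables (K : fieldType) (v : valuation R K) (pK : {rmorphism mpoly n k -> K}).
Implicit Types (p q a b : mpoly n k) (d e i : R).

Local Notation wt := (weight alpha).

(** The property of the completed field from which the arguments on
    homogeneous fractions follow; they are carried out in an abstract field. *)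
Definition weight_valued := forall p, p != 0 ->
  exists2 m, mcoeff m p != 0 & v (pK p) = (wt m)%:E.

Lemma weight_mnm1 j : wt (mnm1 j) = (alpha j)%:num.
Proof.
rewrite /weight (bigD1 j) //= mnm1E eqxx mulr1 big1 ?addr0 // => i ij.
by rewrite mnm1E eq_sym (negbTE ij) mulr0.
Qed.

Definition homog_of d p := forall m, mcoeff m p != 0 -> wt m = d.

Lemma homog_of_alpha d p : homog_of d p -> alpha_homog alpha p.
Proof. by exists d. Qed.

Lemma homog_of0 d : homog_of d 0.
Proof. by move=> m; rewrite mcoeff0 eqxx. Qed.

Lemma homog_ofC c : homog_of 0 (mpolyC n c).
Proof.
move=> m; rewrite mcoeffC; have [->|_] := eqVneq m mnm0; last by rewrite mulr0 eqxx.
by move=> _; rewrite /weight big1 // => j _; rewrite mnm0E mulr0.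
Qed.

Lemma homog_of1 : homog_of 0 1.
Proof. exact: homog_ofC. Qed.

Lemma homog_ofX m : homog_of (wt m) (mpolyX k m).
Proof. by move=> m'; rewrite mcoeffX; have [->//|_] := eqVneq m m'; rewrite eqxx. Qed.

Lemma mpolyX_neq0 (m : multinom n) : mpolyX k m != 0.
Proof.
apply/eqP => /(congr1 (mcoeff m)) /eqP.
by rewrite mcoeffX mcoeff0 eqxx oner_eq0.
Qed.

Lemma homog_ofZ d c p : homog_of d p -> homog_of d (c *: p).
Proof. by move=> dp m; rewrite mcoeffZ mulf_eq0 negb_or => /andP[_ /dp]. Qed.

Lemma homog_ofB d p q : homog_of d p -> homog_of d q -> homog_of d (p - q).
Proof.
move=> dp dq m; rewrite mcoeffB; have [p0|/dp//] := eqVneq (mcoeff m p) 0.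
by rewrite p0 sub0r oppr_eq0 => /dq.
Qed.

Lemma homog_ofD d p q : homog_of d p -> homog_of d q -> homog_of d (p + q).
Proof.
move=> dp dq; rewrite -[q]opprK; apply: homog_ofB => //.
by rewrite -sub0r; apply: homog_ofB => //; apply: homog_of0.
Qed.

Lemma homog_ofM d e p q : homog_of d p -> homog_of e q -> homog_of (d + e) (p * q).
Proof.
move=> dp eq m; rewrite mcoeffM; apply: contra_neqP => /eqP dem.
apply: big1 => -[b1 b2] /= /eqP mb.
have [->|/dp d1] := eqVneq (mcoeff b1 p) 0; first by rewrite mul0r.
have [->|/eq e2] := eqVneq (mcoeff b2 q) 0; first by rewrite mulr0.
by case/eqP: dem; rewrite mb weightD d1 e2.
Qed.

Lemma homog_of_exp d p m : homog_of d p -> homog_of (d *+ m) (p ^+ m).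
Proof.
move=> dp; elim: m => [|m IH]; first exact: homog_of1.
by rewrite exprS mulrS; apply: homog_ofM.
Qed.

Hypothesis pK_weight : weight_valued.

Lemma val_pK d p : homog_of d p -> p != 0 -> v (pK p) = d%:E.
Proof. by move=> dp /pK_weight[m /dp <-]. Qed.

Lemma pK_eq0 p : (pK p == 0) = (p == 0).
Proof.
apply/eqP/eqP => [p0|->]; last exact: rmorph0.
by apply/eqP/negP => /negP /pK_weight[m _]; rewrite p0 val0.
Qed.

(** The set [G_alpha i], in a form that covers [0] by a zero numerator. *)
Definition homog_frac i : set K := [set h | exists d a b,
  [/\ b != 0, homog_of d b, homog_of (d + i) a & h = pK a / pK b]].

Lemma homog_frac_poly d p : homog_of d p -> homog_frac d (pK p).
Proof.
move=> dp; exists 0, p, 1; rewrite oner_neq0 add0r rmorph1 divr1.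
by split=> //; apply: homog_of1.
Qed.

Lemma homog_frac_graded : graded v homog_frac.
Proof.
split.
- by move=> i; rewrite -(rmorph0 pK); apply: homog_frac_poly; apply: homog_of0.
- move=> i _ _ [d [a [b [b0 db da ->]]]] [d' [a' [b' [b'0 db' da' ->]]]].
  exists (d + d'), (a * b' - b * a'), (b * b').
  rewrite mulf_neq0 //; split=> //; first exact: homog_ofM.
    apply: homog_ofB; first by rewrite addrAC; apply: homog_ofM.
    by rewrite -addrA; apply: homog_ofM.
  by rewrite -mulNr addf_div ?pK_eq0 // mulNr [pK a' * _]mulrC -!rmorphM -rmorphB.
- move=> i j _ _ [d [a [b [b0 db da ->]]]] [d' [a' [b' [b'0 db' da' ->]]]].
  exists (d + d'), (a * a'), (b * b').
  rewrite mulf_neq0 //; split=> //; first exact: homog_ofM.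
    by rewrite addrACA; apply: homog_ofM.
  by rewrite mulf_div -!rmorphM.
- rewrite -(rmorph1 pK); apply: homog_frac_poly; exact: homog_of1.
- move=> i _ [d [a [b [b0 db da ->]]]]; have [->|a0] := eqVneq a 0.
    rewrite rmorph0 mul0r invr0 -(rmorph0 pK); apply: homog_frac_poly.
    exact: homog_of0.
  by exists (d + i), b, a; split; rewrite ?addrK // invf_div.
- move=> i _ [d [a [b [b0 db da ->]]]]; rewrite mulf_eq0 pK_eq0 negb_or.
  move=> /andP[a0 _]; rewrite (val_div (val_pK da a0) (val_pK db b0)).
  by rewrite addrAC subrr add0r.
Qed.

Lemma gsum_frac s : terms homog_frac s ->
  exists a b, b != 0 /\ gsum s = pK a / pK b.
Proof.
rewrite /gsum => hs; rewrite big_seq.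
apply: (big_ind (fun x => exists a b, b != 0 /\ x = pK a / pK b)).
- by exists 0, 1; rewrite oner_neq0 rmorph0 mul0r.
- move=> _ _ [a [b [b0 ->]]] [a' [b' [b'0 ->]]].
  exists (a * b' + b * a'), (b * b'); rewrite mulf_neq0 //; split=> //.
  by rewrite addf_div ?pK_eq0 // [pK a' * _]mulrC -!rmorphM -rmorphD.
- by move=> t /hs[d [a [b [b0 _ _ ->]]]]; exists a, b.
Qed.

Lemma monomial_large (c : R) : (0 < n)%N -> exists p d, [/\ p != 0, homog_of d p & c <= d].
Proof.
move=> n_gt0; pose j := Ordinal n_gt0; have [m mP] := nat_above (c / (alpha j)%:num).
exists (mpolyX k (mnm1 j) ^+ m), ((alpha j)%:num *+ m); split.
- by rewrite expf_neq0 // mpolyX_neq0.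
- apply: homog_of_exp; have <- : wt (mnm1 j) = (alpha j)%:num.
    rewrite /weight (bigD1 j) //= mnm1E eqxx mulr1 big1 ?addr0 // => i ij.
    by rewrite mnm1E eq_sym (negbTE ij) mulr0.
  exact: homog_ofX.
- by rewrite -mulr_natr mulrC -ler_pdivrMr // mP.
Qed.

End HomogeneousFractions.

Section CompletedField.
Variables (R : realType) (n : nat) (alpha : 'I_n -> {posnum R}) (k : fieldType).
Implicit Types (p q a b : mpoly n k) (d e i : R).

Local Notation K := (Khat alpha k).
Local Notation v := (Khat_val alpha k).
Local Notation pK := (mpoly_to_Khat alpha k).
Local Notation wt := (weight alpha).

Lemma mfps_of_mpoly_eq0 p : (mfps_of_mpoly p == 0) = (p == 0).
Proof.
apply/eqP/eqP => [p0|->]; last exact: rmorph0.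
apply/mpolyP => m; rewrite mcoeff0.
by have := congr1 (fun f => fcoef f m) p0; rewrite /= mcoeff0.
Qed.

Lemma Khat_weight_valued : weight_valued alpha v pK.
Proof.
move=> p; rewrite -mfps_of_mpoly_eq0 => p0; rewrite Khat_val_mpoly.
by have [m [pm _] pE] := ord_funP alpha p0; exists m.
Qed.

Local Notation pKw := Khat_weight_valued.
Local Notation homog_frac := (@homog_frac R n alpha k K pK).
Local Notation homog_frac_graded := (homog_frac_graded pKw).

Lemma homog_frac_G_alpha i h : homog_frac i h -> G_alpha i h.
Proof.
move=> hi; have [->|h0] := eqVneq h 0; first by left.
right; case: hi h0 => [d [a [b [b0 db da ->]]]] h0; exists a, b.
have a0 : a != 0 by move: h0; rewrite mulf_eq0 (pK_eq0 pKw) negb_or => /andP[].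
split=> //; [exact: homog_of_alpha da|exact: homog_of_alpha db|split=> //].
by rewrite -!Khat_val_mpoly (val_pK pKw da) // (val_pK pKw db) // -EFinB addrAC subrr add0r.
Qed.

Lemma G_alpha_homog_frac i h : G_alpha i h -> homog_frac i h.
Proof.
case=> [->|[a [b [a0 b0 [da ha] [db hb] [abi ->]]]]].
  exact: (graded0 homog_frac_graded).
exists db, a, b; split=> //; move: abi.
rewrite -!Khat_val_mpoly (val_pK pKw ha) // (val_pK pKw hb) // -EFinB => -[<-].
by rewrite addrC subrK.
Qed.

Definition phiV : {rmorphism Vnu alpha k -> K} :=
  Vhat_to_Khat alpha k \o @to_vcompletion R (Vnu alpha k) (vring_valuation (nu_alpha alpha k)).

Lemma val_phiV (y : Vnu alpha k) : v (phiV y) = vring_valuation (nu_alpha alpha k) y.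
Proof. by rewrite /Khat_val /= fracval_tofrac to_vcompletion_val. Qed.

Lemma pK_phiV p : pK p = phiV (mfps_to_Vnu alpha (mfps_of_mpoly p)).
Proof. by []. Qed.

Lemma val_phiV_mfps f : v (phiV (mfps_to_Vnu alpha f)) = monomial_valuation alpha k f.
Proof. by rewrite val_phiV /= /nu_alpha /= fracval_tofrac. Qed.

Lemma phiV_eq0 y : (phiV y == 0) = (y == 0).
Proof.
apply/eqP/eqP => [y0|->]; last exact: rmorph0.
have := val_phiV y; rewrite y0 val0 => yE.
exact/(val_eqy (vring_valuation (nu_alpha alpha k))).
Qed.

Local Notation series := (series_in v homog_frac).

Lemma series_pK p : series (pK p).
Proof.
rewrite (mpolyE p) rmorph_sum; apply: series_in_sum => m _ _.
apply: (@series_in_term _ _ v _ (wt m)); apply: homog_frac_poly.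
by apply: homog_ofZ; apply: homog_ofX.
Qed.

Lemma series_mfps f : series (phiV (mfps_to_Vnu alpha f)).
Proof.
apply: series_in_closed => c; have [d dP] := weight_fin alpha c.
exists (pK (mfps_trunc d f)); first exact: series_pK.
rewrite pK_phiV -!rmorphB val_phiV_mfps /=.
apply: le_ereal_inf_tmp => _ [m /= + <-]; apply: contraR.
rewrite -ltNge lte_fin => /ltW /dP md; apply/eqP.
by rewrite (approx_trunc f md) subrr.
Qed.

(** Series of homogeneous fractions form a closed subfield, which contains the
    power series by truncation, hence their fractions, the completed valuation
    ring by density, and finally its fractions. *)
Lemma series_all A : series A.
Proof.
have gG := homog_frac_graded.
have sV y : series (phiV y).
  have [f [g [g0 yE]]] := fracP (vring_val y).
  have g0' : phiV (mfps_to_Vnu alpha g) != 0.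
    rewrite phiV_eq0; apply/eqP => /(congr1 (@vring_val _ _ _)) /= /eqP.
    by rewrite tofrac_eq0 (negbTE g0).
  have -> : phiV y = phiV (mfps_to_Vnu alpha f) * (phiV (mfps_to_Vnu alpha g))^-1.
    apply: (mulIf g0'); rewrite divfK // -rmorphM; congr (phiV _).
    by apply: val_inj; rewrite /= yE divfK // tofrac_eq0.
  exact: (series_inM (gradedM gG) (series_mfps f) (series_in_inv gG (series_mfps g))).
have sVh (a : Vhat alpha k) : series (Vhat_to_Khat alpha k a).
  apply: series_in_closed => c; have [y yc] := vcompletion_dense a c.
  exists (phiV y) => //; rewrite -rmorphB /= /Khat_val /=.
  by rewrite fracval_tofrac.
have [a [b [b0 ->]]] := fracP A.
exact: (series_inM (gradedM gG) (sVh a) (series_in_inv gG (sVh b))).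
Qed.

Lemma frac_phiV a b : b != 0 -> (0 <= v (pK a / pK b)%R)%E ->
  exists y, phiV y = pK a / pK b.
Proof.
move=> b0 ab; pose x := FracField.tofrac (mfps_of_mpoly a) / FracField.tofrac (mfps_of_mpoly b).
have b0' : mfps_of_mpoly b != 0 by rewrite mfps_of_mpoly_eq0.
have xV : x \in vring_pred (nu_alpha alpha k).
  rewrite unfold_in /= /nu_alpha /= fracval_funE //.
  have [r vb] : exists r, v (pK b) = r%:E by apply: val_fin; rewrite (pK_eq0 pKw).
  move: ab; rewrite valM (valV vb) Khat_val_mpoly.
  by move: vb; rewrite Khat_val_mpoly => ->.
exists (VRing xV); have pb0 : pK b != 0 by rewrite (pK_eq0 pKw).
apply: (mulIf pb0); rewrite divfK // !pK_phiV -rmorphM; congr (phiV _).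
by apply: val_inj; rewrite /= divfK // tofrac_eq0.
Qed.

Lemma approx_phiV A (c : R) : (0 <= v A)%E ->
  exists y, (c%:E <= v (A - phiV y)%R)%E.
Proof.
move=> A0; have [s hs] := series_all A (Num.max 0 c).
rewrite EFin_max ge_max => /andP[s0 sc]; have [a [b [b0 sE]]] := gsum_frac pKw hs.
have [|y yE] := @frac_phiV a b b0.
  by rewrite -sE; exact: val_approx A0 s0.
by exists y; rewrite yE -sE.
Qed.

(** The approximations of [A] by fractions of polynomials eventually lie in the
    valuation ring, so [A] is the limit of a Cauchy sequence of that ring. *)
Lemma Vhat_ge0 A : (0 <= v A)%E -> exists x, A = Vhat_to_Khat alpha k x.
Proof.
move=> A0; have /choice[y yA] : forall m : nat, exists y, (m%:R%:E <= v (A - phiV y)%R)%E.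
  by move=> m; apply: approx_phiV.
have [c|a aP] := @vcompletion_lim _ _ (vring_valuation (nu_alpha alpha k)) y.
  have [N NP] := nat_above c; exists N => i j Ni Nj; rewrite -val_phiV rmorphB.
  have yc m : (N <= m)%N -> (c%:E <= v (A - phiV (y m))%R)%E.
    by move=> /NP Nm; apply: le_trans (yA m); rewrite lee_fin.
  by apply: (val_chain (y := A)); [rewrite val_sym|]; exact: yc.
exists a; apply: (@val_inj_ge _ _ v) => c.
have [N NP] := aP c; have [M MP] := nat_above c; pose i := maxn N M.
apply: (val_chain (y := phiV (y i))).
  by apply: le_trans (yA i); rewrite lee_fin MP ?leq_maxr.
rewrite val_sym -rmorphB {1}/Khat_val /= fracval_tofrac.
by apply: NP; rewrite leq_maxl.
Qed.

Hypothesis n_gt0 : (0 < n)%N.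

(** A Cauchy sequence of the fraction field, multiplied by a monomial of large
    weight and replaced by nearby fractions of polynomials, becomes a Cauchy
    sequence of the valuation ring, which has a limit by construction. *)
Lemma Khat_complete (u : nat -> K) : cauchy_for_val v u ->
  exists A, forall c : R, exists N : nat, forall i : nat, (N <= i)%N ->
    (c%:E <= v (A - u i)%R)%E.
Proof.
move=> uC; have [b [N0 ub]] := cauchy_lbound uC.
have [p [d [p0 dp bd]]] := monomial_large alpha k (- b) n_gt0.
have vp := val_pK pKw dp p0.
have pK0 := val_neq0 vp.
pose u' m := if (N0 <= m)%N then pK p * u m else 0.
have u'0 m : (0 <= v (u' m))%E.
  rewrite /u'; case: ifP => [/ub bu|_]; last by rewrite val0 leey.
  have dv : (d%:E <= v (pK p))%E by rewrite vp.
  by apply: le_trans (valM_ge dv bu); rewrite lee_fin -lerBlDr sub0r.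
have /choice[y yP] : forall m : nat, exists y, (m%:R%:E <= v (u' m - phiV y)%R)%E.
  by move=> m; apply: approx_phiV.
have [c|A AP] := @vcompletion_lim _ _ (vring_valuation (nu_alpha alpha k)) y.
  have [N NP] := nat_above c; have [M MP] := uC (c - d).
  exists (maxn N0 (maxn N M)) => i j; rewrite !geq_max => /and3P[N0i Ni Mi] /and3P[N0j Nj Mj].
  rewrite -val_phiV rmorphB.
  have yc m : (N <= m)%N -> (c%:E <= v (u' m - phiV (y m))%R)%E.
    by move=> /NP Nm; apply: le_trans (yP m); rewrite lee_fin.
  apply: (val_chain (y := u' i)); first by rewrite val_sym; exact: yc.
  apply: (val_chain (y := u' j)); last exact: yc.
  rewrite /u' N0i N0j -mulrBr -[c](subrK d) addrC; apply: valM_ge; last exact: MP.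
  by rewrite vp.
exists (Vhat_to_Khat alpha k A / pK p) => c.
have [N NP] := AP (c + d); have [M MP] := nat_above (c + d).
exists (maxn N0 (maxn N M)) => i; rewrite !geq_max => /and3P[N0i Ni Mi].
have -> : Vhat_to_Khat alpha k A / pK p - u i = (Vhat_to_Khat alpha k A - u' i) / pK p.
  by rewrite mulrBl /u' N0i [pK p * _]mulrC mulfK.
rewrite -[c](addrK d); apply: valM_ge; last by rewrite (valV vp).
apply: (val_chain (y := phiV (y i))).
  by rewrite -rmorphB {1}/Khat_val /= fracval_tofrac; apply: NP.
by rewrite val_sym; apply: le_trans (yP i); rewrite lee_fin MP.
Qed.

End CompletedField.

(** * Subfields and algebraic elements *)

Record subfield_set (K : fieldType) (S : set K) : Prop := SubfieldSet {
  subfield1 : S 1;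
  subfieldB : forall x y, S x -> S y -> S (x - y);
  subfield_div : forall x y, S x -> S y -> S (x / y) }.

(** Subfields are handled as sets; they are turned into field types to use
    minimal polynomials, closure properties of algebraic elements and primitive
    elements. *)
Section SubfieldType.
Variables (K : fieldType) (S : set K) (hS : subfield_set S).

Definition subfield_pred of subfield_set S : {pred K} := fun x => `[< S x >].

Fact subfield_pred_closed : divring_closed (subfield_pred hS).
Proof.
split; first by apply/asboolP; exact: subfield1.
- by move=> x y /asboolP hx /asboolP hy; apply/asboolP; exact: subfieldB.
- by move=> x y /asboolP hx /asboolP hy; apply/asboolP; exact: subfield_div.
Qed.

HB.instance Definition _ :=
  GRing.isDivringClosed.Build K (subfield_pred hS) subfield_pred_closed.

Record subfield_type := SubfieldElt {
  subfield_val :> K; _ : subfield_val \in subfield_pred hS }.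

HB.instance Definition _ := [isSub for subfield_val].
HB.instance Definition _ := [Choice of subfield_type by <:].
HB.instance Definition _ := [SubChoice_isSubIntegralDomain of subfield_type by <:].
HB.instance Definition _ := [SubIntegralDomain_isSubField of subfield_type by <:].

Definition subfield_inj : {rmorphism subfield_type -> K} := \val.

Lemma subfield_typeP (x : subfield_type) : S (subfield_inj x).
Proof. by case: x => x xS; apply/asboolP. Qed.

Lemma subfield_lift x : S x -> exists y, subfield_inj y = x.
Proof. by move=> /asboolP Sx; exists (SubfieldElt Sx). Qed.

Lemma subfield_lift_poly (p : {poly K}) : (forall i, S p`_i) ->
  exists q, map_poly subfield_inj q = p.
Proof.
move=> Sp; have /choice[f fE] := fun i => subfield_lift (Sp i).
exists (\poly_(i < size p) f i); apply/polyP => i; rewrite coef_map coef_poly.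
case: ltnP => ip; first exact: fE.
by rewrite nth_default //; exact: rmorph0.
Qed.

End SubfieldType.

Section SubfieldSetTheory.
Variables (K : fieldType) (S : set K) (hS : subfield_set S).

Lemma subfield0 : S 0.
Proof. by rewrite -(subrr 1); apply: (subfieldB hS); apply: (subfield1 hS). Qed.

Lemma subfieldN x : S x -> S (- x).
Proof. by move=> Sx; rewrite -sub0r; apply: (subfieldB hS) => //; apply: subfield0. Qed.

Lemma subfieldD x y : S x -> S y -> S (x + y).
Proof. by move=> Sx Sy; rewrite -[y]opprK; apply: (subfieldB hS) => //; apply: subfieldN. Qed.

Lemma subfieldV x : S x -> S x^-1.
Proof. by move=> Sx; rewrite -div1r; apply: (subfield_div hS) => //; apply: (subfield1 hS). Qed.

Lemma subfieldM x y : S x -> S y -> S (x * y).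
Proof. by move=> Sx Sy; rewrite -[y]invrK; apply: (subfield_div hS) => //; apply: subfieldV. Qed.

Lemma subfieldX x m : S x -> S (x ^+ m).
Proof.
move=> Sx; elim: m => [|m IH]; first exact: subfield1.
by rewrite exprS; apply: subfieldM.
Qed.

Lemma subfield_nat m : S m%:R.
Proof.
elim: m => [|m IH]; first exact: subfield0.
by rewrite mulrS; apply: subfieldD => //; apply: (subfield1 hS).
Qed.

Lemma subfield_sum (I : Type) (r : seq I) (P : pred I) (F : I -> K) :
  (forall i, P i -> S (F i)) -> S (\sum_(i <- r | P i) F i).
Proof. by move=> SF; apply: big_ind => //; [apply: subfield0|apply: subfieldD]. Qed.

Lemma subfield_horner (p : {poly K}) x : (forall i, S p`_i) -> S x -> S p.[x].
Proof.
move=> Sp Sx; rewrite horner_coef; apply: subfield_sum => i _.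
by apply: subfieldM => //; apply: subfieldX.
Qed.

Lemma subfield_coefM (p q : {poly K}) :
  (forall i, S p`_i) -> (forall i, S q`_i) -> forall i, S (p * q)`_i.
Proof. by move=> Sp Sq i; rewrite coefM; apply: subfield_sum => j _; apply: subfieldM. Qed.

Lemma subfield_prod_XsubC (rs : seq K) : (forall r, r \in rs -> S r) ->
  forall i, S (\prod_(r <- rs) ('X - r%:P))`_i.
Proof.
elim: rs => [|r rs IH] Sr i.
  by rewrite big_nil coef1; apply: subfield_nat.
rewrite big_cons; apply: subfield_coefM => j.
  rewrite coefB coefX coefC; apply: (subfieldB hS); first exact: subfield_nat.
  by case: eqP => _; [apply: Sr; rewrite mem_head|apply: subfield0].
by apply: IH => x xrs; apply: Sr; rewrite inE xrs orbT.
Qed.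

End SubfieldSetTheory.

Section AlgebraicOverSet.
Variables (K L : fieldType) (iota : {rmorphism K -> L}) (S : set K).

(** Polynomials over the large field [K] with coefficients in [S], which makes
    it easy to let [S] vary. *)
Definition algebraic_over : set L := [set z | exists p : {poly K},
  [/\ p != 0, (forall i, S p`_i) & root (map_poly iota p) z]].

Variable hS : subfield_set S.

Lemma algebraic_overE z :
  algebraic_over z <-> algebraicOver (iota \o subfield_inj hS) z.
Proof.
split=> [[p [p0 Sp pz]]|[p p0 pz]].
  have [q qE] := subfield_lift_poly hS Sp; exists q.
    by apply: contraNneq p0 => q0; rewrite -qE q0 map_poly0.
  by rewrite map_poly_comp qE.
exists (map_poly (subfield_inj hS) p); split; rewrite ?map_poly_eq0 //.
  by move=> i; rewrite coef_map; apply: subfield_typeP.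
by rewrite -map_poly_comp.
Qed.

Lemma algebraic_over_subfield : subfield_set algebraic_over.
Proof.
split; first by apply/algebraic_overE; exact: algebraic1.
- move=> x y /algebraic_overE hx /algebraic_overE hy; apply/algebraic_overE.
  exact: algebraic_sub.
- move=> x y /algebraic_overE hx /algebraic_overE hy; apply/algebraic_overE.
  exact: algebraic_div.
Qed.

Lemma algebraic_over_id x : S x -> algebraic_over (iota x).
Proof.
move=> Sx; apply/algebraic_overE; have [y <-] := subfield_lift hS Sx.
exact: (algebraic_id (iota \o subfield_inj hS)).
Qed.

Lemma algebraic_over_exp z m : (0 < m)%N -> algebraic_over (z ^+ m) -> algebraic_over z.
Proof.
move=> m0 [p [p0 Sp pz]]; exists (p \Po 'X^m); split.
- by rewrite comp_poly_eq0 // size_polyXn.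
- move=> i; rewrite comp_polyE coef_sum; apply: (subfield_sum hS) => j _.
  rewrite coefZ -exprM coefXn; apply: (subfieldM hS) => //; exact: (subfield_nat hS).
- by rewrite map_comp_poly map_polyXn rootE horner_comp hornerXn.
Qed.

End AlgebraicOverSet.

Lemma algebraic_over_sub (K L : fieldType) (iota : {rmorphism K -> L}) (S S' : set K) z :
  S `<=` S' -> algebraic_over iota S z -> algebraic_over iota S' z.
Proof. by move=> SS' [p [p0 Sp pz]]; exists p; split=> // i; apply: SS'. Qed.

Lemma horner_map_MXaddC (K L : fieldType) (iota : {rmorphism K -> L})
    (p : {poly K}) c z :
  (map_poly iota (p * 'X + c%:P)).[z] = (map_poly iota p).[z] * z + iota c.
Proof. by rewrite rmorphD rmorphM /= map_polyX map_polyC hornerMXaddC. Qed.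

(** An equation [p(z) * z + c = 0] with [c != 0] gives [z^-1 = - p(z) / c]; if
    [c = 0] then [p] is an equation of smaller degree. *)
Lemma algebraic_inv_closed (K L : fieldType) (iota : {rmorphism K -> L})
    (S : set K) (T : set L) : subfield_set S ->
    (forall x, S x -> T (iota x)) -> (forall x y, T x -> T y -> T (x - y)) ->
    (forall x y, T x -> T y -> T (x * y)) ->
  forall z, T z -> algebraic_over iota S z -> T z^-1.
Proof.
move=> hS ST TB TM z Tz; have [->|z0] := eqVneq z 0.
  by rewrite invr0 -(rmorph0 iota) => _; apply: ST; apply: (subfield0 hS).
have T0 : T 0 by rewrite -(rmorph0 iota); apply: ST; apply: (subfield0 hS).
have TD x y : T x -> T y -> T (x + y).
  move=> Tx Ty; rewrite -[y]opprK; apply: (TB) => //.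
  by rewrite -sub0r; apply: TB.
have Tp (p : {poly K}) : (forall i, S p`_i) -> T (map_poly iota p).[z].
  elim/poly_ind: p => [|p c IH] Sp; first by rewrite rmorph0 horner0.
  rewrite horner_map_MXaddC; apply: TD.
    apply: TM => //; apply: IH => i.
    by have := Sp i.+1; rewrite coefD coefMX coefC /= addr0.
  by have := Sp 0%N; rewrite coefD coefMX coefC /= add0r => /ST.
case=> p [p0 Sp pz]; elim/poly_ind: p p0 Sp pz => [|p c IH]; first by rewrite eqxx.
move=> pc0 Spc; rewrite rootE horner_map_MXaddC.
have Sp i : S p`_i by have := Spc i.+1; rewrite coefD coefMX coefC /= addr0.
have Sc : S c by have := Spc 0%N; rewrite coefD coefMX coefC /= add0r.
have [c0|c0] := eqVneq c 0.
  have -> : iota c = 0 by rewrite c0; exact: rmorph0.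
  rewrite addr0 mulf_eq0 (negbTE z0) orbF; apply: IH => //.
  by apply: contraNneq pc0 => ->; rewrite c0 mul0r addr0.
rewrite addr_eq0 => /eqP pz.
have ic0 : iota c != 0 by rewrite fmorph_eq0.
have -> : z^-1 = (0 - (map_poly iota p).[z]) * iota c^-1.
  apply: (mulIf z0); rewrite mulVf // sub0r mulrAC mulNr pz opprK.
  by rewrite fmorphV divff.
by apply: TM; [apply: TB => //; apply: Tp|apply: ST; apply: (subfieldV hS)].
Qed.

Section MinimalPolynomials.
Variables (K L : fieldType) (iota : {rmorphism K -> L}).
Local Notation "p ^i" := (map_poly iota p) (at level 2, format "p ^i").

Lemma exists_minpoly z : algebraicOver iota z -> exists p, is_minpoly iota z p.
Proof.
move=> [p0 p0n p0z]; pose P (m : nat) := `[< exists p, [/\ p != 0, root p^i z & size p = m] >].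
have exP : exists m, P m by exists (size p0); apply/asboolP; exists p0.
case: (ex_minnP exP) => m /asboolP[q [qn qz qm]] mmin.
exists ((lead_coef q)^-1 *: q); split.
- by rewrite monicE lead_coefZ mulVf // lead_coef_eq0.
- by rewrite map_polyZ rootZ // fmorph_eq0 invr_eq0 lead_coef_eq0.
move=> r rz; rewrite dvdpZl ?invr_eq0 ?lead_coef_eq0 //; apply/modp_eq0P.
apply/eqP/negP => /negP rq0; have := ltn_modp r q; rewrite qn qm ltnNge => /negP; apply.
apply: mmin; apply/asboolP; exists (r %% q); split=> //.
have := congr1 (fun s => s^i.[z]) (divp_eq r q); rewrite rmorphD rmorphM /= hornerD hornerM.
by rewrite (rootP rz) (rootP qz) mulr0 add0r rootE => <-.
Qed.

Lemma minpoly_size_gt1 z p : is_minpoly iota z p -> (1 < size p)%N.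
Proof.
move=> [pm pz _]; rewrite -(size_map_poly iota).
by apply: root_size_gt1 pz; rewrite map_poly_eq0 monic_neq0.
Qed.

Lemma minpoly_small z p : is_minpoly iota z p ->
  forall f : {poly K}, (size f < size p)%N -> root f^i z -> f = 0.
Proof.
move=> [pm pz pmin] f fp fz; apply/eqP/negP => /negP f0.
by have := dvdp_leq f0 (pmin f fz); rewrite leqNgt fp.
Qed.

(** Irreducibility of minimal polynomials: if [q] vanishes at [z'], so does the
    greatest common divisor of [p] and [q], which is therefore not constant. *)
Lemma minpoly_conj z z' p : is_minpoly iota z p -> root p^i z' -> is_minpoly iota z' p.
Proof.
move=> zp pz'; have [pm pz pmin] := zp; split=> // q qz'.
have p0 := monic_neq0 pm.
have gz' : root (gcdp p q)^i z' by rewrite gcdp_map root_gcd pz'.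
have g0 : gcdp p q != 0 by rewrite gcdp_eq0 negb_and p0.
have g1 : (1 < size (gcdp p q))%N.
  by rewrite -(size_map_poly iota); apply: root_size_gt1 gz'; rewrite map_poly_eq0.
have pE : p = p %/ gcdp p q * gcdp p q by rewrite divpK // dvdp_gcdl.
move: (pz); rewrite {1}pE rmorphM /= rootM => /orP[dz|gz]; last first.
  by apply: dvdp_trans (pmin _ gz) (dvdp_gcdr _ _).
have d0 : p %/ gcdp p q = 0.
  apply: (minpoly_small zp _ dz).
  rewrite size_divp // ltn_subrL; apply/andP; split; last by rewrite size_poly_gt0.
  by rewrite -subn1 subn_gt0.
by move: p0; rewrite pE d0 mul0r eqxx.
Qed.

End MinimalPolynomials.

(** * Uniqueness of the valuation over a complete field *)

Section CompleteField.
Variables (R : realType) (K L : fieldType) (iota : {rmorphism K -> L}).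
Variables (v : valuation R K) (w : valuation R L).
Hypothesis w_ext : forall x, w (iota x) = v x.
Hypothesis v_complete : forall u : nat -> K, cauchy_for_val v u ->
  exists A, forall c : R, exists N : nat, forall i : nat, (N <= i)%N ->
    (c%:E <= v (A - u i)%R)%E.
Local Notation "p ^i" := (map_poly iota p) (at level 2, format "p ^i").

Lemma horner_map_wide (f : {poly K}) m z : (size f <= m)%N ->
  f^i.[z] = \sum_(i < m) iota f`_i * z ^+ i.
Proof.
move=> fm; rewrite (@horner_coef_wide _ m) ?size_map_poly //.
by apply: eq_bigr => i _; rewrite coef_map.
Qed.

Lemma cauchy_poly (f : nat -> {poly K}) m : (forall N, (size (f N) <= m)%N) ->
    (forall i, cauchy_for_val v (fun N => (f N)`_i)) ->
  exists2 g : {poly K}, (size g <= m)%N & forall c : R, exists N : nat, forall M : nat,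
    (N <= M)%N -> forall i : nat, (c%:E <= v (g`_i - (f M)`_i)%R)%E.
Proof.
move=> fm fC; have /choice[l lP] := fun i => v_complete (fC i).
exists (\poly_(i < m) l i) => [|c]; first exact: size_poly.
have /choice[N NP] := fun i => lP i c.
exists (\max_(i < m) N i)%N => M NM i; rewrite coef_poly; case: ltnP => im.
  by apply: NP; apply: leq_trans NM; apply: (@leq_bigmax _ (fun j : 'I_m => N j) (Ordinal im)).
by rewrite nth_default ?subr0 ?val0 ?leey // (leq_trans (fm M)).
Qed.

(** Equivalence of norms on a finite-dimensional space over a complete field,
    for the space spanned by the first powers of [z]. By induction on the
    dimension: were there polynomials [f] of smaller degree with [f(z)]
    arbitrarily close to [z ^ m], their coefficients would form Cauchy sequences,
    and the limit would be a relation between the powers of [z]. *)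
Lemma coef_val_bound z q : (forall f : {poly K}, (size f <= q)%N -> root f^i z -> f = 0) ->
  forall m, (m <= q)%N -> exists C : R, forall f : {poly K}, (size f <= m)%N ->
    forall c : R, (c%:E <= w f^i.[z])%E -> forall i, ((c - C)%:E <= v f`_i)%E.
Proof.
move=> zq; have [r rz] := val_lbound w z.
elim=> [_|m IH mq].
  exists 0 => f; rewrite leqn0 size_poly_eq0 => /eqP -> c _ i.
  by rewrite coef0 val0 leey.
have [C CP] := IH (ltnW mq).
have [B BP] : exists B : R, forall f : {poly K}, (size f <= m)%N ->
    (w (z ^+ m - f^i.[z])%R < B%:E)%E.
  apply: contrapT => nB.
  have /choice[f fP] : forall N : nat, exists f : {poly K}, (size f <= m)%N /\
      (N%:R%:E <= w (z ^+ m - f^i.[z])%R)%E.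
    move=> N; apply: contrapT => nf; apply: nB; exists N%:R => f fm.
    by rewrite ltNge; apply/negP => fN; apply: nf; exists f.
  have [||g gm gP] := @cauchy_poly f m.
  - by move=> N; case: (fP N).
  - move=> i c; have [N NP] := nat_above (c + C); exists N => M M' NM NM'.
    rewrite -coefB -[c](addrK C); apply: CP.
      rewrite (leq_trans (size_polyD _ _)) // size_polyN geq_max.
      by case: (fP M) => -> _; case: (fP M') => -> _.
    rewrite rmorphB hornerD hornerN; apply: (val_chain (y := z ^+ m)).
      rewrite val_sym; apply: le_trans (proj2 (fP M)).
      by rewrite lee_fin NP.
    by apply: le_trans (proj2 (fP M')); rewrite lee_fin NP.
  have zg : z ^+ m = g^i.[z].
    apply: (@val_inj_ge _ _ w) => c.
    pose s := Num.min 0 (\big[Num.min/0]_(i < m) (r *+ i)).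
    have sr (i : 'I_m) : s <= r *+ i.
      by rewrite /s ge_min; apply/orP; right; rewrite (bigminD1 i) //= ge_min lexx.
    have [N NP] := gP (c - s); have [M MP] := nat_above c.
    pose e := maxn N M; apply: (val_chain (y := (f e)^i.[z])).
      by apply: le_trans (proj2 (fP e)); rewrite lee_fin MP // leq_maxr.
    rewrite -hornerN -hornerD -rmorphB (@horner_map_wide _ m); last first.
      by rewrite (leq_trans (size_polyD _ _)) // size_polyN geq_max (proj1 (fP e)).
    apply: val_sum_ge => i _ _; rewrite -[c](subrK s); apply: valM_ge.
      by rewrite w_ext coefB val_sym; apply: NP; rewrite leq_maxl.
    by apply: le_trans (valX_ge _ rz); rewrite lee_fin.
  have /(congr1 (fun p : {poly K} => p`_m)) : 'X^m - g = 0.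
    apply: zq; first by rewrite (leq_trans (size_polyD _ _)) // size_polyN geq_max size_polyXn mq (leq_trans gm) // ltnW.
    by rewrite rootE rmorphB /= map_polyXn hornerD hornerN hornerXn zg subrr.
  rewrite coefB coefXn eqxx nth_default // coef0 subr0 => /eqP.
  by rewrite oner_eq0.
exists (Num.max B (C + Num.max 0 (B - r *+ m))) => f fm c cf.
pose g := take_poly m f; pose a := f`_m.
have gm : (size g <= m)%N by apply: size_take_poly.
have fE : f = g + a *: 'X^m.
  apply/polyP => i; rewrite coefD coefZ coefXn coef_take_poly.
  case: ltngtP => im; rewrite ?mulr0 ?mulr1 ?addr0 ?add0r //; last by rewrite im.
  by rewrite nth_default // (leq_trans fm).
have fz : f^i.[z] = g^i.[z] + iota a * z ^+ m.
  by rewrite {1}fE rmorphD /= map_polyZ map_polyXn hornerD hornerZ hornerXn.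
have va : ((c - B)%:E <= v a)%E.
  have [->|a0] := eqVneq a 0; first by rewrite val0 leey.
  have [b vb] := val_fin v a0; rewrite vb lee_fin lerBlDr.
  have : (w (z ^+ m - (- a^-1 *: g)^i.[z])%R < B%:E)%E.
    by apply: BP; apply: leq_trans (size_scale_leq _ _) gm.
  have -> : z ^+ m - (- a^-1 *: g)^i.[z] = f^i.[z] / iota a.
    rewrite map_polyZ hornerZ fz rmorphN fmorphV; field.
    by rewrite fmorph_eq0.
  rewrite valM (valV (a := b)) ?w_ext // => fB.
  have : (c%:E + (- b)%:E < B%:E)%E by apply: le_lt_trans fB; rewrite leeD2r.
  by rewrite -EFinD lte_fin ltrBlDr addrC => /ltW.
move=> i; have [im|mi] := ltnP i m; last first.
  have [->|mi'] := eqVneq i m.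
    by apply: le_trans va; rewrite lee_fin lerB // le_max lexx.
  by rewrite nth_default ?val0 ?leey // (leq_trans fm) // ltn_neqAle eq_sym mi' mi.
have -> : f`_i = g`_i by rewrite coef_take_poly im.
have := CP g gm (c - Num.max 0 (B - r *+ m)).
have -> : g^i.[z] = f^i.[z] - iota a * z ^+ m by rewrite fz addrK.
move=> /(_ _ i) h; apply: le_trans (h _); last first.
  apply: valB_ge; first by apply: le_trans cf; rewrite lee_fin lerBlDr lerDl le_max lexx.
  have -> : c - Num.max 0 (B - r *+ m) = (c - Num.max 0 (B - r *+ m) - r *+ m) + r *+ m.
    by rewrite subrK.
  apply: valM_ge; last exact: valX_ge.
  rewrite w_ext; apply: le_trans va; rewrite lee_fin.
  rewrite -addrA -opprD lerB // -lerBlDr le_max lexx; exact: orbT.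
by rewrite lee_fin -addrA -opprD lerB // [_ + C]addrC le_max lexx orbT.
Qed.

(** Write [z ^ n] as a combination of the first powers of [z]. The coefficients
    have valuation at least [n * w z - C], so the same combination for [z'] gives
    [n * w z' >= n * w z - C'] for all [n]. *)
Lemma conj_val_le z z' p (a : R) : is_minpoly iota z p -> root p^i z' ->
  w z = a%:E -> (a%:E <= w z')%E.
Proof.
move=> zp pz' wz; rewrite leNgt; apply/negP => z'a.
have [a' wz'] : exists a' : R, w z' = a'%:E.
  by apply: val_fin; apply/eqP => z'0; move: z'a; rewrite z'0 val0 ltNge leey.
move: z'a; rewrite wz' lte_fin => a'a.
have small (f : {poly K}) : (size f <= (size p).-1)%N -> root f^i z -> f = 0.
  move=> fp; apply: (minpoly_small zp); rewrite (leq_ltn_trans fp) // ltn_predL.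
  exact: ltnW (minpoly_size_gt1 zp).
have [C CP] := coef_val_bound small (leqnn _).
have [pm pz _] := zp; have p0 := monic_neq0 pm.
pose s := \big[Num.min/0]_(i < (size p).-1) (a' *+ i).
have sa' (i : 'I_(size p).-1) : s <= a' *+ i.
  by rewrite /s (bigminD1 i) //= ge_min lexx.
have key (n : nat) : n%:R * (a - a') <= C - s.
  pose r := 'X^n %% p.
  have rp : (size r <= (size p).-1)%N.
    by rewrite -ltnS prednK ?ltn_modp // size_poly_gt0.
  have rE y : root p^i y -> r^i.[y] = y ^+ n.
    move=> py; have := congr1 (fun s => s^i.[y]) (divp_eq 'X^n p).
    rewrite map_polyXn hornerXn rmorphD rmorphM /= hornerD hornerM.
    by rewrite (rootP py) mulr0 add0r.
  have rc : forall i, ((a *+ n - C)%:E <= v r`_i)%E.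
    by apply: CP => //; rewrite (rE z pz) (valX n wz).
  have : ((a *+ n - C + s)%:E <= w (z' ^+ n)%R)%E.
    rewrite -rE // (horner_map_wide _ rp); apply: val_sum_ge => i _ _.
    apply: valM_ge; first by rewrite w_ext.
    by rewrite (valX _ wz') lee_fin.
  rewrite (valX _ wz') lee_fin -(mulr_natl a) -(mulr_natl a') mulrBr => h.
  by rewrite lerBlDr -lerBlDl; move: h; lra.
have [N NP] := nat_above ((C - s) / (a - a') + 1).
have := NP N (leqnn N); rewrite -lerBrDr ler_pdivrMr ?subr_gt0 // => h.
have := key N; move: h; rewrite mulrBl mul1r.
by move: (a'a); lra.
Qed.

Lemma conj_val z z' p : is_minpoly iota z p -> root p^i z' -> w z' = w z.
Proof.
move=> zp pz'; have z'p := minpoly_conj zp pz'; have [_ pz _] := zp.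
have conj0 x y : is_minpoly iota x p -> root p^i y -> x = 0 -> y = 0.
  move=> [_ _ pmin] py x0; have /dvdpP[q qE] : p %| 'X.
    by apply: pmin; rewrite map_polyX x0 rootX.
  apply/eqP; rewrite -rootX -(map_polyX iota) qE rmorphM rootM py orbT //.
have [z0|z0] := eqVneq z 0; first by rewrite (conj0 z z' zp pz' z0) z0.
have z'0 : z' != 0.
  by apply: contra_neq z0 => z'0; apply: conj0 z'p pz z'0.
have [[a wz] [a' wz']] := (val_fin w z0, val_fin w z'0).
apply/eqP; rewrite eq_le; apply/andP; split.
  by rewrite wz'; apply: conj_val_le z'p pz wz'.
by rewrite wz; apply: conj_val_le zp pz' wz.
Qed.

End CompleteField.

(** * Series with linearly bounded denominators *)

Section TameSeries.
Variables (R : realType) (n : nat) (alpha : 'I_n -> {posnum R}) (k : fieldType).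
Variables (K : fieldType) (v : valuation R K) (pK : {rmorphism mpoly n k -> K}).
Hypothesis pK_weight : weight_valued alpha v pK.
Local Notation hfrac := (homog_frac alpha pK).
Hypothesis all_series : forall A, series_in v hfrac A.
Implicit Types (p q delta : mpoly n k) (d e i c b : R).

Let gG : graded v hfrac := homog_frac_graded pK_weight.

Lemma val_leading A (a : R) : v A = a%:E ->
  exists2 g, hfrac a g & (a%:E < v (A - g)%R)%E.
Proof.
move=> vA; exact: (series_in_leading gG (fun _ _ h => h) (graded0 gG)
  (@gradedD _ _ _ _ gG) (all_series A) vA).
Qed.

(** The homogeneous fractions of degree [i] allowed in [Valpha_delta delta],
    where [e] is the weight of [delta] and [c * i + b] bounds the exponents. *)
Definition bounded_frac delta e c b i : set K := [set h | h = 0 \/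
  exists p m, [/\ homog_of alpha (i + e *+ m) p, m%:R <= c * i + b &
    h = pK p / pK delta ^+ m]].

Lemma bounded_frac0 delta e c b i : bounded_frac delta e c b i 0.
Proof. by left. Qed.

Lemma bounded_fracN delta e c b i h :
  bounded_frac delta e c b i h -> bounded_frac delta e c b i (- h).
Proof.
case=> [->|[p [m [dp mi ->]]]]; first by left; rewrite oppr0.
right; exists (- p), m; split=> //; last by rewrite rmorphN mulNr.
by rewrite -sub0r; apply: homog_ofB => //; apply: homog_of0.
Qed.

Lemma bounded_frac_le delta e c b c' b' i h : c * i + b <= c' * i + b' ->
  bounded_frac delta e c b i h -> bounded_frac delta e c' b' i h.
Proof.
move=> cb [->|[p [m [dp mi ->]]]]; first by left.
by right; exists p, m; split=> //; apply: le_trans cb.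
Qed.

Section Denominator.
Variables (delta : mpoly n k) (e : R).
Hypotheses (delta0 : delta != 0) (delta_e : homog_of alpha e delta).
Local Notation H := (bounded_frac delta e).
Local Notation T c b := (series_in v (H c b)).

Let pd0 : pK delta != 0. Proof. by rewrite (pK_eq0 pK_weight). Qed.

Lemma raise_denominator p m m' : (m <= m')%N ->
  pK p / pK delta ^+ m = pK (p * delta ^+ (m' - m)) / pK delta ^+ m'.
Proof.
move=> mm'; rewrite -{2}(subnK mm') rmorphM rmorphXn exprD.
by rewrite invfM mulrA mulfK // expf_neq0.
Qed.

Lemma homog_raise i p m m' : (m <= m')%N -> homog_of alpha (i + e *+ m) p ->
  homog_of alpha (i + e *+ m') (p * delta ^+ (m' - m)).
Proof.
move=> mm' dp; rewrite -{1}(subnKC mm') mulrnDr addrA.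
by apply: homog_ofM => //; apply: homog_of_exp.
Qed.

Lemma bounded_frac_homog c b i h : H c b i h -> hfrac i h.
Proof.
case=> [->|[p [m [dp _ ->]]]]; first exact: (graded0 gG).
exists (e *+ m), p, (delta ^+ m); split.
- by rewrite expf_neq0.
- exact: homog_of_exp.
- by rewrite addrC.
- by rewrite rmorphXn.
Qed.

Lemma bounded_fracD c b i x y : H c b i x -> H c b i y -> H c b i (x + y).
Proof.
case=> [->|[p [m [dp mi ->]]]]; first by rewrite add0r.
case=> [->|[q [m' [dq mi' ->]]]].
  by rewrite addr0; right; exists p, m.
pose M := maxn m m'; have mM : (m <= M)%N by rewrite leq_maxl.
have m'M : (m' <= M)%N by rewrite leq_maxr.
right; exists (p * delta ^+ (M - m) + q * delta ^+ (M - m')), M; split.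
- by apply: homog_ofD; apply: homog_raise.
- by rewrite /M; case: (leqP m m').
- by rewrite (raise_denominator p mM) (raise_denominator q m'M) rmorphD mulrDl.
Qed.

Lemma bounded_fracM c b b' i j x y :
  H c b i x -> H c b' j y -> H c (b + b') (i + j) (x * y).
Proof.
case=> [->|[p [m [dp mi ->]]]]; first by rewrite mul0r; left.
case=> [->|[q [m' [dq mi' ->]]]]; first by rewrite mulr0; left.
right; exists (p * q), (m + m')%N; split.
- by rewrite mulrnDr addrACA; apply: homog_ofM.
- by rewrite natrD mulrDr addrACA; apply: lerD.
- by rewrite mulf_div rmorphM exprD.
Qed.

Lemma bounded_fracM0 c i j x y : H c 0 i x -> H c 0 j y -> H c 0 (i + j) (x * y).
Proof. by move=> hx hy; have := bounded_fracM hx hy; rewrite addr0. Qed.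

Lemma bounded_frac1 c : H c 0 0 1.
Proof.
right; exists 1, 0%N; rewrite mulr0n addr0 mulr0 addr0; split=> //.
  exact: homog_of1.
by rewrite rmorph1 expr0 divr1.
Qed.

(** The bound matters only from the valuation of the series on; in particular a
    larger slope is always possible, at the expense of the constant term. *)
Lemma bounded_raise r c b c' b' A : (r%:E <= v A)%E ->
    (forall i, r <= i -> c * i + b <= c' * i + b') ->
  T c b A -> T c' b' A.
Proof.
move=> rA cb; apply: (series_in_ge gG) rA _; first by move=> i x; apply: bounded_frac_homog.
by move=> i x ri; apply: bounded_frac_le; apply: cb.
Qed.

Lemma bounded_raise_slope r c b c' b' A : (r%:E <= v A)%E -> c <= c' ->
  b - (c' - c) * r <= b' -> T c b A -> T c' b' A.
Proof.
move=> rA cc' bb'; apply: bounded_raise rA _ => i ri.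
have := ler_wpM2l (_ : 0 <= c' - c) ri; rewrite subr_ge0 => /(_ cc').
by move: bb'; rewrite !mulrBl; lra.
Qed.

End Denominator.

Lemma bounded_frac_mull delta e delta' e' c b i h : delta' != 0 ->
    homog_of alpha e' delta' -> bounded_frac delta e c b i h ->
  bounded_frac (delta * delta') (e + e') c b i h.
Proof.
move=> d0 de' [->|[p [m [dp mi ->]]]]; first by left.
right; exists (p * delta' ^+ m), m; split=> //.
  by rewrite mulrnDl addrA; apply: homog_ofM => //; apply: homog_of_exp.
rewrite !rmorphM rmorphXn exprMn invfM [_^-1 * _]mulrC mulrA mulfK //.
by rewrite expf_neq0 // (pK_eq0 pK_weight).
Qed.

Lemma bounded_frac_mulr delta e delta' e' c b i h : delta' != 0 ->
    homog_of alpha e' delta' -> bounded_frac delta e c b i h ->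
  bounded_frac (delta' * delta) (e' + e) c b i h.
Proof. by rewrite mulrC addrC; apply: bounded_frac_mull. Qed.

(** Series with denominators [delta ^ m] of linearly bounded exponents. In the
    completed field they are the elements of [Kalpha]. *)
Definition tame : set K := [set A | exists delta e c b,
  [/\ delta != 0, homog_of alpha e delta, 0 <= c &
      series_in v (bounded_frac delta e c b) A]].

Lemma tame_join A B : tame A -> tame B -> exists delta e c b,
  [/\ delta != 0, homog_of alpha e delta, 0 <= c &
      series_in v (bounded_frac delta e c b) A /\
      series_in v (bounded_frac delta e c b) B].
Proof.
move=> [d1 [e1 [c1 [b1 [d10 h1 c10 tA]]]]] [d2 [e2 [c2 [b2 [d20 h2 c20 tB]]]]].
have [r rA] := val_lbound v A; have [s sB] := val_lbound v B.
pose c := Num.max c1 c2.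
have c1c : c1 <= c by rewrite le_max lexx.
have c2c : c2 <= c by rewrite le_max lexx orbT.
pose b := Num.max (b1 - (c - c1) * r) (b2 - (c - c2) * s).
exists (d1 * d2), (e1 + e2), c, b.
have d0 : d1 * d2 != 0 by rewrite mulf_neq0.
have h : homog_of alpha (e1 + e2) (d1 * d2) by apply: homog_ofM.
split=> //; first exact: le_trans c1c.
split.
  apply: (bounded_raise_slope d0 h rA c1c (b := b1)); first by rewrite le_max lexx.
  by apply: series_in_sub tA => i x; apply: bounded_frac_mull.
apply: (bounded_raise_slope d0 h sB c2c (b := b2)); first by rewrite le_max lexx orbT.
by apply: series_in_sub tB => i x; apply: bounded_frac_mulr.
Qed.

Lemma tame_homog i h : hfrac i h -> tame h.
Proof.
case=> [d [a [b [b0 db da ->]]]]; exists b, d, 0, 1; split=> //.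
apply: (@series_in_term _ _ v _ i); right; exists a, 1%N.
by rewrite mulr1n addrC expr1 mul0r add0r; split.
Qed.

Lemma tameB A B : tame A -> tame B -> tame (A - B).
Proof.
move=> tA tB; have [d [e [c [b [d0 de c0 [hA hB]]]]]] := tame_join tA tB.
exists d, e, c, b; split=> //; apply: series_inD => //.
by apply: series_inN => // i x; apply: bounded_fracN.
Qed.

Lemma tameM A B : tame A -> tame B -> tame (A * B).
Proof.
move=> tA tB; have [d [e [c [b [d0 de c0 [hA hB]]]]]] := tame_join tA tB.
exists d, e, c, (b + b); split=> //; apply: series_inM hA hB.
by move=> i j x y; apply: bounded_fracM.
Qed.

(** The degrees of a series of positive valuation are bounded below by some
    [r > 0], so the constant term of the bound is absorbed in its slope. With
    constant term zero, the series form a ring that is closed under limits. *)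
Lemma tame_common (s : seq K) : (forall x, x \in s -> tame x /\ (0 < v x)%E) ->
  exists delta e c, [/\ delta != 0, homog_of alpha e delta, 0 <= c &
    forall x, x \in s -> series_in v (bounded_frac delta e c 0) x].
Proof.
elim: s => [_|x s IH xsP].
  by exists 1, 0, 0; rewrite oner_neq0; split=> //; apply: homog_of1.
have [|d2 [e2 [c2 [d20 h2 c20 sP]]]] := IH.
  by move=> y ys; apply: xsP; rewrite inE ys orbT.
have [[d1 [e1 [c1 [b1 [d10 h1 c10 tx]]]]] x0] := xsP x (mem_head _ _).
have [r r0 rx] : exists2 r : R, 0 < r & (r%:E <= v x)%E.
  have [xx|xn0] := eqVneq x 0; first by exists 1; rewrite // xx val0 leey.
  by have [r vx] := val_fin v xn0; exists r; rewrite ?vx // -lte_fin -vx.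
pose b := Num.max 0 b1; pose c3 := c1 + b / r.
have b0 : 0 <= b by rewrite le_max lexx.
have c3_1 : c1 <= c3 by rewrite lerDl divr_ge0 // ltW.
pose c := Num.max c3 c2; exists (d1 * d2), (e1 + e2), c.
have d0 : d1 * d2 != 0 by rewrite mulf_neq0.
have h : homog_of alpha (e1 + e2) (d1 * d2) by apply: homog_ofM.
have c3c : c3 <= c by rewrite le_max lexx.
have c2c : c2 <= c by rewrite le_max lexx orbT.
split=> //; first exact: le_trans c2c.
move=> y; rewrite inE => /orP[/eqP ->|ys].
  apply: (bounded_raise_slope d0 h rx (le_trans c3_1 c3c) (b := b1)).
    rewrite subr_le0; apply: (@le_trans _ _ b); first by rewrite le_max lexx orbT.
    rewrite -ler_pdivrMr // lerBrDr addrC; exact: c3c.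
  by apply: series_in_sub tx => i z; apply: bounded_frac_mull.
have y0 : (0%:E <= v y)%E by apply: ltW; case: (xsP y); rewrite // inE ys orbT.
apply: (bounded_raise_slope d0 h y0 c2c (b := 0)); first by rewrite mulr0 subr0.
by apply: series_in_sub (sP y ys) => i z; apply: bounded_frac_mulr.
Qed.

Lemma tame1 : tame 1.
Proof. by apply: (@tame_homog 0); apply: (graded1 gG). Qed.

(** Up to its initial form, whose inverse is again a homogeneous fraction, the
    inverse of a series is a geometric series in an element of positive
    valuation. *)
Lemma tameV A : tame A -> tame A^-1.
Proof.
move=> tA; have [->|A0] := eqVneq A 0; first by rewrite invr0 -(subrr 1); apply: tameB; apply: tame1.
have [a vA] := val_fin v A0; have [g hg Ag] := val_leading vA.
have [vg -> u0] := div_leadingE vA Ag.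
have tg : tame g^-1 by apply: (@tame_homog (- a)); apply: (gradedV gG hg).
apply: (tameM tg).
have tu : tame (1 - g^-1 * A) by apply: (tameB tame1); apply: (tameM tg tA).
have [|d [e [c [d0 de c0 cP]]]] := @tame_common [:: 1 - g^-1 * A].
  by move=> x; rewrite inE => /eqP ->.
exists d, e, c, 0; split=> //; apply: series_in_inv1B => //.
- by move=> i j x y; apply: bounded_fracM0.
- exact: bounded_frac1.
- by apply: cP; rewrite mem_head.
Qed.

Lemma tame_subfield : subfield_set tame.
Proof.
by split; [exact: tame1|exact: tameB|move=> x y tx ty; exact: (tameM tx (tameV ty))].
Qed.

End TameSeries.

(** * Algebraic elements of the completion have bounded denominators *)

Section Contraction.
Variables (R : realType) (K : fieldType) (v : valuation R K) (H : R -> set K).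
Hypotheses (HM : forall i j x y, H i x -> H j y -> H (i + j) (x * y)) (H1 : H 0 1).

(** Picard iteration: the coefficients of [Q] having positive valuation, [Q] is
    a contraction of the valuation ring and its iterates at [0] converge to [Y]. *)
Lemma series_in_fixpoint (Q : {poly K}) (r : R) Y : 0 < r ->
    (forall i, series_in v H Q`_i) -> (forall i, (r%:E <= v Q`_i)%E) ->
    Q.[Y] = Y -> (0 <= v Y)%E ->
  series_in v H Y.
Proof.
move=> r0 HQ rQ QY Y0; pose y m := iter m (fun z => Q.[z]) 0.
have yP m : [/\ series_in v H (y m), (0 <= v (y m))%E & ((r *+ m)%:E <= v (Y - y m)%R)%E].
  elim: m => [|m [Hy y0 yY]]; first by rewrite /y /= subr0 val0 leey; split=> //; apply: series_in0.
  rewrite /y /= -/(y m); split.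
  - rewrite horner_coef; apply: series_in_sum => i _ _.
    by apply: (series_inM HM) => //; apply: series_inX.
  - rewrite horner_coef; apply: val_sum_ge => i _ _.
    rewrite valM; apply: adde_ge0; first by apply: le_trans (rQ i); rewrite lee_fin ltW.
    by have := valX_ge i y0; rewrite mul0rn.
  - rewrite -{1}QY !horner_coef -sumrB; apply: val_sum_ge => i _ _.
    rewrite -mulrBr subrXX mulrS; apply: valM_ge => //.
    rewrite -[_ *+ m]addr0; apply: valM_ge => //; apply: val_sum_ge => j _ _.
    rewrite valM; apply: adde_ge0.
      by have := valX_ge (i.-1 - j) Y0; rewrite mul0rn.
    by have := valX_ge j y0; rewrite mul0rn.
apply: series_in_closed => c; have [N NP] := nat_above (c / r).
have [Hy _ yY] := yP N; exists (y N) => //; apply: le_trans yY.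
by rewrite lee_fin -mulr_natr mulrC -ler_pdivrMr // NP.
Qed.

Lemma horner_bounded (p : {poly K}) (A : K) :
  exists B : R, forall x, (0 <= v (x - A)%R)%E -> (B%:E <= v p.[x])%E.
Proof.
have [r rA] := val_lbound v A; pose s := Num.min 0 r.
have sx x : (0 <= v (x - A)%R)%E -> (s%:E <= v x)%E.
  move=> xA; rewrite -(subrK A x); apply: valD_ge.
    by apply: le_trans xA; rewrite lee_fin ge_min lexx.
  by apply: le_trans rA; rewrite lee_fin ge_min lexx orbT.
elim/poly_ind: p => [|p c [B BP]]; first by exists 0 => x _; rewrite horner0 val0 leey.
have [e ec] := val_lbound v c; exists (Num.min (B + s) e) => x xA.
rewrite hornerMXaddC; apply: valD_ge.
  apply: le_trans (valM_ge (BP x xA) (sx x xA)).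
  by rewrite lee_fin ge_min lexx.
by apply: le_trans ec; rewrite lee_fin ge_min lexx orbT.
Qed.

Lemma nderiv_bounded (f : {poly K}) (A : K) : exists B : R, forall x j,
  (0 <= v (x - A)%R)%E -> (B%:E <= v (nderivn j f).[x])%E.
Proof.
have /choice[B BP] := fun j : nat => horner_bounded (nderivn j f) A.
exists (\big[Num.min/0]_(j < size f) B j) => x j xA.
have [jf|fj] := ltnP j (size f); last by rewrite nderivn_poly0 // horner0 val0 leey.
apply: le_trans (BP j x xA); rewrite lee_fin (bigminD1 (Ordinal jf)) //=.
by rewrite ge_min lexx.
Qed.

Lemma deriv_val_near (f : {poly K}) (A : K) (m : R) : v f^`().[A] = m%:E ->
  exists B : R, forall x, (0 <= v (x - A)%R)%E -> (B%:E <= v (x - A)%R)%E ->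
    v f^`().[x] = m%:E.
Proof.
move=> fA; pose g := f^`() - f^`().[A]%:P.
have /factor_theorem[h gE] : root g A by rewrite rootE !hornerE subrr.
have [B BP] := horner_bounded h A; exists (m - B + 1) => x x0 xB.
rewrite -fA; apply: val_close.
have -> : f^`().[x] - f^`().[A] = h.[x] * (x - A).
  by have := congr1 (fun p => p.[x]) gE; rewrite !hornerE.
apply: lt_le_trans (valM_ge (BP x x0) xB).
rewrite fA lte_fin; lra.
Qed.

End Contraction.

Section RelativeClosure.
Variables (R : realType) (n : nat) (alpha : 'I_n -> {posnum R}) (k : fieldType).
Variables (K : fieldType) (v : valuation R K) (pK : {rmorphism mpoly n k -> K}).
Hypothesis pK_weight : weight_valued alpha v pK.
Hypothesis all_series : forall A, series_in v (homog_frac alpha pK) A.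
Hypothesis n_gt0 : (0 < n)%N.
Hypothesis K_char0 : [pchar K] =i pred0.

Local Notation tame := (tame alpha v pK).
Let tame_sub : subfield_set tame := tame_subfield pK_weight all_series.

(** Truncate the simple root [A] to [A0]. After the rescaling [A = A0 + t * Y] by a
    monomial [t] of large weight, Taylor expansion turns the equation into a
    fixed point equation [Y = Q(Y)] where [Q] has coefficients of positive
    valuation, and Picard iteration bounds the denominators of [Y]. *)
Lemma tame_simple_root (f : {poly K}) A : (forall i, tame f`_i) ->
  root f A -> ~~ root f^`() A -> tame A.
Proof.
move=> tf fA f'A; have [m f'm] := val_fin v f'A.
have f2 : (1 < size f)%N.
  rewrite ltnNge; apply/negP => f1; move: f'A; rewrite (size1_polyC f1) derivC.
  by rewrite root0.
have [B BP] := nderiv_bounded v f A; have [B' B'P] := deriv_val_near f'm.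
have [p [d [p0 dp dB]]] := monomial_large alpha k (Num.max 1 (m - B + 1)) n_gt0.
move: dB; rewrite ge_max => /andP[d1 dB].
pose t := pK p; have vt : v t = d%:E := val_pK pK_weight dp p0.
have t0 := val_neq0 vt.
have [s hs] := all_series A (Num.max 0 (Num.max (d + 1) B')).
rewrite EFin_max ge_max EFin_max ge_max => /and3P[As0 Asd AsB'].
pose A0 := gsum s; pose Y := (A - A0) / t.
have tA0 : tame A0.
  rewrite /A0 /gsum big_seq; apply: (subfield_sum tame_sub) => u /hs.
  exact: (tame_homog v).
have tt : tame t by apply: (tame_homog v); apply: homog_frac_poly dp.
rewrite val_sym in As0; rewrite val_sym in AsB'.
pose F j := (nderivn j f).[A0].
have tF j : tame (F j).
  apply: (subfield_horner tame_sub) => // i; rewrite coef_nderivn -mulr_natr.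
  by apply: (subfieldM tame_sub) => //; apply: (subfield_nat tame_sub).
have vF1 : v (F 1%N) = m%:E by rewrite /F poly.nderivn1; apply: B'P.
have F10 := val_neq0 vF1.
have sumF : \sum_(i < size f) F i * (A - A0) ^+ i = 0.
  have := nderiv_taylor f (mulrC A0 (A - A0)).
  by rewrite addrC subrK (rootP fA) => <-.
(* Divide the Taylor expansion at [A0] by [t * F 1] and solve it for its linear
   term, which is then [Y]. *)
pose q j := if j == 1%N then 0 else - (F j * t ^+ j / (t * F 1%N)).
pose Q := \poly_(j < size f) q j.
have tq j : tame (q j).
  rewrite /q; case: eqP => _; first exact: (subfield0 tame_sub).
  apply: (subfieldN tame_sub); apply: (subfield_div tame_sub).
    by apply: (subfieldM tame_sub) => //; apply: (subfieldX tame_sub).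
  exact: (subfieldM tame_sub).
have YE : A - A0 = t * Y by rewrite /Y mulrC divfK.
have qY j : q j * Y ^+ j = - (if j == 1%N then 0 else F j * (A - A0) ^+ j) / (t * F 1%N).
  rewrite /q; case: eqP => _; first by rewrite oppr0 !mul0r.
  have -> : (A - A0) ^+ j = t ^+ j * Y ^+ j by rewrite -exprMn -YE.
  by move: (t ^+ j) (Y ^+ j) => x y; field; rewrite F10 t0.
have QY : Q.[Y] = Y.
  rewrite horner_poly (eq_bigr _ (fun (j : 'I_(size f)) _ => qY j)) -mulr_suml sumrN.
  have -> : \sum_(j < size f) (if j == 1%N :> nat then 0 else F j * (A - A0) ^+ j)
      = - (F 1%N * (A - A0)).
    apply/eqP; rewrite -addr_eq0; apply/eqP; rewrite -[RHS]sumF.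
    rewrite [X in X + _](bigD1 (Ordinal f2)) //= add0r addrC.
    rewrite [RHS](bigD1 (Ordinal f2)) //= expr1; congr (_ + _).
    by apply: eq_bigr => j; rewrite -val_eqE /= => /negbTE ->.
  by rewrite opprK /Y; field; rewrite F10 t0.
have vY : (1%:E <= v Y)%E.
  have -> : (1 : R) = (d + 1) + (- d) by lra.
  by apply: valM_ge => //; rewrite (valV vt).
have Y0 : (0 <= v Y)%E by apply: le_trans vY; rewrite lee_fin.
have q1 j : (0 < j)%N -> (1%:E <= v (q j))%E.
  rewrite /q; case: eqP => [_|j1 j0]; first by rewrite val0 leey.
  have jge : 1 <= B + d *+ j + - (d + m).
    have : d * 2 <= d *+ j.
      rewrite -(mulr_natr d j) ler_wpM2l //; first by move: d1; lra.
      by rewrite ler_nat; move: j1 j0; case: (j) => [|[|]].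
    by move: dB; lra.
  rewrite valN; apply: (@le_trans _ _ (B + d *+ j + - (d + m))%:E); first by rewrite lee_fin.
  apply: valM_ge; last by rewrite (valV (a := d + m)) // valM vt vF1.
  by apply: valM_ge; [apply: BP|rewrite (valX _ vt)].
have q01 : (1%:E <= v (q 0%N))%E.
  move: QY; rewrite horner_poly; case: (size f) f2 => // N _.
  rewrite big_ord_recl /= expr0 mulr1 => qE.
  have -> : q 0%N = Y - \sum_(i < N) q (lift ord0 i) * Y ^+ lift ord0 i.
    by rewrite -[X in X - _]qE addrK.
  apply: valB_ge => //; apply: val_sum_ge => i _ _.
  rewrite -[1]addr0; apply: valM_ge; first exact: q1.
  by have := valX_ge (lift ord0 i) Y0; rewrite mul0rn.
have Q1 j : (1%:E <= v Q`_j)%E.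
  rewrite coef_poly; case: ltnP => _; last by rewrite val0 leey.
  by case: j => [|j]; [exact: q01|exact: q1].
have tQ j : tame Q`_j.
  by rewrite coef_poly; case: ltnP => _; [exact: tq|exact: (subfield0 tame_sub)].
have [|delta [e [c [d0 de c0 QP]]]] := @tame_common _ _ alpha _ _ v _ pK_weight Q.
  move=> x /(nthP 0)[j _ <-]; split; first exact: tQ.
  by apply: lt_le_trans (Q1 j); rewrite lte_fin.
have tY : tame Y.
  exists delta, e, c, 0; split=> //.
  apply: (@series_in_fixpoint _ _ v _ _ _ Q 1) => //.
  - by move=> i j x y; apply: bounded_fracM0.
  - exact: bounded_frac1.
  - move=> i; have [iQ|Qi] := ltnP i (size Q); first by apply: QP; apply: mem_nth.
    by rewrite nth_default //; apply: series_in0.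
rewrite -(subrK A0 A) YE; apply: (subfieldD tame_sub) => //.
exact: (subfieldM tame_sub).
Qed.

(** In characteristic zero, differentiate an equation of [A] until [A] becomes a
    simple root. *)
Lemma tame_algebraic (f : {poly K}) A : f != 0 -> (forall i, tame f`_i) ->
  root f A -> tame A.
Proof.
have [N] := ubnP (size f); elim: N => // N IH in f *; rewrite ltnS => fN f0 tf fA.
have [f'A|] := boolP (root f^`() A); last exact: tame_simple_root.
have f1 : (1 < size f)%N by apply: root_size_gt1 fA.
have fc n' : (0 < n')%N -> n'%:R != 0 :> K.
  by rewrite lt0n; apply: contraNneq; move/pcharf0P: K_char0 => <- ->.
apply: (IH f^`()) => //.
- exact: leq_trans (lt_size_deriv f0) fN.
- apply/eqP => /(congr1 (fun p : {poly K} => p`_(size f).-2)).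
  rewrite coef_deriv coef0 -mulr_natr => /eqP; rewrite mulf_eq0.
  have -> : (size f).-2.+1 = (size f).-1 by case: (size f) f1 => [|[]].
  rewrite -/(lead_coef f) lead_coef_eq0 (negbTE f0) /=; apply/negP.
  by apply: fc; rewrite -subn1 subn_gt0.
- move=> i; rewrite coef_deriv -mulr_natr.
  by apply: (subfieldM tame_sub) => //; apply: (subfield_nat tame_sub).
Qed.

End RelativeClosure.

(** * Finite generation of the exponents *)

Section Exponents.
Variables (R : realType) (n : nat) (alpha : 'I_n -> {posnum R}).
Implicit Types (beta : multinom n) (e c b i : R).
Local Notation wt := (weight alpha).

Lemma mnm_sub1K beta j : (0 < beta j)%N ->
  beta = mnm_add (mnm1 j) (mnm_sub beta (mnm1 j)).
Proof.
move=> bj; apply/mnmP => l; rewrite mnmDE mnmBE mnm1E.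
by case: eqP => [<-|_]; rewrite ?add0n ?subn0 // subnKC.
Qed.

Lemma mdeg_sub1 beta j : (0 < beta j)%N -> mdeg beta = (mdeg (mnm_sub beta (mnm1 j))).+1.
Proof. by move=> /mnm_sub1K {1}->; rewrite mdegD mdeg1. Qed.

Lemma weight_gt0_ex beta : 0 < wt beta -> exists j, (0 < beta j)%N.
Proof.
move=> b0; apply: contrapT => nb; move: b0; rewrite /weight big1 ?ltxx // => j _.
have [->|bj] := posnP (beta j); first by rewrite mulr0.
by case: nb; exists j.
Qed.

Let S : R := \sum_(j < n) (alpha j)%:num.

Let alphaS j : (alpha j)%:num <= S.
Proof. by rewrite /S (bigD1 j) //= lerDl; apply: sumr_ge0. Qed.

(** Remove variables one by one: each step lowers the weight by at most [S]. *)
Lemma sub_monomial beta r : 0 <= r -> r <= wt beta ->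
  exists beta1 beta2, beta = mnm_add beta1 beta2 /\ r <= wt beta1 <= r + S.
Proof.
move=> r0; have [m] := ubnP (mdeg beta); elim: m => // m IH in beta *.
rewrite ltnS => bm rb; have [bS|bS] := leP (wt beta) (r + S).
  by exists beta, mnm0; rewrite addm0 rb.
have S0 : 0 <= S by apply: sumr_ge0.
have [j bj] : exists j, (0 < beta j)%N.
  by apply: weight_gt0_ex; apply: le_lt_trans bS; rewrite addr_ge0.
have bE := mnm_sub1K bj; have [||b1 [b2 [E h]]] := IH (mnm_sub beta (mnm1 j)).
- by rewrite -ltnS -mdeg_sub1.
- have : wt beta = (alpha j)%:num + wt (mnm_sub beta (mnm1 j)).
    by rewrite {1}bE weightD weight_mnm1.
  by move: bS (alphaS j); lra.
exists b1, (mnm_add (mnm1 j) b2); split=> //; rewrite {1}bE E.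
by apply/mnmP => l; rewrite !mnmDE addnCA.
Qed.

(** [wt beta - e *+ m] is the degree of [x ^ beta / delta ^ m] if [e] is the
    weight of [delta]. The generators are the degrees with [m <= M2] and
    [wt beta <= W]. Any other one is the sum of a generator and of the degree of a
    smaller pair [(beta, m)], which satisfies the same bound or [m < M]: if
    [m >= M], subtract a block [(beta1, M)] with
    [M * e <= wt beta1 <= M * e + M / c], otherwise a single variable. The
    semigroup condition in [Valpha_delta] thus follows from the linear bound. *)
Lemma exponents_fg_pos e c b : 0 <= e -> 0 < c -> 0 <= b -> exists gens : seq R,
  all (fun x => 0 <= x) gens /\
  forall beta (m : nat), 0 <= wt beta - e *+ m -> m%:R <= c * (wt beta - e *+ m) + b ->
    smallest [set X : set R | forall x y, X x -> X y -> X (x + y)] [set` gens]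
      (wt beta - e *+ m).
Proof.
move=> e0 c0 b0; have S0 : 0 <= S by apply: sumr_ge0.
have [M /(_ M (leqnn M))] := nat_above (Num.max 1 (c * S)).
rewrite ge_max => /andP[M1 McS].
have [M2 /(_ M2 (leqnn M2)) MM2] := nat_above (M%:R + b).
have M_gt0 : (0 < M)%N by rewrite -(ltr_nat R); apply: lt_le_trans M1.
have leM : (M <= M2)%N by rewrite -(ler_nat R); move: MM2 b0; lra.
pose B := M%:R / c; have cB : c * B = M%:R by rewrite /B mulrC divfK // gt_eqF.
have SB : S <= B by rewrite ler_pdivlMr // mulrC.
pose W := B + e *+ M2; have eM : e *+ M <= e *+ M2.
  by rewrite -!(mulr_natr e) ler_wpM2l // ler_nat.
have [d dP] := weight_fin alpha W.
pose gens := [seq x <- [seq wt (bmnm u) - e *+ m | u <- enum {: bmultinom n d.+1},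
  m <- iota 0 M2.+1] | 0 <= x].
have gensP beta (m : nat) : 0 <= wt beta - e *+ m -> wt beta <= W -> (m <= M2)%N ->
    wt beta - e *+ m \in gens.
  move=> i0 bW mM2; rewrite mem_filter i0 andTb; apply/allpairsPdep.
  exists (BMultinom (dP _ bW : (mdeg beta < d.+1)%N)), m.
  by rewrite mem_enum mem_iota; split.
exists gens; split; first by apply/allP => x; rewrite mem_filter => /andP[].
move=> beta m i0 mi X [XD Xgens].
have {mi} : m%:R <= c * (wt beta - e *+ m) + b \/ (m < M)%N by left.
have [N] := ubnP (m + mdeg beta); elim: N => // N IH in beta m i0 *.
rewrite ltnS => mN h.
have [/andP[bW mM2]|] := boolP ((wt beta <= W) && (m <= M2)%N).
  by apply: Xgens; apply: gensP.
move=> large; have [mM|Mm] := ltnP m M.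
  have mM2 : (m <= M2)%N by rewrite ltnW // (leq_trans mM).
  have em : e *+ m <= e *+ M2 by rewrite -!(mulr_natr e) ler_wpM2l // ler_nat.
  move: large; rewrite mM2 andbT -ltNge => Wb.
  have W0 : 0 <= W by apply: addr_ge0; [exact: le_trans S0 SB|exact: mulrn_wge0].
  have [j bj] : exists j, (0 < beta j)%N by apply: weight_gt0_ex; apply: le_lt_trans Wb.
  have bE : wt beta = (alpha j)%:num + wt (mnm_sub beta (mnm1 j)).
    by rewrite {1}(mnm_sub1K bj) weightD weight_mnm1.
  rewrite bE -addrA; apply: XD.
    apply: Xgens; have := @gensP (mnm1 j) 0%N; rewrite weight_mnm1 subr0; apply=> //.
    by move: (alphaS j) SB; rewrite /W; move: (mulrn_wge0 M2 e0); lra.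
  apply: IH; last by right.
    by move: Wb (alphaS j) SB em; rewrite bE /W; lra.
  by rewrite (leq_trans _ mN) // ltn_add2l (mdeg_sub1 bj).
have {h} mi : m%:R <= c * (wt beta - e *+ m) + b.
  by case: h => //; rewrite ltnNge Mm.
have [iB|Bi] := ltP (wt beta - e *+ m) B.
  have mM2 : (m <= M2)%N.
    rewrite -(ler_nat R); apply: le_trans MM2; apply: le_trans mi _.
    by rewrite lerD2r -cB ler_pM2l // ltW.
  have em : e *+ m <= e *+ M2 by rewrite -!(mulr_natr e) ler_wpM2l // ler_nat.
  by case/negP: large; rewrite mM2 andbT; move: iB em; rewrite /W; lra.
have em : e *+ M <= e *+ m by rewrite -!(mulr_natr e) ler_wpM2l // ler_nat.
have [||b1 [b2 [bE /andP[b1l b1u]]]] := @sub_monomial beta (e *+ M).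
- exact: mulrn_wge0.
- by move: i0 em; lra.
have iE : wt beta - e *+ m = (wt b1 - e *+ M) + (wt b2 - e *+ (m - M)).
  by rewrite bE weightD mulrnBr //; ring.
rewrite iE; apply: XD.
  apply: Xgens; apply: gensP => //; first by rewrite subr_ge0.
  by rewrite /W; move: b1u SB eM; lra.
apply: IH.
- by move: iE Bi b1u SB; lra.
- apply: leq_trans mN; rewrite bE mdegD.
  by rewrite addnA ltn_add2r ltn_addr // ltn_subrL M_gt0 (leq_trans M_gt0).
left; rewrite natrB //.
have : c * (wt b1 - e *+ M) <= c * B by rewrite ler_pM2l //; move: b1u SB; lra.
by move: mi; rewrite iE mulrDr cB; lra.
Qed.

Lemma exponents_fg e c b : 0 <= e -> exists gens : seq R,
  all (fun x => 0 <= x) gens /\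
  forall beta (m : nat), 0 <= wt beta - e *+ m -> m%:R <= c * (wt beta - e *+ m) + b ->
    smallest [set X : set R | forall x y, X x -> X y -> X (x + y)] [set` gens]
      (wt beta - e *+ m).
Proof.
move=> e0; have c1 : 0 < Num.max 1 c by rewrite lt_max ltr01.
have b1 : 0 <= Num.max 0 b by rewrite le_max lexx.
have [gens [g0 gP]] := exponents_fg_pos e0 c1 b1; exists gens; split=> // beta m i0 mi.
apply: gP => //; apply: le_trans mi _; apply: lerD; last by rewrite le_max lexx orbT.
by rewrite ler_wpM2r // le_max lexx orbT.
Qed.

End Exponents.

Lemma eq_big_support (V : nmodType) (T : eqType) (r1 r2 : seq T) (P : pred T)
    (h : T -> V) : uniq r1 -> uniq r2 ->
    (forall i, P i -> h i != 0 -> (i \in r1) = (i \in r2)) ->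
  \sum_(i <- r1 | P i) h i = \sum_(i <- r2 | P i) h i.
Proof.
move=> u1 u2 E; pose Q i := P i && (h i != 0).
have S r : \sum_(i <- r | P i) h i = \sum_(i <- [seq i <- r | Q i]) h i.
  rewrite big_filter (bigID (fun i => h i != 0)) /= addrC big1 ?add0r // => i.
  by rewrite negbK => /andP[_ /eqP].
rewrite !S; apply: perm_big; apply: uniq_perm; rewrite ?filter_uniq // => i.
by rewrite !mem_filter; case: (boolP (Q i)) => // /andP[Pi hi]; apply: E.
Qed.

Section BoundedSums.
Variables (R : realType) (n : nat) (alpha : 'I_n -> {posnum R}) (k : fieldType).
Variables (K : fieldType) (v : valuation R K) (pK : {rmorphism mpoly n k -> K}).
Hypothesis pK_weight : weight_valued alpha v pK.
Implicit Types (p q delta : mpoly n k) (d e i c b : R).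
Local Notation tame := (tame alpha v pK).
Let gG := homog_frac_graded pK_weight.

(** The condition that defines [Valpha_delta delta], in an abstract field. *)
Definition bounded_sum delta (A : K) : Prop :=
  exists (L : set R) (a : R -> mpoly n k) (m : R -> nat),
  [/\ fg_subsemigroup L,
      (forall i, L i -> [/\ alpha_homog alpha (a i), (0 < m i)%N &
         a i != 0 -> v (pK (a i) / pK delta ^+ m i) = i%:E]),
      (exists c b : R, 0 <= c /\ forall i, L i -> (m i)%:R <= c * i + b) &
      has_sum v L (fun i => pK (a i) / pK delta ^+ m i) A].

Lemma bounded_sum_tame delta A : delta != 0 -> alpha_homog alpha delta ->
  bounded_sum delta A -> tame A.
Proof.
move=> delta0 [e de] [L [a [m [_ aP [c [b [c0 mb]]] hs]]]].
exists delta, e, c, b; split=> // C; have [F0 [F0L F0P]] := hs C.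
exists [seq (i, pK (a i) / pK delta ^+ m i) | i <- enum_fset F0]; last first.
  rewrite /gsum big_map; exact: (F0P F0).
move=> _ /mapP[i iF ->] /=; have Li : L i by apply: F0L.
have [[d da] _ ai] := aP i Li; have [a0|a0] := eqVneq (a i) 0.
  by left; rewrite a0 rmorph0 mul0r.
right; exists (a i), (m i); split=> //; last exact: mb.
have := ai a0; rewrite (val_div (val_pK pK_weight da a0) (valX _ (val_pK pK_weight de delta0))) => -[iE].
by rewrite -{1}iE subrK.
Qed.

(** The components of the series give the family of terms; the exponents are
    made positive by an extra factor [delta] in numerators and denominators. *)
Lemma tame_bounded_sum x : tame x -> (0 <= v x)%E ->
  exists delta, [/\ delta != 0, alpha_homog alpha delta & bounded_sum delta x].
Proof.
move=> [delta [e [c [b [d0 de c0 tx]]]]] x0.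
exists delta; split=> //; first by exists e.
have HG i h : bounded_frac alpha pK delta e c b i h -> homog_frac alpha pK i h.
  exact: (bounded_frac_homog pK_weight d0 de).
have [h hH hP] := series_in_components gG HG (bounded_frac0 alpha pK delta e c b)
  (bounded_fracD pK_weight d0 de (c := c) (b := b)) tx.
have h_neg i : i < 0 -> h i = 0.
  move=> i0; have [s hs s1] := tx 1; rewrite (hP 1 s) //.
  - apply: (gsum_comp_eq0 gG (c := 0)) => //; first by move=> t /hs /HG.
    by apply: (val_approx x0); apply: le_trans s1; rewrite lee_fin.
  - by move=> t /hs /HG.
  - exact: lt_trans i0 ltr01.
have e0 : 0 <= e.
  by have [mm _] := pK_weight d0; rewrite (val_pK pK_weight de d0) => -[->]; exact: weight_ge0.
have [gens [gens0 gensP]] := @exponents_fg R n alpha e c b e0.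
pose L := smallest [set X : set R | forall x y, X x -> X y -> X (x + y)] [set` gens].
have L0 i : L i -> 0 <= i.
  move=> Li; apply: (Li [set x : R | 0 <= x]); split=> [y z|y /= /(allP gens0)//].
  exact: addr_ge0.
have hL i : h i != 0 -> L i.
  move=> hi; have i0 : 0 <= i by rewrite leNgt; apply: contra hi => /h_neg ->.
  case: (hH i) hi => [->|[p [m [dp mi hE]]]]; first by rewrite eqxx.
  rewrite hE mulf_eq0 (pK_eq0 pK_weight) negb_or => /andP[p0 _].
  have [beta bp _] := pK_weight p0; have iE : i = weight alpha beta - e *+ m.
    by rewrite (dp _ bp) addrK.
  by move: mi i0; rewrite iE => mi i0; apply: gensP.
pose b' := Num.max 1 (b + 1).
have /choice[am amP] : forall i, exists am : mpoly n k * nat,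
    [/\ homog_of alpha (i + e *+ am.2) am.1, (0 < am.2)%N,
        0 <= i -> am.2%:R <= c * i + b' & h i = pK am.1 / pK delta ^+ am.2].
  move=> i; have [h0|[p [m [dp mi hE]]]] := hH i.
    exists (0, 1%N); split=> //=; first exact: homog_of0.
      move=> i0; apply: (@le_trans _ _ b'); first by rewrite le_max lexx.
      by rewrite lerDr mulr_ge0.
    by rewrite h0 rmorph0 mul0r.
  exists (p * delta ^+ 1, m.+1); split=> //=.
  - by have := homog_raise de (leqnSn m) dp; rewrite subSnn.
  - move=> _; rewrite -natr1; apply: (@le_trans _ _ (c * i + (b + 1))).
      by rewrite addrA lerD2r.
    by rewrite lerD2l le_max lexx orbT.
  - by rewrite hE (raise_denominator pK_weight d0 p (leqnSn m)) subSnn.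
exists L, (fun i => (am i).1), (fun i => (am i).2); split.
- by exists gens.
- move=> i Li; have [da m0 mb aE] := amP i; split=> //; first exact: homog_of_alpha da.
  move=> a0; rewrite (val_div (val_pK pK_weight da a0) (valX _ (val_pK pK_weight de d0))).
  by rewrite addrK.
- by exists c, b'; split=> // i /L0 i0; have [_ _ + _] := amP i; apply.
move=> C; have [s hs sC] := tx C.
have Gs : terms (homog_frac alpha pK) s by move=> t /hs /HG.
pose I := undup [seq t.1 | t <- s].
have sumI : \sum_(i <- I | i < C) h i = \sum_(t <- s | t.1 < C) t.2.
  rewrite (eq_bigr (fun i => \sum_(t <- s | t.1 == i) t.2)); last first.
    by move=> i iC; apply: hP sC i iC.
  rewrite (exchange_big_dep (fun t : R * K => t.1 < C)) /=; last first.
    by move=> i t iC /eqP ->.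
  rewrite big_seq_cond [RHS]big_seq_cond; apply: eq_bigr => t /andP[ts tC].
  rewrite (eq_bigl (pred1 t.1)) => [|i]; last first.
    by rewrite /= eq_sym; case: eqP => [->|_]; rewrite ?andbF ?andbT.
  by rewrite -big_filter filter_pred1_uniq ?undup_uniq ?big_seq1 // mem_undup map_f.
exists [fset i in [seq i <- I | (i < C) && (h i != 0)]]%fset; split.
  by move=> i /=; rewrite !inE /= mem_filter => /andP[/andP[_ /hL]].
move=> F F0F FL.
rewrite (eq_bigr h) => [|i _]; last by case: (amP i).
have sumF : \sum_(i <- F | i < C) h i = \sum_(i <- I | i < C) h i.
  apply: eq_big_support; rewrite ?fset_uniq ?undup_uniq // => i iC hi.
  have iI : i \in I.
    rewrite mem_undup; apply: contraNT hi => iI; rewrite (hP C s Gs sC i iC) big_seq_cond.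
    rewrite big_pred0 // => t; apply/negbTE/negP => /andP[ts /eqP ti].
    by case/negP: iI; rewrite -ti; apply: map_f.
  rewrite iI; apply: (fsubsetP F0F); by rewrite !inE /= mem_filter iC hi iI.
apply: (val_chain (y := gsum s)) => //.
have -> : gsum s - \sum_(i <- F) h i =
    \sum_(t <- s | ~~ (t.1 < C)) t.2 - \sum_(i <- F | ~~ (i < C)) h i.
  rewrite /gsum (bigID (fun t => t.1 < C)) [X in _ - X](bigID (fun i => i < C)) /=.
  by rewrite sumF sumI opprD addrACA subrr add0r.
apply: valB_ge; [apply: val_sum_ge => t ts|apply: val_sum_ge => i _]; rewrite -leNgt => Ci.
  by apply: le_trans (graded_val_ge gG (Gs t ts)); rewrite lee_fin.
by apply: le_trans (graded_val_ge gG (HG _ _ (hH i))); rewrite lee_fin.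
Qed.

End BoundedSums.

Section KalphaTame.
Variables (R : realType) (n : nat) (alpha : 'I_n -> {posnum R}) (k : fieldType).

Local Notation K := (Khat alpha k).
Local Notation v := (Khat_val alpha k).
Local Notation pK := (mpoly_to_Khat alpha k).
Local Notation pKw := (@Khat_weight_valued R n alpha k).
Local Notation tame := (tame alpha v pK).
Let tame_sub : subfield_set tame := tame_subfield pKw (@series_all _ _ alpha k).

Lemma Valpha_tame A : Valpha A -> tame (Vhat_to_Khat alpha k A).
Proof. by move=> [delta [d0 dh] dA]; apply: (bounded_sum_tame pKw d0 dh). Qed.

Lemma tame_ge0_Valpha x : tame x -> (0 <= v x)%E ->
  exists A, Valpha A /\ x = Vhat_to_Khat alpha k A.
Proof.
move=> tx x0; have [A AE] := Vhat_ge0 x0; exists A; split=> //.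
have [delta [d0 dh]] := tame_bounded_sum pKw tx x0; rewrite AE => dA.
by exists delta.
Qed.

Lemma KalphaE x : (0 < n)%N -> Kalpha x <-> tame x.
Proof.
move=> n0; split=> [[a [b [ta tb b0 ->]]]|tx].
  by apply: (subfield_div tame_sub); apply: Valpha_tame.
have [r rx] := val_lbound v x.
have [p [d [p0 dp rd]]] := monomial_large alpha k (Num.max 0 (- r)) n0.
move: rd; rewrite ge_max => /andP[d0 rd].
have vp := val_pK pKw dp p0.
have tp : tame (pK p) by apply: (tame_homog v); apply: homog_frac_poly dp.
have [|b [Vb bE]] := tame_ge0_Valpha tp; first by rewrite vp lee_fin.
have [|a [Va aE]] := tame_ge0_Valpha (subfieldM tame_sub tp tx).
  have dv : (d%:E <= v (pK p))%E by rewrite vp.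
  apply: le_trans (valM_ge dv rx); rewrite lee_fin.
  by rewrite -lerBlDr sub0r.
exists a, b; split=> //; rewrite -?aE -?bE; last by rewrite mulrC mulKf // (val_neq0 vp).
by apply: contraTneq p0 => b0; rewrite negbK -(pK_eq0 pKw) bE b0 rmorph0.
Qed.

End KalphaTame.

(** * Homogeneous elements of the algebraic closure *)

Lemma horner_map_comp_XsubC (K L : fieldType) (iota : {rmorphism K -> L})
    (p : {poly K}) x z :
  (map_poly iota (p \Po ('X - x%:P))).[z] = (map_poly iota p).[z - iota x].
Proof.
rewrite map_comp_poly horner_comp rmorphB /= map_polyX map_polyC /=.
by rewrite !hornerE.
Qed.

Section HomogeneousElements.
Variables (R : realType) (n : nat) (alpha : 'I_n -> {posnum R}) (k : fieldType).
Variables (K : fieldType) (v : valuation R K) (pK : {rmorphism mpoly n k -> K}).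
Hypothesis pK_weight : weight_valued alpha v pK.
Local Notation hfrac := (homog_frac alpha pK).
Hypothesis all_series : forall A, series_in v hfrac A.
Hypothesis n_gt0 : (0 < n)%N.
Hypothesis K_char0 : [pchar K] =i pred0.
Hypothesis v_complete : forall u : nat -> K, cauchy_for_val v u ->
  exists A, forall c : R, exists N : nat, forall i : nat, (N <= i)%N ->
    (c%:E <= v (A - u i)%R)%E.
Variables (Omega : closedFieldType) (iota : {rmorphism K -> Omega}).
Variable w : valuation R Omega.
Hypothesis Omega_alg : forall z, algebraicOver iota z.
Hypothesis w_ext : forall x, w (iota x) = v x.
Implicit Types (d a : R) (g x y : K) (z : Omega).

Local Notation tame := (tame alpha v pK).
Let tame_sub : subfield_set tame := tame_subfield pK_weight all_series.
Let gG : graded v hfrac := homog_frac_graded pK_weight.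
Local Notation "p ^i" := (map_poly iota p) (at level 2, format "p ^i").

Lemma hfrac0_subfield : subfield_set (hfrac 0).
Proof.
split; first exact: (graded1 gG); first exact: (gradedB gG).
by move=> x y hx hy; have := gradedM gG hx (gradedV gG hy); rewrite subr0.
Qed.

Local Notation Ebar := (algebraic_over iota (hfrac 0)).

Let Ebar_sub : subfield_set Ebar := algebraic_over_subfield iota hfrac0_subfield.

(** [degree_elt d z]: up to a factor algebraic over the residue field, [z] is a
    radical of a homogeneous fraction; such elements form the component of degree
    [d] of a graded ring that contains the homogeneous fractions. *)
Definition degree_elt d : set Omega := [set z | z = 0 \/ exists q g,
  [/\ (0 < q)%N, hfrac (d *+ q) g, g != 0 & Ebar (z ^+ q / iota g)]].

Lemma root_prod_XsubC_map (p : {poly K}) : p \is monic ->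
  exists rs : seq Omega, p^i = \prod_(r <- rs) ('X - r%:P).
Proof.
move=> pm; have [rs E] := closed_field_poly_normal p^i; exists rs.
by move: E; rewrite lead_coef_map (monicP pm) rmorph1 scale1r.
Qed.

Lemma mem_rootsE (p : {poly Omega}) (rs : seq Omega) z :
  p = \prod_(r <- rs) ('X - r%:P) -> (z \in rs) = root p z.
Proof. by move=> ->; rewrite root_prod_XsubC. Qed.

Lemma root_of m z : (0 < m)%N -> exists y : Omega, y ^+ m = z.
Proof.
move=> m0; have [|y] := closed_rootP ('X^m - z%:P) _.
  by rewrite size_XnsubC // eqSS -lt0n.
by rewrite rootE !hornerE subr_eq0 => /eqP <-; exists y.
Qed.

Lemma Ebar_ge0 z : Ebar z -> (0 <= w z)%E.
Proof.
move=> [p [p0 hp pz]]; apply: root_val_ge0 pz => [|i].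
  rewrite lead_coef_map w_ext; apply: (graded_val gG (hp _)).
  by rewrite lead_coef_eq0.
by rewrite coef_map w_ext; exact: (graded_val_ge gG (hp _)).
Qed.

Lemma Ebar_val z : Ebar z -> z != 0 -> w z = 0%E.
Proof.
move=> hz z0; apply/eqP; rewrite eq_le Ebar_ge0 // andbT.
have [a wz] := val_fin w z0; have := Ebar_ge0 (subfieldV Ebar_sub hz).
by rewrite wz (valV wz) !lee_fin oppr_ge0.
Qed.

Lemma degree_elt_val d z : degree_elt d z -> z != 0 -> w z = d%:E.
Proof.
case=> [->|[q [g [q0 hg g0 zq]]] z0]; first by rewrite eqxx.
have [a wz] := val_fin w z0; have vg := graded_val gG hg g0.
have ig0 : iota g != 0 by rewrite fmorph_eq0.
have : w (z ^+ q / iota g) = 0%E.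
  by apply: Ebar_val => //; rewrite mulf_neq0 ?invr_eq0 ?expf_neq0.
rewrite (val_div (valX q wz) (_ : w (iota g) = (d *+ q)%:E)) ?w_ext // => -[] /eqP.
by rewrite wz subr_eq0 eqr_pMn2r // => /eqP ->.
Qed.

Lemma degree_elt0 d : degree_elt d 0. Proof. by left. Qed.

Lemma degree_elt_frac d g : hfrac d g -> degree_elt d (iota g).
Proof.
move=> hg; have [->|g0] := eqVneq g 0; first by left; apply: rmorph0.
right; exists 1%N, g; split=> //.
by rewrite expr1 divff ?fmorph_eq0 //; apply: (subfield1 Ebar_sub).
Qed.

Lemma degree_eltM d e z z' :
  degree_elt d z -> degree_elt e z' -> degree_elt (d + e) (z * z').
Proof.
case=> [->|[q [g [q0 hg g0 zq]]]]; first by rewrite mul0r; left.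
case=> [->|[q' [g' [q'0 hg' g'0 zq']]]]; first by rewrite mulr0; left.
right; exists (q * q')%N, (g ^+ q' * g' ^+ q); split.
- by rewrite muln_gt0 q0.
- rewrite mulrnDl mulrnA; apply: (gradedM gG); first exact: (gradedX gG).
  by rewrite mulnC mulrnA; apply: (gradedX gG).
- by rewrite mulf_neq0 // expf_neq0.
have -> : (z * z') ^+ (q * q') / iota (g ^+ q' * g' ^+ q) =
    (z ^+ q / iota g) ^+ q' * (z' ^+ q' / iota g') ^+ q.
  by rewrite rmorphM !rmorphXn exprMn !expr_div_n mulf_div -!exprM (mulnC q' q).
by apply: (subfieldM Ebar_sub); apply: (subfieldX Ebar_sub).
Qed.

Lemma degree_eltV d z : degree_elt d z -> degree_elt (- d) z^-1.
Proof.
case=> [->|[q [g [q0 hg g0 zq]]]]; first by rewrite invr0; left.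
right; exists q, g^-1; split=> //; rewrite ?invr_eq0 //.
  by rewrite mulNrn; apply: (gradedV gG).
by rewrite exprVn fmorphV -invfM; apply: (subfieldV Ebar_sub).
Qed.

Lemma degree_elt_Ebar z : degree_elt 0 z <-> Ebar z.
Proof.
split=> [[->|[q [g [q0 hg g0 zq]]]]|zE]; first exact: (subfield0 Ebar_sub).
  apply: (algebraic_over_exp hfrac0_subfield q0).
  have ig0 : iota g != 0 by rewrite fmorph_eq0.
  rewrite -(divfK ig0 (z ^+ q)); apply: (subfieldM Ebar_sub) => //.
  by apply: (algebraic_over_id iota hfrac0_subfield); rewrite mul0rn in hg.
right; exists 1%N, 1; rewrite oner_neq0 mul0rn rmorph1 expr1 divr1; split=> //.
exact: (graded1 gG).
Qed.

Lemma degree_eltX d z m : degree_elt d z -> degree_elt (d *+ m) (z ^+ m).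
Proof.
move=> dz; elim: m => [|m IH].
  by apply/degree_elt_Ebar; apply: (subfield1 Ebar_sub).
by rewrite exprS mulrS; apply: degree_eltM.
Qed.

Lemma degree_eltN d z : degree_elt d z -> degree_elt d (- z).
Proof.
move=> dz; rewrite -mulN1r -[d]add0r; apply: degree_eltM => //.
apply/degree_elt_Ebar; apply: (subfieldN Ebar_sub); exact: (subfield1 Ebar_sub).
Qed.

Lemma degree_eltD d z z' : degree_elt d z -> degree_elt d z' -> degree_elt d (z + z').
Proof.
move=> dz dz'; have [->|z0] := eqVneq z 0; first by rewrite add0r.
have -> : z + z' = z * (1 + z^-1 * z') by rewrite mulrDr mulr1 mulrA divff // mul1r.
rewrite -[d]addr0; apply: degree_eltM => //; apply/degree_elt_Ebar.
apply: (subfieldD Ebar_sub); first exact: (subfield1 Ebar_sub).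
by apply/degree_elt_Ebar; rewrite -(addNr d); apply: degree_eltM => //; apply: degree_eltV.
Qed.

Lemma degree_elt_nat d z m : degree_elt d z -> degree_elt d (z *+ m).
Proof.
move=> dz; elim: m => [|m IH]; first by left; rewrite mulr0n.
by rewrite mulrS; apply: degree_eltD.
Qed.

Lemma degree_elt_conj d z z' p : degree_elt d z -> is_minpoly iota z p ->
  root p^i z' -> degree_elt d z'.
Proof.
move=> dz zp pz'; have z'p := minpoly_conj zp pz'.
case: dz => [z0|[q [g [q0 hg g0 [f [f0 hf fz]]]]]].
  have /dvdpP[h hE] : p %| 'X by case: zp => _ _; apply; rewrite map_polyX z0 rootX.
  left; apply/eqP; rewrite -rootX -(map_polyX iota) hE rmorphM /= rootM.
  by rewrite pz' orbT.
right; exists q, g; split=> //; exists f; split=> //.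
have rE (y : Omega) : (f \Po (g^-1 *: 'X^q))^i.[y] = f^i.[y ^+ q / iota g].
  by rewrite map_comp_poly map_polyZ map_polyXn horner_comp hornerZ hornerXn fmorphV mulrC.
have [_ _ pmin] := zp; have /dvdpP[h hE] : p %| f \Po (g^-1 *: 'X^q).
  by apply: pmin; rewrite rootE rE; apply/eqP/rootP.
by rewrite rootE -rE hE rmorphM /= hornerM (rootP pz') mulr0.
Qed.

Lemma degree_elt_alg d z : degree_elt d z -> algebraic_over iota tame z.
Proof.
have alg_sub := algebraic_over_subfield iota tame_sub.
case=> [->|[q [g [q0 hg g0 zq]]]]; first exact: (subfield0 alg_sub).
apply: (algebraic_over_exp tame_sub q0).
have ig0 : iota g != 0 by rewrite fmorph_eq0.
rewrite -(divfK ig0 (z ^+ q)); apply: (subfieldM alg_sub).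
  by apply: algebraic_over_sub zq => x; apply: tame_homog.
by apply: (algebraic_over_id iota tame_sub); apply: tame_homog hg.
Qed.

(** Subtracting its initial form from [y] would give an element of degree [d]
    and of valuation larger than [d], unless it is zero. *)
Lemma hfrac_of_degree_elt d y : degree_elt d (iota y) -> hfrac d y.
Proof.
move=> dy; have [->|y0] := eqVneq y 0; first exact: (graded0 gG).
have vy : v y = d%:E by rewrite -w_ext; apply: degree_elt_val; rewrite ?fmorph_eq0.
have [g hg yg] := val_leading pK_weight all_series vy.
suff -> : y = g by [].
apply/eqP; rewrite -subr_eq0; apply/negP => /negP yg0.
have dyg : degree_elt d (iota (y - g)).
  by rewrite rmorphB; apply: degree_eltD => //; apply: degree_eltN; apply: degree_elt_frac.
have := degree_elt_val dyg; rewrite fmorph_eq0 => /(_ yg0); rewrite w_ext => E.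
by move: yg; rewrite E ltxx.
Qed.

Let w_conj := conj_val w_ext v_complete.

Lemma val_prod_const (rs : seq Omega) a : (forall r, r \in rs -> w r = a%:E) ->
  w (\prod_(r <- rs) r) = (a *+ size rs)%:E.
Proof.
elim: rs => [|r rs IH] wr; first by rewrite big_nil val1.
rewrite big_cons valM wr ?mem_head // IH => [|s srs]; first by rewrite mulrS EFinD.
by apply: wr; rewrite inE srs orbT.
Qed.

Lemma val_prod_gt0 (rs : seq Omega) z : (0 < w (\prod_(r <- rs) (z - r))%R)%E ->
  exists2 r, r \in rs & (0 < w (z - r)%R)%E.
Proof.
elim: rs => [|r rs IH]; first by rewrite big_nil val1 ltxx.
rewrite big_cons => h; have [zr|zr] := ltP 0%E (w (z - r)).
  by exists r; rewrite ?mem_head.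
have [|s srs ws] := IH; last by exists s; rewrite ?inE ?srs ?orbT.
by apply: lt_le_trans h _; rewrite valM -[leRHS]add0e leeD2r.
Qed.

Lemma coef_val_ge0 (rs : seq Omega) : (forall r, r \in rs -> (0 <= w r)%E) ->
  forall i, (0 <= w (\prod_(r <- rs) ('X - r%:P))`_i)%E.
Proof.
elim: rs => [|r rs IH] wr i; first by rewrite big_nil coef1; apply: val_nat_ge0.
rewrite big_cons mulrBl coefB coefXM coefCM; apply: valB_ge.
  case: eqP => _; first by rewrite val0 leey.
  by apply: IH => s srs; apply: wr; rewrite inE srs orbT.
rewrite valM; apply: adde_ge0; first by apply: wr; rewrite mem_head.
by apply: IH => s srs; apply: wr; rewrite inE srs orbT.
Qed.

(** The minimal polynomial [p] of [z] has integral coefficients because the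
    conjugates of [z] have valuation zero. Replacing each coefficient by its
    component of degree zero gives a polynomial [f] over the residue field such
    that [f(z)] has positive valuation, so a root of [f] is close to [z]. *)
Lemma Ebar_leading z : w z = 0%E -> exists2 u, Ebar u & (0 < w (z - u)%R)%E.
Proof.
move=> wz; have [p zp] := exists_minpoly (Omega_alg z).
have [pm pz _] := zp; have [rs prs] := root_prod_XsubC_map pm.
have wr r : r \in rs -> w r = 0%E.
  by rewrite (mem_rootsE _ prs) => pr; rewrite (w_conj zp pr).
have vp i : (0 <= v p`_i)%E.
  by rewrite -w_ext -coef_map prs; apply: coef_val_ge0 => r /wr ->.
have /choice[g gP] : forall i, exists g, hfrac 0 g /\ (0 < v (p`_i - g)%R)%E.
  move=> i; have [vi|vi] := ltP 0%E (v p`_i).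
    by exists 0; rewrite subr0; split=> //; apply: (graded0 gG).
  have v0 : v p`_i = 0%E by apply/eqP; rewrite eq_le vi vp.
  by have [g hg gv] := val_leading pK_weight all_series v0; exists g.
pose f := 'X^((size p).-1) + \poly_(i < (size p).-1) g i.
have sp : (0 < size p)%N by rewrite ltnW // (minpoly_size_gt1 zp).
have sf : (size (\poly_(i < (size p).-1) g i)%R < size ('X^((size p).-1) : {poly K})%R)%N.
  by rewrite size_polyXn ltnS size_poly.
have fm : f \is monic by rewrite monicE lead_coefDl // lead_coefXn.
have hf i : hfrac 0 f`_i.
  rewrite coefD coefXn coef_poly; apply: (subfieldD hfrac0_subfield).
    exact: (subfield_nat hfrac0_subfield).
  by case: ltnP => _; [case: (gP i)|exact: (subfield0 hfrac0_subfield)].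
have [us fus] := root_prod_XsubC_map fm.
have fz : (0 < w f^i.[z])%E.
  have -> : f^i.[z] = (f - p)^i.[z].
    by rewrite rmorphB hornerD hornerN (rootP pz) subr0.
  have fpE : f - p = \poly_(i < (size p).-1) (g i - p`_i).
    apply/polyP => i; rewrite coefB coefD coefXn !coef_poly.
    case: ltngtP => [ip|ip|->]; first by rewrite add0r.
      have pi : (size p <= i)%N by move: ip; rewrite prednK.
      by rewrite addr0 nth_default // subr0.
    by rewrite addr0 -lead_coefE (monicP pm) subrr.
  rewrite fpE (horner_map_wide iota z (size_poly _ _)); apply: val_sum_gt => i _ _.
  rewrite valM (valX _ wz) mul0rn adde0 w_ext coef_poly ltn_ord -val_sym.
  by case: (gP i).
have [u uus uz] : exists2 u, u \in us & (0 < w (z - u)%R)%E.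
  apply: val_prod_gt0; move: fz; rewrite fus horner_prod.
  by under eq_bigr do rewrite !hornerE.
exists u => //; exists f; split=> //; first exact: monic_neq0.
by rewrite -(mem_rootsE _ fus).
Qed.

(** Initial forms exist in [Omega]: the product of the conjugates of [z] has an
    initial form in the completed field, and dividing [z] by a root of it reduces
    to the case of valuation zero. *)
Lemma degree_elt_leading z a : w z = a%:E ->
  exists2 u, degree_elt a u & (a%:E < w (z - u)%R)%E.
Proof.
move=> wz; have [p zp] := exists_minpoly (Omega_alg z).
have [pm pz _] := zp; have [rs prs] := root_prod_XsubC_map pm.
have wr r : r \in rs -> w r = a%:E.
  by rewrite (mem_rootsE _ prs) => pr; rewrite (w_conj zp pr).
have rs0 : (0 < size rs)%N.
  by move: (minpoly_size_gt1 zp); rewrite -(size_map_poly iota) prs size_prod_XsubC.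
have vp0 : v p`_0 = (a *+ size rs)%:E.
  rewrite -w_ext -coef_map prs coef0_prod_XsubC -(val_prod_const wr).
  by rewrite -signr_odd; case: odd; rewrite ?expr0 ?expr1 ?mul1r // mulN1r valN.
have [g hg pg] := val_leading pK_weight all_series vp0.
have vg : v g = (a *+ size rs)%:E by rewrite -vp0; apply: val_close; rewrite vp0 val_sym.
have g0 := val_neq0 vg; have [t tE] := root_of (iota g) rs0.
have dt : degree_elt a t.
  right; exists (size rs), g; split=> //; rewrite tE divff ?fmorph_eq0 //.
  exact: (subfield1 Ebar_sub).
have t0 : t != 0.
  apply: contraNneq g0 => tz; move: tE; rewrite tz expr0n gtn_eqF // => /esym/eqP.
  by rewrite fmorph_eq0.
have wt := degree_elt_val dt t0.
have [|u uE zu] := @Ebar_leading (z / t); first by rewrite (val_div wz wt) subrr.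
exists (t * u).
  by rewrite -[a]addr0; apply: degree_eltM => //; apply/degree_elt_Ebar.
have -> : z - t * u = t * (z / t - u) by rewrite mulrBr mulrCA divff ?mulr1.
have [->|n0] := eqVneq (z / t - u) 0; first by rewrite mulr0 val0 ltry.
have [r wr'] := val_fin w n0; move: zu; rewrite valM wt wr' lte_fin => r0.
by rewrite -EFinD lte_fin ltrDl.
Qed.

(** The field generated over [tame] by all the [degree_elt]s: their products are
    again such elements, so their span is a ring, and a field by algebraicity. *)
Definition homog_span : set Omega := [set z | exists2 s : seq (K * Omega),
  (forall t, t \in s -> tame t.1 /\ exists d, degree_elt d t.2) &
  z = \sum_(t <- s) iota t.1 * t.2].

Let alg_sub := algebraic_over_subfield iota tame_sub.

Lemma homog_span_alg z : homog_span z -> algebraic_over iota tame z.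
Proof.
move=> [s sP ->]; rewrite big_seq; apply: (subfield_sum alg_sub) => t /sP[tt [d dt]].
by apply: (subfieldM alg_sub); [exact: (algebraic_over_id iota tame_sub)|exact: degree_elt_alg dt].
Qed.

Lemma homog_span_term x z d : tame x -> degree_elt d z -> homog_span (iota x * z).
Proof.
move=> tx dz; exists [:: (x, z)]; last by rewrite big_seq1.
by move=> t; rewrite inE => /eqP ->; split=> //; exists d.
Qed.

Lemma homog_span_tame x : tame x -> homog_span (iota x).
Proof.
move=> tx; rewrite -[iota x]mulr1; apply: (homog_span_term (d := 0)) => //.
by apply/degree_elt_Ebar; apply: (subfield1 Ebar_sub).
Qed.

Lemma homog_span_elt d z : degree_elt d z -> homog_span z.
Proof.
move=> dz; rewrite -[z]mul1r -(rmorph1 iota); apply: homog_span_term dz.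
exact: (subfield1 tame_sub).
Qed.

Lemma homog_spanB z z' : homog_span z -> homog_span z' -> homog_span (z - z').
Proof.
move=> [s sP ->] [s' sP' ->]; exists (s ++ [seq (- t.1, t.2) | t <- s']).
  move=> t; rewrite mem_cat => /orP[/sP//|/mapP[u /sP'[tu du] ->]] /=; split=> //.
  exact: (subfieldN tame_sub).
rewrite big_cat big_map /= -sumrN; congr (_ + _); apply: eq_bigr => t _.
by rewrite rmorphN mulNr.
Qed.

Lemma homog_spanM z z' : homog_span z -> homog_span z' -> homog_span (z * z').
Proof.
move=> [s sP ->] [s' sP' ->].
exists [seq (t.1 * u.1, t.2 * u.2) | t <- s, u <- s'].
  move=> _ /allpairsP[[t u] [/= /sP[tt [d dt]] /sP'[tu [e du]] ->]]; split=> /=.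
    exact: (subfieldM tame_sub).
  by exists (d + e); apply: degree_eltM.
rewrite big_allpairs_dep /= big_distrl /=; apply: eq_bigr => t _.
by rewrite big_distrr /=; apply: eq_bigr => u _; rewrite rmorphM mulrACA.
Qed.

Lemma homog_span_subfield : subfield_set homog_span.
Proof.
split; [|exact: homog_spanB|].
  by rewrite -(rmorph1 iota); apply: homog_span_tame; apply: (subfield1 tame_sub).
move=> z z' hz hz'; apply: homog_spanM => //.
apply: (algebraic_inv_closed tame_sub homog_span_tame homog_spanB homog_spanM hz').
exact: homog_span_alg.
Qed.

Let F := subfield_type homog_span_subfield.
Let j : {rmorphism F -> Omega} := subfield_inj homog_span_subfield.

(** The minimal polynomial of [z - x] over the complete field has its
    coefficients in [tame], which is relatively algebraically closed. Composed
    with ['X - x] it is a polynomial over [F] vanishing at [z], hence at [r]. So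
    [r - x] and [z - x] are conjugate over the complete field. *)
Lemma span_conj_val (p : {poly F}) z r (x : F) : algebraic_over iota tame z ->
  is_minpoly j z p -> root (map_poly j p) r -> w (r - j x) = w (z - j x).
Proof.
move=> zalg [pm pz pmin] pr; pose y := z - j x.
have yalg : algebraic_over iota tame y.
  by apply: (subfieldB alg_sub) => //; apply: homog_span_alg; apply: subfield_typeP.
have [q yq] := exists_minpoly (Omega_alg y); have [qm qy qmin] := yq.
have [rs qrs] := root_prod_XsubC_map qm.
have tq i : tame q`_i.
  have [f [f0 tf]] : algebraic_over iota tame (iota q`_i).
    rewrite -coef_map qrs; apply: (subfield_prod_XsubC alg_sub) => s.
    rewrite (mem_rootsE _ qrs) => qs; have [f [f0 tf fy]] := yalg.
    exists f; split=> //; have /dvdpP[h ->] := qmin f fy.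
    by rewrite rmorphM /= rootM qs orbT.
  rewrite fmorph_root => fq.
  exact: (tame_algebraic pK_weight all_series n_gt0 K_char0 f0 tf fq).
have [|q' q'E] := @subfield_lift_poly _ _ homog_span_subfield q^i.
  by move=> i; rewrite coef_map; apply: homog_span_tame.
have evalE s : (map_poly j (q' \Po ('X - x%:P))).[s] = q^i.[s - j x].
  by rewrite horner_map_comp_XsubC q'E.
have /dvdpP[h hE] : p %| q' \Po ('X - x%:P).
  by apply: pmin; rewrite rootE evalE; apply/eqP/rootP.
have qr : root q^i (r - j x).
  by rewrite rootE -evalE hE rmorphM /= hornerM (rootP pr) mulr0.
exact: (w_conj yq qr).
Qed.

(** The average [c] of the conjugates of [z] over [F] belongs to [F]. If [z] is
    not equal to [c], approximate [z - c] by its initial form [u], an element of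
    [F]. Then [z - c - u] and all its conjugates have larger valuation than [u];
    but they sum up to a multiple of [u] by a nonzero integer. *)
Lemma algebraic_homog_span z : algebraic_over iota tame z -> homog_span z.
Proof.
move=> zalg; have [f [f0 tf fz]] := zalg.
have [|f' f'E] := @subfield_lift_poly _ _ homog_span_subfield f^i.
  by move=> i; rewrite coef_map; apply: homog_span_tame.
have [p zp] : exists p, is_minpoly j z p.
  apply: exists_minpoly; exists f'; last by rewrite f'E.
  by rewrite -(map_poly_eq0 j) f'E map_poly_eq0.
have [pm pz _] := zp; have [rs E] := closed_field_poly_normal (map_poly j p).
have prs : map_poly j p = \prod_(r <- rs) ('X - r%:P).
  by move: E; rewrite lead_coef_map (monicP pm) rmorph1 scale1r.
pose m := size rs; have m0 : (0 < m)%N.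
  by move: (minpoly_size_gt1 zp); rewrite -(size_map_poly j) prs size_prod_XsubC.
have sumr : \sum_(r <- rs) r = - j p`_m.-1.
  by rewrite -coef_map prs coefPn_prod_XsubC ?opprK // -lt0n.
have mK0 : m%:R != 0 :> K.
  by move: m0; rewrite lt0n; apply: contraNneq; move/pcharf0P: K_char0 => <- ->.
have vm : v m%:R = 0%E.
  exact: (graded_val gG (subfield_nat hfrac0_subfield m) mK0).
have mO0 : m%:R != 0 :> Omega by rewrite -(rmorph_nat iota) fmorph_eq0.
have mF0 : m%:R != 0 :> F by rewrite -(fmorph_eq0 j) rmorph_nat.
pose c : F := - p`_m.-1 / m%:R.
have jc : j c * m%:R = \sum_(r <- rs) r.
  by rewrite sumr -(rmorph_nat j) -rmorphM divfK // rmorphN.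
have [->|zc] := eqVneq z (j c); first exact: subfield_typeP.
have [a wa] : exists a : R, w (z - j c) = a%:E by apply: val_fin; rewrite subr_eq0.
have [u du ua] := degree_elt_leading wa.
have wu : w u = a%:E by rewrite -wa; apply: val_close; rewrite wa val_sym.
have [u' u'E] := subfield_lift homog_span_subfield (homog_span_elt du).
pose x := c + u'; have jx : j x = j c + u by rewrite -u'E; exact: rmorphD.
have : (a%:E < w (\sum_(r <- rs) (r - j x))%R)%E.
  apply: val_sum_gt => r rrs _; rewrite (span_conj_val x zalg zp).
    by rewrite jx opprD addrA.
  by rewrite -(mem_rootsE _ prs).
have -> : \sum_(r <- rs) (r - j x) = - (u * m%:R).
  rewrite sumrB -jc big_const_seq count_predT iter_addr_0 -/m jx -[(_ + u) *+ m]mulr_natr mulrDl.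
  by rewrite opprD addrA subrr add0r.
by rewrite valN valM wu -(rmorph_nat iota) w_ext vm adde0 ltxx.
Qed.

End HomogeneousElements.

(** * Reduction to as many generators as the rational rank *)

Lemma common_denominator (l : seq rat) : exists2 p : nat, (0 < p)%N &
  forall c, c \in l -> exists ab : nat * nat, c * p%:R = ab.1%:R - ab.2%:R.
Proof.
elim: l => [|c l [p p0 pP]]; first by exists 1%N.
exists (p * `|denq c|)%N; first by rewrite muln_gt0 p0 absz_gt0 denq_eq0.
have dE : (`|denq c|%N)%:R = (denq c)%:~R :> rat.
  by rewrite -[in RHS](gez0_abs (ltW (denq_gt0 c))).
move=> c'; rewrite inE natrM mulrA => /orP[/eqP ->|/pP[[a b] ->]]; last first.
  by exists (a * `|denq c|, b * `|denq c|)%N; rewrite !natrM mulrBl.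
rewrite mulrAC dE -numqE; case: (numq c) => m; first by exists (m * p, 0)%N; rewrite natrM subr0.
by exists (0, m.+1 * p)%N; rewrite NegzE natrM sub0r rmorphN mulNr.
Qed.

Section FewGenerators.
Variables (R : realType) (n : nat) (alpha : 'I_n -> {posnum R}) (k : fieldType).
Variables (K : fieldType) (v : valuation R K) (pK : {rmorphism mpoly n k -> K}).
Hypothesis pK_weight : weight_valued alpha v pK.
Local Notation hfrac := (homog_frac alpha pK).
Hypothesis all_series : forall A, series_in v hfrac A.
Hypothesis n_gt0 : (0 < n)%N.
Hypothesis K_char0 : [pchar K] =i pred0.
Variables (Omega : closedFieldType) (iota : {rmorphism K -> Omega}).
Variable w : valuation R Omega.
Hypothesis Omega_alg : forall z, algebraicOver iota z.
Hypothesis w_ext : forall x, w (iota x) = v x.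
Implicit Types (d a : R) (g x : K) (y z t u : Omega).

Local Notation tame := (tame alpha v pK).
Local Notation degree_elt := (degree_elt alpha pK iota).
Local Notation rspan := (rat_span (fun j => (alpha j)%:num)).
Let tame_sub : subfield_set tame := tame_subfield pK_weight all_series.
Let dM := degree_eltM pK_weight (iota := iota).
Let dV := degree_eltV pK_weight (iota := iota).
Let dX := degree_eltX pK_weight (iota := iota).

Lemma degree_elt1 : degree_elt 0 1.
Proof. exact: (dX 0 (degree_elt0 alpha pK iota 0)). Qed.

Lemma degree_elt_prod (I : Type) (r : seq I) (d : I -> R) (z : I -> Omega) :
  (forall i, degree_elt (d i) (z i)) ->
  degree_elt (\sum_(i <- r) d i) (\prod_(i <- r) z i).
Proof.
move=> dz; apply: (big_ind2 degree_elt) => [|d1 z1 d2 z2|i _]; first exact: degree_elt1.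
  exact: dM.
exact: dz.
Qed.

Lemma degree_elt_root d t m : (0 < m)%N -> degree_elt (d *+ m) (t ^+ m) -> degree_elt d t.
Proof.
move=> m0 [/eqP|[q [g [q0 hg g0 tg]]]].
  by rewrite expf_eq0 m0 => /eqP ->; left.
by right; exists (m * q)%N, g; rewrite muln_gt0 m0 q0 mulrnA exprM.
Qed.

Lemma rat_span_div d m : rspan d -> rspan (d / m%:R).
Proof.
move=> [q _ <-]; exists (fun j => q j / m%:R) => //; rewrite mulr_suml.
by apply: eq_bigr => j _; rewrite fmorph_div /= ratr_nat mulrAC.
Qed.

Lemma degree_elt_exists d : rspan d -> exists2 t, t != 0 & degree_elt d t.
Proof.
move=> [q _ qd]; have [D D0 DP] := common_denominator [seq q j | j <- enum 'I_n].
have /choice[ab abP] : forall j, exists ab : nat * nat, q j * D%:R = ab.1%:R - ab.2%:R.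
  by move=> j; apply: DP; apply: map_f; rewrite mem_enum.
pose X j : Omega := iota (pK (mpolyX k (mnm1 j))).
have X0 j : X j != 0 by rewrite fmorph_eq0 (pK_eq0 pK_weight) mpolyX_neq0.
have dXj j : degree_elt (alpha j)%:num (X j).
  apply: (degree_elt_frac pK_weight); apply: homog_frac_poly.
  by rewrite -weight_mnm1; apply: homog_ofX.
have prod0 (c : 'I_n -> nat) : \prod_(j < n) X j ^+ c j != 0.
  by apply/prodf_neq0 => j _; rewrite expf_neq0.
have [t tE] := root_of (\prod_(j < n) X j ^+ (ab j).1 / \prod_(j < n) X j ^+ (ab j).2) D0.
exists t.
  apply: contraTneq D0 => t0; rewrite -eqn0Ngt; apply/negP => /negP D0.
  by move: tE; rewrite t0 expr0n (negbTE D0) => /esym/eqP; rewrite mulf_eq0 invr_eq0 !(negbTE (prod0 _)).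
apply: (degree_elt_root D0); rewrite tE.
have -> : d *+ D = \sum_(j < n) (alpha j)%:num *+ (ab j).1 + - \sum_(j < n) (alpha j)%:num *+ (ab j).2.
  rewrite -qd -sumrMnl -sumrB; apply: eq_bigr => j _.
  have := congr1 (@ratr R) (abP j); rewrite rmorphM rmorphB /= !ratr_nat => qE.
  by rewrite -!(mulr_natr (alpha j)%:num) -mulrBr -qE -mulr_natr; ring.
by apply: dM; [|apply: dV]; apply: degree_elt_prod => j; apply: dX.
Qed.

Lemma degree_elt_span d z : degree_elt d z -> z != 0 -> rspan d.
Proof.
case=> [->|[q [g [q0 hg g0 _]]] _]; first by rewrite eqxx.
case: hg g0 => [D [a [b [b0 Db Da ->]]]]; rewrite mulf_eq0 (pK_eq0 pK_weight) negb_or.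
move=> /andP[a0 _]; have [m /Da mE _] := pK_weight a0; have [m' /Db m'E _] := pK_weight b0.
exists (fun j => ((m j)%:R - (m' j)%:R) / q%:R) => //.
have qn0 : q%:R != 0 :> R by rewrite pnatr_eq0 -lt0n.
apply: (mulIf qn0); rewrite [RHS]mulr_natr.
have -> : d *+ q = weight alpha m - weight alpha m' by rewrite mE m'E addrAC subrr add0r.
rewrite mulr_suml -sumrB; apply: eq_bigr => j _.
rewrite fmorph_div rmorphB /= !ratr_nat; field.
exact: qn0.
Qed.

(** Primitive element theorem. The primitive element is an integral linear
    combination of the generators, hence of degree [d] if they all are. *)
Lemma degree_elt_primitive d (l : seq Omega) : (forall y, y \in l -> degree_elt d y) ->
  exists2 z, degree_elt d z & forall T : set Omega, subfield_set T ->
    (forall x, tame x -> T (iota x)) -> T z -> forall y, y \in l -> T y.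
Proof.
elim: l => [_|y l IH dl]; first by exists 0 => //; left.
have [|z dz zP] := IH; first by move=> u ul; apply: dl; rewrite inE ul orbT.
have dy := dl y (mem_head _ _).
pose j := iota \o subfield_inj tame_sub.
have jalg u : degree_elt d u -> algebraicOver j u.
  by move=> du; apply/algebraic_overE; apply: (degree_elt_alg pK_weight all_series du).
have [[p p0 py] [q q0 qz]] := (jalg y dy, jalg z dz).
have char0 : [pchar (subfield_type tame_sub)] =i pred0.
  by move=> m; rewrite -(fmorph_pchar (subfield_inj tame_sub)).
have [m [[r rE] [s sE]]] := pchar0_PET p0 py q0 qz char0.
exists (z *+ m - y).
  apply: (degree_eltD pK_weight); last exact: (degree_eltN pK_weight).
  exact: (degree_elt_nat pK_weight).
move=> T hT tT Tz u; have Th (f : {poly subfield_type tame_sub}) :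
    T (map_poly j f).[z *+ m - y].
  apply: (subfield_horner hT) => // i; rewrite coef_map; apply: tT.
  exact: subfield_typeP.
rewrite inE => /orP[/eqP ->|ul]; first by rewrite -rE.
by apply: (zP T) => //; rewrite -sE.
Qed.

(** Over a basis [e] of the rational span of the weights, each element of [s] is,
    up to a factor of degree zero, a product of powers of fixed elements [t j] of
    degree [e j / p]. The factors of degree zero are multiplied by [t 0] and
    absorbed, with [t 0] itself, in one generator of degree [e 0 / p]. *)
Lemma degree_elt_generators N (e : 'I_N.+1 -> R) (s : seq Omega) :
    rspan = rat_span e -> (forall z, z \in s -> exists d, degree_elt d z) ->
  exists c : 'I_N.+1 -> Omega, (forall j, exists d, degree_elt d (c j)) /\
    forall T : set Omega, subfield_set T -> (forall x, tame x -> T (iota x)) ->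
      (forall j, T (c j)) -> forall z, z \in s -> T z.
Proof.
move=> spanE sP.
have /choice[dc dcP] : forall z, exists dc : R * ('I_N.+1 -> rat), z \in s -> z != 0 ->
    degree_elt dc.1 z /\ dc.1 = \sum_(j < N.+1) ratr (dc.2 j) * e j.
  move=> z; have [|zs] := boolP (z \in s); last by exists (0, fun=> 0).
  move=> /sP[d dz]; have [->|z0] := eqVneq z 0; first by exists (0, fun=> 0).
  have := degree_elt_span dz z0; rewrite spanE => -[q _ qd].
  by exists (d, q).
have [p p0 pP] := common_denominator
  (flatten [seq [seq (dc z).2 j | j <- enum 'I_N.+1] | z <- s]).
have /choice[ab abP] : forall zj : Omega * 'I_N.+1, exists ab : nat * nat, zj.1 \in s ->
    (dc zj.1).2 zj.2 * p%:R = ab.1%:R - ab.2%:R.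
  move=> [z j]; have [zs|zs] := boolP (z \in s); last by exists (0%N, 0%N).
  have [|ab abE] := pP ((dc z).2 j); last by exists ab.
  apply/flattenP; exists [seq (dc z).2 j | j <- enum 'I_N.+1]; first exact: map_f.
  by apply: map_f; rewrite mem_enum.
have /choice[t tP] : forall j, exists t, t != 0 /\ degree_elt (e j / p%:R) t.
  move=> j; have [|t t0 dt] := @degree_elt_exists (e j / p%:R); last by exists t.
  apply: rat_span_div; rewrite spanE; exists (fun i => (i == j)%:R) => //.
  rewrite (bigD1 j) //= eqxx ratr_nat mul1r big1 ?addr0 // => i /negbTE ->.
  by rewrite ratr_nat mul0r.
pose A z := \prod_(j < N.+1) t j ^+ (ab (z, j)).1.
pose B z := \prod_(j < N.+1) t j ^+ (ab (z, j)).2.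
have prod0 (c : 'I_N.+1 -> nat) : \prod_(j < N.+1) t j ^+ c j != 0.
  by apply/prodf_neq0 => j _; rewrite expf_neq0 //; case: (tP j).
pose eta z := z * B z / A z.
have deta z : z \in s -> degree_elt 0 (eta z).
  move=> zs; have [->|z0] := eqVneq z 0; first by left; rewrite /eta !mul0r.
  have [dz dE] := dcP z zs z0.
  have -> : 0 = (dc z).1 + \sum_(j < N.+1) (e j / p%:R) *+ (ab (z, j)).2
      + - \sum_(j < N.+1) (e j / p%:R) *+ (ab (z, j)).1.
    rewrite dE -big_split -sumrB /= big1 // => j _.
    have := congr1 (@ratr R) (abP (z, j) zs); rewrite rmorphM rmorphB /= !ratr_nat => E.
    have pn0 : p%:R != 0 :> R by rewrite pnatr_eq0 -lt0n.
    rewrite -!(mulr_natr (e j / p%:R)) -(mulfK pn0 (ratr _)) E; field.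
    exact: pn0.
  apply: dM; [apply: dM => //|apply: dV]; apply: degree_elt_prod => j; apply: dX.
    by case: (tP j).
  by case: (tP j).
have [|z dz zP] := @degree_elt_primitive (e ord0 / p%:R)
  (t ord0 :: [seq t ord0 * eta z | z <- s]).
  move=> y; rewrite inE => /orP[/eqP ->|/mapP[z zs ->]]; first by case: (tP ord0).
  by rewrite -[_ / _]addr0; apply: dM; [case: (tP ord0)|apply: deta].
exists (fun j => if j == ord0 then z else t j); split.
  by move=> j; exists (e j / p%:R); case: eqP => [->//|_]; case: (tP j).
move=> T hT tT Tc u us.
have Tz : T z by have := Tc ord0; rewrite eqxx.
have Tl := zP T hT tT Tz.
have Tt0 : T (t ord0) by apply: Tl; rewrite mem_head.
have Tt j : T (t j) by have := Tc j; case: eqP => [->|_].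
have Tprod (c : 'I_N.+1 -> nat) : T (\prod_(j < N.+1) t j ^+ c j).
  apply: (big_ind T); [exact: (subfield1 hT)|exact: (subfieldM hT)|move=> j _].
  exact: (subfieldX hT).
have [t00 _] := tP ord0.
have Teta : T (eta u).
  rewrite -(mulKf t00 (eta u)) mulrC; apply: (subfield_div hT) => //.
  by apply: Tl; rewrite inE (map_f (fun z => t ord0 * eta z) us) orbT.
have -> : u = eta u * A u / B u.
  by rewrite /eta divfK ?prod0 // mulfK ?prod0.
by apply: (subfield_div hT); [apply: (subfieldM hT) => //|]; apply: Tprod.
Qed.

Lemma degree_elt_coef (rs : seq Omega) d : (forall r, r \in rs -> degree_elt d r) ->
  forall i, (i <= size rs)%N ->
    degree_elt (d *+ (size rs - i)) (\prod_(r <- rs) ('X - r%:P))`_i.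
Proof.
elim: rs => [_ i|r rs IH dr i] /=.
  rewrite leqn0 => /eqP ->; rewrite big_nil coef1 mulr0n; exact: degree_elt1.
have {}IH := IH (fun s srs => dr s (mem_behead (s := r :: rs) srs)).
move=> irs; rewrite big_cons mulrBl coefB coefXM coefCM.
apply: (degree_eltD pK_weight).
  case: i irs => [_|i irs]; first by left.
  by rewrite subSS; apply: IH.
apply: (degree_eltN pK_weight); have [ir|ri] := leqP i (size rs).
  rewrite subSn // mulrS; apply: dM; first by apply: dr; rewrite mem_head.
  exact: IH.
by left; rewrite nth_default ?mulr0 // size_prod_XsubC.
Qed.

(** All the conjugates of [z] have degree [d], so its minimal polynomial has
    homogeneous fractions as coefficients. Multiplying [z] by a common
    denominator, times a monomial that makes the degree nonnegative, turns them
    into polynomials. *)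
Lemma degree_elt_integral d z : degree_elt d z ->
  exists (b : mpoly n k) (d' : R) (m : nat) (g : nat -> mpoly n k),
  [/\ b != 0 /\ tame (pK b), 0 <= d', (0 < m)%N,
      is_minpoly iota (iota (pK b) * z) ('X^m + \poly_(i < m) pK (g i)) &
      forall i, (i <= m)%N -> homog_of alpha (d' *+ i) (g (m - i)%N)].
Proof.
move=> dz; have [p zp] := exists_minpoly (Omega_alg z).
have [pm pz pmin] := zp; have [rs prs] := root_prod_XsubC_map iota pm.
pose m := (size p).-1; have sp : size p = m.+1.
  by rewrite prednK // ltnW // (minpoly_size_gt1 zp).
have m0 : (0 < m)%N by rewrite -ltnS -sp (minpoly_size_gt1 zp).
have srs : size rs = m.
  by have := size_map_poly iota p; rewrite prs size_prod_XsubC sp => -[].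
have hp i : (i <= m)%N -> hfrac (d *+ i) p`_(m - i).
  move=> im; apply: (hfrac_of_degree_elt pK_weight all_series w_ext).
  rewrite -coef_map prs -{1}(subKn im) -srs; apply: degree_elt_coef; last exact: leq_subr.
  by move=> r; rewrite (mem_rootsE _ prs) => pr; apply: degree_elt_conj dz zp pr.
have [B0 [e0 [B00 he0 hB0]]] : exists b e, [/\ b != 0, homog_of alpha e b &
    forall i, (i <= m)%N -> exists c,
      homog_of alpha (d *+ i + e) c /\ p`_(m - i) * pK b = pK c].
  suff H l : exists b e, [/\ b != 0, homog_of alpha e b &
      forall i, (i < l)%N -> (i <= m)%N -> exists c,
        homog_of alpha (d *+ i + e) c /\ p`_(m - i) * pK b = pK c].
    by have [b [e [b0 be bP]]] := H m.+1; exists b, e; split=> // i im; apply: bP.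
  elim: l => [|l [b [e [b0 be bP]]]].
    by exists 1, 0; rewrite oner_neq0; split=> //; apply: homog_of1.
  have [lm|ml] := leqP l m; last first.
    exists b, e; split=> // i _ im; apply: bP => //; exact: leq_ltn_trans im ml.
  have [D [a [c [c0 Dc Da E]]]] := hp l lm.
  exists (b * c), (e + D); split; [by rewrite mulf_neq0|exact: homog_ofM|].
  move=> i; rewrite ltnS leq_eqVlt => /orP[/eqP ->|il] im.
    exists (a * b); split; first by rewrite addrCA addrC [_ + D]addrC; apply: homog_ofM.
    have pc0 : pK c != 0 by rewrite (pK_eq0 pK_weight).
    by rewrite E !rmorphM [pK b * _]mulrC mulrA divfK.
  have [f [hf fE]] := bP i il im; exists (f * c); split; first by rewrite addrA; apply: homog_ofM.
  by rewrite !rmorphM mulrA fE.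
have [q [e1 [q0 qe1 e1P]]] := monomial_large alpha k (- (d + e0)) n_gt0.
pose b := B0 * q; pose e := e0 + e1; pose d' := d + e.
have b0 : b != 0 by rewrite mulf_neq0.
have be : homog_of alpha e b by apply: homog_ofM.
have /choice[c cP] : forall i, exists c, (i <= m)%N ->
    homog_of alpha (d *+ i + e) c /\ p`_(m - i) * pK b = pK c.
  move=> i; have [im|im] := boolP (i <= m)%N; last by exists 0.
  have [c [hc cE]] := hB0 i im; exists (c * q) => _; split.
    by rewrite addrA; apply: homog_ofM.
  by rewrite !rmorphM mulrA cE.
pose g i := if (i < m)%N then c (m - i)%N * b ^+ (m - i).-1 else 1.
have gE i : (i < m)%N -> pK (g i) = p`_i * pK b ^+ (m - i).
  move=> im; rewrite /g im; have [_ cE] := cP (m - i)%N (leq_subr _ _).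
  rewrite rmorphM rmorphXn -cE subKn ?(ltnW im) // -mulrA -exprS prednK //.
  by rewrite subn_gt0.
have pb0 : pK b != 0 by rewrite (pK_eq0 pK_weight).
have ib0 : iota (pK b) != 0 by rewrite fmorph_eq0.
exists b, d', m, g; split=> //.
- by split=> //; apply: (tame_homog v); apply: homog_frac_poly be.
- by rewrite /d' /e; move: e1P; lra.
- set f := _ + _.
  have fE i : f`_i = p`_i * pK b ^+ (m - i).
    rewrite coefD coefXn coef_poly; case: ltngtP => im; first by rewrite add0r gE.
      by rewrite addr0 [p`_i]nth_default ?mul0r // sp.
    rewrite addr0 im subnn expr0 mulr1; have := monicP pm.
    by rewrite lead_coefE sp => ->.
  have sf : size f = m.+1.
    rewrite /f size_polyDl size_polyXn // ltnS; exact: size_poly.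
  have fm : f \is monic by rewrite monicE lead_coefE sf fE subnn mulr1 -[m]/(m.+1.-1) -sp -lead_coefE (monicP pm).
  have fz : root (map_poly iota f) (iota (pK b) * z).
    have := rootP pz; rewrite rootE !(horner_map_wide iota _ (leqnn _)) sp sf => pz0.
    rewrite (_ : \sum_(i < m.+1) _ = iota (pK b) ^+ m * \sum_(i < m.+1) iota p`_i * z ^+ i).
      by rewrite pz0 mulr0.
    rewrite big_distrr /=; apply: eq_bigr => i _.
    have im : (i <= m)%N by rewrite -ltnS.
    have -> : iota (pK b) ^+ m = iota (pK b) ^+ (m - i) * iota (pK b) ^+ i.
      by rewrite -exprD subnK.
    rewrite fE rmorphM rmorphXn exprMn.
    by move: (iota _ ^+ (m - i)) (iota _ ^+ i) (iota p`_i) (z ^+ i) => *; ring.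
  have [h zh] := exists_minpoly (Omega_alg (iota (pK b) * z)); have [hm hz hmin] := zh.
  suff <- : h = f by [].
  apply/eqP; rewrite -eqp_monic // -dvdp_size_eqp ?hmin // eqn_leq.
  rewrite (dvdp_leq _ (hmin _ fz)) ?monic_neq0 // sf -sp /=.
  have -> : size h = size (h \Po (pK b *: 'X)).
    by rewrite size_comp_poly2 // size_scale // size_polyX.
  apply: dvdp_leq.
    rewrite -size_poly_eq0 size_comp_poly2 ?size_poly_eq0 ?monic_neq0 //.
    by rewrite size_scale // size_polyX.
  apply: pmin; rewrite rootE map_comp_poly map_polyZ map_polyX horner_comp hornerZ hornerX.
  exact: hz.
- move=> i im; case: i im => [_|i im].
    by rewrite mulr0n subn0 /g ltnn; apply: homog_of1.
  have h : (m - i.+1 < m)%N by rewrite ltn_subrL.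
  rewrite /g h subKn //=; have [hc _] := cP i.+1 im.
  have -> : d' *+ i.+1 = (d *+ i.+1 + e) + e *+ i.
    by rewrite /d' mulrnDl [e *+ i.+1]mulrS addrA.
  by apply: homog_ofM => //; apply: homog_of_exp.
Qed.

End FewGenerators.

(** * Fields generated by homogeneous elements *)

Section AdjoinedField.
Variables (R : realType) (n : nat) (alpha : 'I_n -> {posnum R}) (k : fieldType).
Hypothesis n_gt0 : (0 < n)%N.
Variables (Omega : closedFieldType) (iota : {rmorphism Khat alpha k -> Omega}).
Variables (s : nat) (gamma : 'I_s -> Omega).

Local Notation K := (Khat alpha k).
Local Notation v := (Khat_val alpha k).
Local Notation pK := (mpoly_to_Khat alpha k).
Local Notation pKw := (@Khat_weight_valued R n alpha k).
Local Notation tame := (tame alpha v pK).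
Local Notation alg := (algebraic_over iota tame).
Let tame_sub : subfield_set tame := tame_subfield pKw (@series_all _ _ alpha k).
Let alg_sub := algebraic_over_subfield iota tame_sub.

Definition tame_coefs (f : mpoly s Omega) :=
  forall m, exists2 c, tame c & mcoeff m f = iota c.

Lemma Kalpha_adjoinE z : Kalpha_adjoin iota gamma z <->
  exists f, tame_coefs f /\ z = meval gamma f.
Proof.
split=> -[f [fc zE]]; exists f; split=> // m; have [c tc cE] := fc m; exists c => //;
  exact/KalphaE.
Qed.

Lemma tame_coefsB f g : tame_coefs f -> tame_coefs g -> tame_coefs (f - g).
Proof.
move=> hf hg m; have [[c tc cE] [d td dE]] := (hf m, hg m).
exists (c - d); first exact: (subfieldB tame_sub).
by rewrite mcoeffB cE dE rmorphB.
Qed.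

Lemma tame_coefsM f g : tame_coefs f -> tame_coefs g -> tame_coefs (f * g).
Proof.
move=> hf hg m; rewrite mcoeffM.
apply: (big_ind (fun x => exists2 c, tame c & x = iota c)).
- by exists 0; [exact: (subfield0 tame_sub)|rewrite rmorph0].
- move=> _ _ [c tc ->] [d td ->]; exists (c + d); last by rewrite rmorphD.
  exact: (subfieldD tame_sub).
move=> [b1 b2] _ /=; have [[c tc ->] [d td ->]] := (hf b1, hg b2).
by exists (c * d); [exact: (subfieldM tame_sub)|rewrite rmorphM].
Qed.

Lemma Kalpha_adjoin_tame c : tame c -> Kalpha_adjoin iota gamma (iota c).
Proof.
move=> tc; apply/Kalpha_adjoinE; exists (mpolyC s (iota c)); split; last by rewrite mevalC.
move=> m; rewrite mcoeffC; case: (m == mnm0); rewrite ?mulr1 ?mulr0; first by exists c.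
by exists 0; [exact: (subfield0 tame_sub)|rewrite rmorph0].
Qed.

Lemma Kalpha_adjoin_gen j : Kalpha_adjoin iota gamma (gamma j).
Proof.
apply/Kalpha_adjoinE; exists (mpolyX Omega (mnm1 j)); split; last by rewrite mevalXU.
move=> m; rewrite mcoeffX; exists (mnm1 j == m)%:R; last by rewrite rmorph_nat.
exact: (subfield_nat tame_sub).
Qed.

Hypothesis gamma_alg : forall j, alg (gamma j).

Lemma Kalpha_adjoin_alg z : Kalpha_adjoin iota gamma z -> alg z.
Proof.
move=> /Kalpha_adjoinE[f [hf ->]]; rewrite mevalE; apply: (subfield_sum alg_sub) => m _.
apply: (subfieldM alg_sub).
  by have [c tc ->] := hf m; apply: (algebraic_over_id iota tame_sub).
apply: (big_ind alg); [exact: (subfield1 alg_sub)|exact: (subfieldM alg_sub)|].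
by move=> j _; apply: (subfieldX alg_sub).
Qed.

Lemma Kalpha_adjoin_subfield : subfield_set (Kalpha_adjoin iota gamma).
Proof.
have adjB x y : Kalpha_adjoin iota gamma x -> Kalpha_adjoin iota gamma y ->
    Kalpha_adjoin iota gamma (x - y).
  move=> /Kalpha_adjoinE[f [hf ->]] /Kalpha_adjoinE[g [hg ->]]; apply/Kalpha_adjoinE.
  by exists (f - g); rewrite mevalB; split=> //; apply: tame_coefsB.
have adjM x y : Kalpha_adjoin iota gamma x -> Kalpha_adjoin iota gamma y ->
    Kalpha_adjoin iota gamma (x * y).
  move=> /Kalpha_adjoinE[f [hf ->]] /Kalpha_adjoinE[g [hg ->]]; apply/Kalpha_adjoinE.
  by exists (f * g); rewrite mevalM; split=> //; apply: tame_coefsM.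
split=> //.
  by rewrite -(rmorph1 iota); apply: Kalpha_adjoin_tame; apply: (subfield1 tame_sub).
move=> x y hx hy; apply: (adjM) => //.
apply: (algebraic_inv_closed tame_sub Kalpha_adjoin_tame adjB adjM hy).
exact: Kalpha_adjoin_alg.
Qed.

End AdjoinedField.

Lemma Vhat_to_Khat_inj (R : realType) (n : nat) (alpha : 'I_n -> {posnum R})
  (k : fieldType) : injective (Vhat_to_Khat alpha k).
Proof. by move=> x y E; apply/eqP; rewrite -(@tofrac_eq (Vhat alpha k)); exact/eqP. Qed.

Section Roots.
Variables (R : realType) (n : nat) (alpha : 'I_n -> {posnum R}) (k : fieldType).
Hypothesis n_gt0 : (0 < n)%N.
Variables (Omega : closedFieldType) (iota : {rmorphism Khat alpha k -> Omega}).
Variable w : valuation R Omega.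
Hypothesis Omega_alg : forall z, algebraicOver iota z.
Hypothesis w_ext : forall x, w (iota x) = Khat_val alpha k x.

Local Notation K := (Khat alpha k).
Local Notation v := (Khat_val alpha k).
Local Notation pK := (mpoly_to_Khat alpha k).
Local Notation pKw := (@Khat_weight_valued R n alpha k).
Local Notation hfrac := (homog_frac alpha pK).
Local Notation tame := (tame alpha v pK).
Local Notation alg := (algebraic_over iota tame).
Local Notation all_series := (@series_all _ _ alpha k).
Let tame_sub : subfield_set tame := tame_subfield pKw all_series.
Let alg_sub := algebraic_over_subfield iota tame_sub.

Lemma homogeneous_element_alg z : homogeneous_element iota z -> alg z.
Proof.
move=> [d [p [d0 [[pm pz _] _ hp]]]]; set q := map_poly _ p in pm pz.
have sq : size q = size p.
  by apply: size_map_inj_poly; [exact: Vhat_to_Khat_inj|exact: rmorph0].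
exists q; split=> //; first exact: monic_neq0.
move=> i; have [iq|qi] := ltnP i (size q).-1.
  have -> : i = ((size p).-1 - ((size p).-1 - i))%N.
    by rewrite subKn // -sq ltnW.
  rewrite coef_map; apply: (tame_homog v (i := d * ((size p).-1 - i)%:R)).
  apply: G_alpha_homog_frac; apply: hp.
  by rewrite subn_gt0 -sq iq leq_subr.
have [->|iq] := eqVneq i (size q).-1.
  by rewrite -lead_coefE (monicP pm); apply: (subfield1 tame_sub).
rewrite nth_default; first exact: (subfield0 tame_sub).
by move: iq qi; case: (size q) => // m im mi; rewrite ltn_neqAle eq_sym im.
Qed.

Lemma alg_root (P : {poly Omega}) z : P \is monic -> (forall i, alg P`_i) ->
  root P z -> alg z.
Proof.
move=> Pm hP Pz; apply/(algebraic_overE iota tame_sub)/integral_algebraic.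
apply: integral_root_monic Pm Pz _ => x /(nthP 0)[i _ <-].
by apply/integral_algebraic/algebraic_overE.
Qed.

(** The rescaled minimal polynomial has coefficients in the valuation ring. In a
    factorisation over that ring one factor has full degree, by minimality over
    the fraction field, and the other one is a unit since the product is monic. *)
Lemma degree_elt_integral_homogeneous d z : degree_elt alpha pK iota d z ->
  exists c, [/\ c != 0, tame c & integral_homogeneous_element iota (iota c * z)].
Proof.
move=> dz.
have [b [d' [m [g [[b0 tb] d'0 m0 fmin hg]]]]] :=
  degree_elt_integral pKw all_series n_gt0 Omega_alg w_ext dz.
exists (pK b); split=> //; first by rewrite (pK_eq0 pKw).
pose p : {poly Vhat alpha k} := 'X^m + \poly_(i < m) mpoly_to_Vhat alpha k (g i).
have lowm : (size (\poly_(i < m) mpoly_to_Vhat alpha k (g i))%R < size ('X^m : {poly Vhat alpha k})%R)%N.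
  by rewrite size_polyXn ltnS size_poly.
have sp : size p = m.+1 by rewrite size_polyDl // size_polyXn.
have pm : p \is monic by rewrite monicE lead_coefDl // lead_coefXn.
have pE : map_poly (Vhat_to_Khat alpha k) p = 'X^m + \poly_(i < m) pK (g i).
  rewrite rmorphD /= map_polyXn; congr (_ + _); apply/polyP => i.
  by rewrite coef_map !coef_poly; case: ifP => // _; exact: rmorph0.
have coefp i : (0 < i <= m)%N -> p`_(m - i) = mpoly_to_Vhat alpha k (g (m - i)%N).
  move=> /andP[i0 im]; have mi : (m - i < m)%N by rewrite ltn_subrL i0.
  by rewrite coefD coefXn coef_poly mi ltn_eqF // add0r.
exists d', p; rewrite sp /=; split=> //; last first.
  move=> i i0; exists (g (m - i)%N); last exact: coefp.
  by apply: (homog_of_alpha (d := d' *+ i)); apply: hg; case/andP: i0.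
split; first by rewrite pE.
- split; first exact: monic_neq0.
    by rewrite poly_unitE sp eqSS (gtn_eqF m0).
  move=> q r qr; have := monicP pm; rewrite qr lead_coefM => lqr.
  have q0 : q != 0 by apply: contraTneq pm => q0; rewrite qr q0 mul0r monicE lead_coef0 eq_sym oner_eq0.
  have r0 : r != 0 by apply: contraTneq pm => r0; rewrite qr r0 mulr0 monicE lead_coef0 eq_sym oner_eq0.
  have smap (f : {poly Vhat alpha k}) : size (map_poly (Vhat_to_Khat alpha k) f) = size f.
    by apply: size_map_inj_poly; [exact: Vhat_to_Khat_inj|exact: rmorph0].
  have split_unit (f h : {poly Vhat alpha k}) : f != 0 -> h != 0 -> p = f * h ->
      lead_coef h \is a GRing.unit ->
      root (map_poly iota (map_poly (Vhat_to_Khat alpha k) f)) (iota (pK b) * z) ->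
      h \is a GRing.unit.
    move=> f0 h0 pfh hu fz; have [_ _ /(_ _ fz)] := fmin.
    rewrite -pE => /dvdp_leq; rewrite -size_poly_eq0 !smap size_poly_eq0 => /(_ f0).
    rewrite {1}pfh size_mul // => le; have h1 : size h = 1%N.
      apply/eqP; rewrite eqn_leq size_poly_gt0 h0 andbT.
      move: le; rewrite -(prednK (_ : 0 < size f)%N) ?size_poly_gt0 // addSn /=.
      by rewrite -[X in (_ <= X)%N]addn1 leq_add2l.
    by rewrite poly_unitE h1 eqxx /=; move: hu; rewrite lead_coefE h1.
  have [_ fz _] := fmin; move: fz; rewrite -pE qr rmorphM /= rmorphM /= rootM.
  case/orP => [qz|rz]; [right; apply: (split_unit q r)|left; apply: (split_unit r q)] => //.
  + by apply/unitrPr; exists (lead_coef q); rewrite mulrC lqr.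
  + by rewrite mulrC.
  + by apply/unitrPr; exists (lead_coef r).
- rewrite sp /= => i i0; rewrite (coefp i i0) mulr_natr.
  apply: (homog_frac_G_alpha (i := d' *+ i)); apply: homog_frac_poly.
  by apply: hg; case/andP: i0.
Qed.

Lemma homog_span_generators (rs : seq Omega) :
    (forall z, z \in rs -> homog_span alpha v pK iota z) ->
  exists l : seq Omega, (forall y, y \in l -> exists d, degree_elt alpha pK iota d y) /\
    forall T : set Omega, subfield_set T -> (forall x, tame x -> T (iota x)) ->
      (forall y, y \in l -> T y) -> forall z, z \in rs -> T z.
Proof.
elim: rs => [_|z rs IH zrsP]; first by exists [::].
have [|l [lP lT]] := IH; first by move=> y yrs; apply: zrsP; rewrite inE yrs orbT.
have [t tP zE] := zrsP z (mem_head _ _).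
exists ([seq u.2 | u <- t] ++ l); split.
  by move=> y; rewrite mem_cat => /orP[/mapP[u /tP[_ du] ->]|/lP].
move=> T hT tT Tl y; rewrite inE => /orP[/eqP ->|yrs]; last first.
  by apply: lT yrs => // x xl; apply: Tl; rewrite mem_cat xl orbT.
rewrite zE big_seq; apply: (subfield_sum hT) => u ut; apply: (subfieldM hT).
  by apply: tT; case: (tP u ut).
by apply: Tl; rewrite mem_cat map_f.
Qed.

End Roots.

Lemma Khat_char0 (R : realType) (n : nat) (alpha : 'I_n -> {posnum R}) (k : fieldType) :
  [pchar k] =i pred0 -> [pchar (Khat alpha k)] =i pred0.
Proof.
move=> /pcharf0P k0; apply/pcharf0P => m.
rewrite -(rmorph_nat (mpoly_to_Khat alpha k)) (pK_eq0 (@Khat_weight_valued R n alpha k)).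
rewrite -k0; apply/eqP/eqP => [/(congr1 (mcoeff mnm0))|m0].
  by rewrite mcoeffMn mcoeff1 eqxx mcoeff0.
by apply/mpolyP => u; rewrite mcoeffMn mcoeff1 mcoeff0 -[_ *+ m]mulr_natl m0 mul0r.
Qed.

Theorem theorem5p12 (R : realType) (k : fieldType) (n : nat)
    (alpha : 'I_n -> {posnum R}) (N : nat)
    (Omega : closedFieldType) (iota : {rmorphism Khat alpha k -> Omega})
    (w : valuation R Omega)
    (s : nat) (gamma : 'I_s -> Omega) (P : {poly Omega})
    (k_char0 : [pchar k] =i pred0)
    (n_ge2 : (2 <= n)%N)
    (N_dim : has_rat_dim (rat_span (fun j => (alpha j)%:num)) N)
    (Omega_alg : forall z, algebraicOver iota z)
    (w_ext : forall x, w (iota x) = Khat_val alpha k x)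
    (gamma_homog : forall j, homogeneous_element iota (gamma j))
    (P_monic : P \is monic)
    (P_coef : forall j, Valpha_adjoin iota w gamma P`_j) :
  exists gamma' : 'I_N -> Omega,
    (forall j, integral_homogeneous_element iota (gamma' j)) /\
    (forall z, root P z -> Valpha_adjoin iota w gamma' z).
Proof.
have n0 : (0 < n)%N by apply: ltn_trans n_ge2.
have pKw := @Khat_weight_valued R n alpha k.
have ser := @series_all R n alpha k.
have K0 := Khat_char0 alpha k_char0.
(* [N = 0] is impossible: the weights are positive, so their span is not zero. *)
case: N N_dim => [|N'] [e [_ spanE]].
  have span_alpha j0 : rat_span (fun j => (alpha j)%:num) (alpha j0)%:num.
    exists (fun j => (j == j0)%:R) => //.
    rewrite (bigD1 j0) //= eqxx ratr_nat mul1r big1 ?addr0 // => j /negbTE ->.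
    by rewrite ratr_nat mul0r.
  have := span_alpha (Ordinal n0); rewrite spanE => -[q _]; rewrite big_ord0 => a0.
  have : 0 < (alpha (Ordinal n0))%:num by [].
  by rewrite -a0 ltxx.
have gamma_alg j := homogeneous_element_alg (gamma_homog j).
have [rs Prs] := closed_field_poly_normal P.
rewrite (monicP P_monic) scale1r in Prs.
have [|l [l_deg lT]] := @homog_span_generators _ _ alpha k _ iota rs.
  move=> z; rewrite (mem_rootsE _ Prs) => Pz.
  apply: (algebraic_homog_span pKw ser n0 K0 (Khat_complete n0) Omega_alg w_ext).
  apply: (alg_root P_monic _ Pz) => i.
  by apply: (Kalpha_adjoin_alg n0 gamma_alg); case: (P_coef i).
have [c [c_deg cT]] := degree_elt_generators pKw ser K0 spanE l_deg.
have /choice[b bP] : forall j, exists b : Khat alpha k, [/\ b != 0,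
    tame alpha (Khat_val alpha k) (mpoly_to_Khat alpha k) b &
    integral_homogeneous_element iota (iota b * c j)].
  by move=> j; have [d dj] := c_deg j; apply: (degree_elt_integral_homogeneous n0 Omega_alg w_ext dj).
pose gamma' j := iota (b j) * c j.
have gamma'_int j : integral_homogeneous_element iota (gamma' j) by case: (bP j).
exists gamma'; split=> //.
move=> z Pz; split; last first.
  apply: (root_val_ge0 _ _ Pz); first by rewrite (monicP P_monic) val1.
  by move=> i; case: (P_coef i).
have gamma'_alg j : algebraic_over iota
    (tame alpha (Khat_val alpha k) (mpoly_to_Khat alpha k)) (gamma' j).
  have [d [p [d0 hp _]]] := gamma'_int j.
  by apply: homogeneous_element_alg; exists d, p.
have adj_sub := Kalpha_adjoin_subfield n0 gamma'_alg.
have adj_tame x := @Kalpha_adjoin_tame _ _ alpha k n0 _ iota _ gamma' x.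
apply: (lT _ adj_sub adj_tame); last by rewrite (mem_rootsE _ Prs).
apply: (cT _ adj_sub adj_tame) => j; have [b0 tb _] := bP j.
have ib0 : iota (b j) != 0 by rewrite fmorph_eq0.
rewrite -(mulKf ib0 (c j)) mulrC; apply: (subfield_div adj_sub); last exact: adj_tame.
exact: (Kalpha_adjoin_gen n0 iota gamma').
Qed.
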